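(* Let $H$ be a strictly $2$-balanced graph with $h$ vertices and $k$ edges, and fix $0<c<\left(\frac{e}{k-1}\right)^{\frac{1}{k-1}}$. Let $x^\ast=\left(\frac{W((k-1)c^{k-1})}{k-1}\right)^{\frac{1}{k-1}}$. If $p\sim c\,\Delta_H^{-\frac{1}{k-1}}$ (equivalently $p\sim c\left(\frac{|\mathrm{Aut}(H)|}{2k}\right)^{\frac{1}{k-1}}n^{-1/m_2(H)}$), then $$\lim_{n\to\infty}\Delta_H^{\frac{1}{k-1}}\binom{n}{2}^{-1}\log\mathbb{P}_p(\mathbf X_H=0)=x^\ast+\left(1-\frac1k\right)(x^\ast)^k-c.$$ Moreover, if $0<b<(k-1)^{-\frac{1}{k-1}}$ is fixed and $m\sim b\,\Delta_H^{-\frac{1}{k-1}}\binom n2$, then $$\lim_{n\to\infty}\Delta_H^{\frac{1}{k-1}}\binom{n}{2}^{-1}\log\mathbb{P}_m(\mathbf X_H=0)=-\frac{b^k}{k},$$ i.e. $\log\mathbb{P}_m(\mathbf X_H=0)\sim-\mathbb{E}_m\mathbf X_H$.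
   Context: For a graph $H$, $m_2(H)=\max_{F\subseteq H,|V(F)|\ge3}\frac{|E(F)|-1}{|V(F)|-2}$; $H$ (with $|E(H)|\ge3$) is strictly $2$-balanced if this maximum is attained uniquely at $F=H$. $\mathbf X_H$ denotes the number of copies of $H$ in the random graph; $\mathbb{P}_p,\mathbb{E}_p$ refer to $G(n,p)$ and $\mathbb{P}_m,\mathbb{E}_m$ to $G(n,m)$ (uniform graph on $[n]$ with $m$ edges). $\mathrm{Aut}(H)$ is the automorphism group of $H$, $(n)_j=n(n-1)\cdots(n-j+1)$, and $\Delta_H=\frac{2k\,(n-2)_{h-2}}{|\mathrm{Aut}(H)|}$ (the number of copies of $H$ in $K_n$ containing a given edge). $W$ is the Lambert $W$ function (inverse of $y\mapsto ye^y$ on $[0,\infty)$). $f\sim g$ means $f/g\to1$ as $n\to\infty$. *)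

(* Defs.v *)
From HB Require Import structures.
From mathcomp Require Import all_boot all_order all_algebra all_fingroup.
From mathcomp Require Import all_classical all_reals all_analysis.
Set Implicit Arguments. Unset Strict Implicit. Unset Printing Implicit Defensive.
Import Order.TTheory GRing.Theory Num.Theory.
Local Open Scope ring_scope.

(* A simple graph on a finite vertex type V is a set H of 2-element subsets
   of V (its edge set); its vertex set is all of V. *)
Definition simple_graph (V : finType) (H : {set {set V}}) : Prop :=
  forall e, e \in H -> #|e| = 2%N.

Definition d2 (nv ne : nat) : rat := (ne%:Q - 1) / (nv%:Q - 2).

(* Strictly 2-balanced: k >= 3 and d2 is maximised (over subgraphs F with
   at least 3 vertices) uniquely at F = H.  Subgraphs are pairs (S,E) with
   E \subset H and every edge of E inside S. *)
Definition strictly_2_balanced (V : finType) (H : {set {set V}}) : Prop :=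
  (3 <= #|H|)%N /\
  forall (S : {set V}) (E : {set {set V}}),
    E \subset H -> (forall e, e \in E -> e \subset S) -> (3 <= #|S|)%N ->
    (S, E) <> ([set: V], H) -> d2 #|S| #|E| < d2 #|V| #|H|.

Definition aut_card (V : finType) (H : {set {set V}}) : nat :=
  #|[set s : {perm V} | [set s @: (e : {set V}) | e in H] == H]|.

Definition DeltaH (R : realType) (V : finType) (H : {set {set V}}) (n : nat) : R :=
  (2 * #|H|)%:R * ((n - 2) ^_ (#|V| - 2))%:R / (aut_card H)%:R.

Definition Kn (n : nat) : {set {set 'I_n}} := [set e : {set 'I_n} | #|e| == 2%N].

Definition copies (V : finType) (H : {set {set V}}) (n : nat) : {set {set {set 'I_n}}} :=
  [set [set (fun v => (f : {ffun V -> 'I_n}) v) @: (e : {set V}) | e in H]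
    | f in [set f : {ffun V -> 'I_n} | injectiveb f]].

Definition XH (V : finType) (H : {set {set V}}) (n : nat) (G : {set {set 'I_n}}) : nat :=
  #|[set F in copies H n | F \subset G]|.

Definition Pp_free (R : realType) (V : finType) (H : {set {set V}}) (n : nat) (p : R) : R :=
  \sum_(G : {set {set 'I_n}} | G \subset Kn n)
     p ^+ #|G| * (1 - p) ^+ (#|Kn n| - #|G|) * (XH H G == 0%N)%:R.

Definition Pm_free (R : realType) (V : finType) (H : {set {set V}}) (n m : nat) : R :=
  (#|[set G : {set {set 'I_n}} | [&& G \subset Kn n, #|G| == m & XH H G == 0%N]]|)%:R
  / ('C(#|Kn n|, m))%:R.

Definition LambertW (R : realType) (x : R) : R :=
  xget 0 [set y : R | 0 <= y /\ y * expR y = x]%classic.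

(* Main.v *)
(** The graphs avoiding [H] are the independent sets of the hypergraph whose vertices are
    the edges of [K_n] and whose hyperedges are the copies of [H], so that
    [P_p(X_H = 0) = (1 - p)^N Z(p / (1 - p))], where [Z] is the hard-core partition function and
    [N = binom(n, 2)].  Strict 2-balancedness makes all codegrees of this [Delta]-regular,
    [k]-uniform hypergraph negligible.  Put [s = Delta^(-1/(k-1))] and [lam = s t].  Conditioning on a
    vertex being occupied expresses its occupation ratio as [lam] times a product, over the hyperedges
    through it, of probabilities that the rest of the hyperedge is not occupied.  Since boundedly many
    conditionings perturb the hypergraph only negligibly, upper bounds [x s] on the ratio turn into lower
    bounds [t exp(- x^(k-1)) s] and conversely.  Two such steps contract around the solution of
    [x exp(x^(k-1)) = t] as long as [(k-1) x^(k-1) < 1], so all occupation ratios are close to [x s];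
    integrating the logarithmic derivative of [Z] gives [ln Z ~ N s (x + (k-1)/k x^k)], uniformly.
    In [G(n,m)] the upper bound is the Chernoff estimate [a_m <= Z(lam) / lam^m] for the number [a_m] of
    independent sets of size [m]; for the lower bound, the largest term of [Z(lam)] has index close to
    [x N s], and [a_m / binom(N, m)] decreases in [m]. *)

Require Import Defs.
From HB Require Import structures.
From mathcomp Require Import all_boot all_order all_algebra all_fingroup.
From mathcomp Require Import all_classical all_reals all_analysis.
From mathcomp Require Import ring lra zify.
(* Imported last so that the finset lemmas and notations shadow those of classical_sets. *)
From mathcomp Require Import seq fintype bigop finset.
Set Implicit Arguments. Unset Strict Implicit. Unset Printing Implicit Defensive.
Import Order.TTheory GRing.Theory Num.Theory.
Import numFieldNormedType.Exports.
Local Open Scope ring_scope.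

(** * Real inequalities and derivatives *)

Section Numeric.
Variable R : realType.
Implicit Types x y z a b u e t : R.

(** In logarithmic coordinates around the fixed point one step of the recursion has slope [- u],
    where [u = (k-1) x^(k-1)]; a round trip therefore contracts by [u^2] as soon as [u < 1]. Both
    thresholds of the theorem are the point [u = 1]: for [b] directly with [x = b], for [c] through
    [x exp(x^(k-1)) = (e/(k-1))^(1/(k-1))] there. The obstacle is that conditioning alters the
    hypergraph: occupied vertices shorten edges, and the links of a vertex are added as new
    constraints one at a time. So every bound is proved for all states whose family contains the
    untouched edges and consists of links of original ones ([valid]), with a budget on the number of
    touched vertices. A step consumes [k] of this budget. The number of round trips depends only on
    [u] and the precision wanted, so the budget, and after it the admissible codegree error [d], can
    be fixed before [n]. Upper bounds also suffer from links that contain a smaller constraint.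
    Counting those needs, besides codegrees, the number of edges at [v] that stay edges when [v] is
    replaced by another vertex; for copies of [H] it is small because deleting one edge of [H]
    isolates no vertex. *)

Lemma le_of_derive_ge0 (f df : R -> R) a b : a <= b ->
  (forall x, a <= x <= b -> is_derive x 1 f (df x)) ->
  (forall x, a < x < b -> 0 <= df x) -> f a <= f b.
Proof.
move=> ab fd df0; move: (ab); rewrite le_eqVlt => /predU1P[->//|ab'].
have [x||c] := @MVT R f df a b ab'.
- by rewrite in_itv /= => /andP[ax xb]; apply: fd; rewrite !ltW.
- apply: derivable_within_continuous => x; rewrite in_itv /= => /fd h.
  exact: ex_derive.
by rewrite in_itv /= => /df0 c0 /eqP; rewrite subr_eq => /eqP ->; rewrite lerDr mulr_ge0 // subr_ge0.
Qed.

Lemma is_derive1D (f g : R -> R) x df dg : is_derive x 1 f df -> is_derive x 1 g dg ->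
  is_derive x 1 (fun y => f y + g y) (df + dg).
Proof. by move=> *; apply: is_deriveD. Qed.

Lemma is_derive1B (f g : R -> R) x df dg : is_derive x 1 f df -> is_derive x 1 g dg ->
  is_derive x 1 (fun y => f y - g y) (df - dg).
Proof. by move=> *; apply: is_deriveB. Qed.

Lemma is_derive1Z (f : R -> R) c x df : is_derive x 1 f df ->
  is_derive x 1 (fun y => c * f y) (c * df).
Proof. by move=> *; apply: is_deriveZ. Qed.

Lemma is_derive1M (f g : R -> R) x df dg : is_derive x 1 f df -> is_derive x 1 g dg ->
  is_derive x 1 (fun y => f y * g y) (f x * dg + g x * df).
Proof. by move=> *; apply: is_deriveM. Qed.

Lemma is_derive1N (f : R -> R) x df : is_derive x 1 f df ->
  is_derive x 1 (fun y => - f y) (- df).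
Proof. by move=> *; apply: is_deriveN. Qed.

Lemma is_derive1c c x : is_derive x 1 ((fun=> c) : R -> R) 0.
Proof. exact: is_derive_cst. Qed.

Lemma is_derive1_id x : is_derive x 1 ((fun y => y) : R -> R) 1.
Proof. exact: is_derive_id. Qed.

Lemma is_derive1_chain (f g : R -> R) x df dg : is_derive (g x) 1 f df -> is_derive x 1 g dg ->
  is_derive x 1 (fun y => f (g y)) (df * dg).
Proof. by move=> *; apply: is_derive1_comp. Qed.

Lemma is_derive1Xn n x : is_derive x 1 ((fun y => y ^+ n) : R -> R) (n%:R * x ^+ n.-1).
Proof.
have -> : ((fun y => y ^+ n) : R -> R) = (id : R -> R) ^+ n.
  by apply/funext => y; rewrite exprfctE.
have h := is_deriveX n (is_derive1_id x : is_derive x 1 (id : R -> R) 1).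
by apply: (is_derive_eq h); rewrite /GRing.scale /= mulr1.
Qed.

Lemma expR_opp_ln a : 0 <= a -> 1 <= ln (1 + a) + expR (- a).
Proof.
move=> a0.
have := @le_of_derive_ge0 (fun x => ln (1 + x) + expR (- x)) (fun x => (1 + x)^-1 - expR (- x)) 0 a a0.
rewrite addr0 ln1 oppr0 expR0 add0r; apply => x /andP[x0 xa].
  have x1 : 0 < 1 + x by lra.
  have := is_derive1D (is_derive1_chain (is_derive1_ln x1) (is_derive1D (is_derive1c 1 x) (is_derive1_id x)))
    (is_derive1_chain (is_derive_expR (- x)) (is_derive1N (is_derive1_id x))).
  by move=> /is_derive_eq; apply; rewrite add0r !mulr1 mulrN1.
have x1 : 0 < 1 + x by lra.
rewrite subr_ge0 expRN lef_pV2 ?posrE ?expR_gt0 //; exact: expR_ge1Dx.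
Qed.

(** This holds for every [a >= 0], not only near 0, which is why the contraction below needs no
    small initial error. *)
Lemma expR_1BN_le a : 0 <= a -> expR (1 - expR (- a)) <= 1 + a.
Proof.
move=> a0; rewrite -[leRHS]lnK ?posrE; last by lra.
by rewrite ler_expR; have := expR_opp_ln a0; lra.
Qed.

Lemma expR_chord u z : 0 <= u <= 1 -> 0 <= z -> expR (u * z) - 1 <= u * (expR z - 1).
Proof.
move=> /andP[u0 u1] z0.
have := @le_of_derive_ge0 (fun x => u * expR x - expR (u * x))
  (fun x => u * expR x - expR (u * x) * u) 0 z z0.
rewrite mulr0 expR0 mulr1 => h.
suff : u - 1 <= u * expR z - expR (u * z) by lra.
apply: h => x /andP[x0 xz].
  have := is_derive1B (is_derive1Z u (is_derive_expR x))
    (is_derive1_chain (is_derive_expR (u * x)) (is_derive1Z u (is_derive1_id x))).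
  by rewrite mulr1.
by rewrite [X in _ - X]mulrC -mulrBr mulr_ge0 // subr_ge0 ler_expR ler_piMl ?(ltW x0).
Qed.

Lemma expR_le_inv z : z < 1 -> expR z <= (1 - z)^-1.
Proof.
move=> z1; have z0 : 0 < 1 - z by lra.
rewrite -[expR z]invrK lef_pV2 ?posrE ?invr_gt0 ?expR_gt0 //.
by rewrite -expRN; apply: expR_ge1Dx.
Qed.

Lemma expR1_le4 : expR 1 <= 4 :> R.
Proof.
have h : expR (2^-1) <= 2 :> R.
  apply: le_trans (expR_le_inv _) _; first lra.
  by rewrite invf_ple ?posrE; lra.
have -> : expR 1 = expR 2^-1 * expR 2^-1 :> R by rewrite -expRD; congr expR; lra.
have := expR_gt0 (2^-1 : R); nra.
Qed.

Lemma expR_sub1_le2 e : 0 <= e <= 2^-1 -> expR e - 1 <= 2 * e.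
Proof.
move=> /andP[e0 e1]; rewrite lerBlDr; apply: le_trans (expR_le_inv _) _; first lra.
by rewrite -[(1 - e)^-1]mul1r ler_pdivrMr; nra.
Qed.

(* One round trip of the recursion, in logarithmic coordinates around the fixed point,
   contracts by the factor [u ^ 2]. *)
Lemma two_step_contract u a e : 0 <= u <= 1 -> 0 <= a -> 0 <= e <= 2^-1 ->
  u * (expR (u * (1 - expR (- a)) + e) - 1) + e <= u ^+ 2 * a + 9 * e.
Proof.
move=> /andP[u0 u1] a0 /andP[e0 e1].
have ea : 0 <= 1 - expR (- a) <= 1.
  rewrite subr_ge0 -expR0 ler_expR oppr_le0 a0 /= expR0 lerBlDr lerDl; exact: expR_ge0.
set y := u * (1 - expR (- a)).
have y1 : 0 <= y <= 1 by case/andP: (ea) => ? ?; rewrite /y mulr_ge0 //= mulr_ile1.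
have ey : expR y <= 4.
  by apply: le_trans expR1_le4; rewrite ler_expR; case/andP: y1.
have ee := @expR_sub1_le2 e; rewrite e0 e1 in ee.
(* Convexity of exp pulls the factor [u] out of the exponent; what remains is
   [exp (1 - exp (- a)) - 1 <= a]. *)
have hy : expR y - 1 <= u * a.
  have := @expR_chord u (1 - expR (- a)); rewrite u0 u1 => /(_ isT).
  case/andP: ea => -> _ /(_ isT) /le_trans; apply; rewrite ler_wpM2l //.
  by have := expR_1BN_le a0; lra.
rewrite expRD.
(* The 8 is [exp y <= 4] times [exp e - 1 <= 2 e]; the [e] outside the bracket raises it to 9. *)
have h1 : expR y * expR e - 1 <= u * a + 8 * e.
  have := expR_gt0 y; have := ee isT; have : 1 <= expR e by rewrite -expR0 ler_expR.
  nra.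
nra.
Qed.

End Numeric.

(** * Arithmetic of the error terms in the limit arguments *)

Section Inequalities.
Variable R : realFieldType.

(** With [Q = q] and [w = z^(q-1)] the left side is the derivative at [z] of the free energy minus
    [x] times the logarithmic activity; the right side displays its sign. *)
Lemma slope_factor (x z Q w : R) : z != 0 ->
  1 + Q * (z * w) - x * (z^-1 + Q * w) = (1 + Q * (z * w)) * ((z - x) / z).
Proof. by move=> z0; field. Qed.

Lemma subr_le_swap (a b c d : R) : a - b <= c - d -> d - b <= c - a.
Proof. by lra. Qed.

Lemma bracket_arith (M e f f1 f2 z z1 z2 : R) : 0 < M -> f - e / 2 <= f1 -> f2 <= f + e / 2 ->
  M * f1 - e / 2 * M <= z1 -> z2 <= M * f2 + e / 2 * M -> z1 <= z -> z <= z2 ->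
  `|f - z / M| <= e.
Proof.
move=> M0 ff1 ff2 z1M z2M z1z zz2.
have F1 := ler_wpM2l (ltW M0) ff1; have F2 := ler_wpM2l (ltW M0) ff2.
rewrite distrC ler_distl ler_pdivlMr // ler_pdivrMr //; apply/andP; split; nra.
Qed.

(** Here [m] is the index of the dominant term of the partition function at log-activity [ls + T1],
    and [a] is the logarithm of its coefficient. Comparing with the same term at [T0] eliminates
    [a]. The loss [3 * tau] comes from two approximations of [ln Z] and one factor for the number of
    terms. *)
Lemma level_ge_arith (M tau x T0 T1 f0 f1 z0 z1 l a ls m y : R) :
  z1 <= l + (a + m * (ls + T1)) -> a + m * (ls + T0) <= z0 ->
  M * f1 - tau * M <= z1 -> z0 <= M * f0 + tau * M -> l <= tau * M ->
  x * (T1 - T0) <= f1 - f0 -> 0 < M -> T0 < T1 ->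
  y * (T1 - T0) <= x * (T1 - T0) - 3 * tau -> y * M <= m.
Proof.
move=> h1 h2 h3 h4 h5 h6 M0 TT h7.
have T10 : 0 < T1 - T0 by lra.
have h8 := ler_wpM2r (ltW M0) h6; have h9 := ler_wpM2r (ltW M0) h7.
rewrite -(ler_pM2r T10); nra.
Qed.

Lemma level_le_arith (M tau x T1 T2 f1 f2 z1 z2 l a ls m y : R) :
  z1 <= l + (a + m * (ls + T1)) -> a + m * (ls + T2) <= z2 ->
  M * f1 - tau * M <= z1 -> z2 <= M * f2 + tau * M -> l <= tau * M ->
  f2 - f1 <= x * (T2 - T1) -> 0 < M -> T1 < T2 ->
  x * (T2 - T1) + 3 * tau <= y * (T2 - T1) -> m <= y * M.
Proof.
move=> h1 h2 h3 h4 h5 h6 M0 TT h7.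
have T10 : 0 < T2 - T1 by lra.
have h8 := ler_wpM2r (ltW M0) h6; have h9 := ler_wpM2r (ltW M0) h7.
rewrite -(ler_pM2r T10); nra.
Qed.

Lemma Pm_ge_arith (M tau x xq f z l a ls lN lm lx m y lC : R) :
  z <= l + (a + m * (ls + (lx + xq))) -> M * f - tau * M <= z -> l <= tau * M ->
  lC <= m * (1 + lN - lm) -> m * (lx + (lN + ls)) + m - x * M <= m * lm ->
  m <= y * M -> 0 <= xq -> M * (f - x - y * xq - 2 * tau) <= a - lC.
Proof.
move=> h1 h2 h3 h4 h5 h6 xq0.
have h7 := ler_wpM2r xq0 h6; nra.
Qed.

Lemma Pm_le_arith (M tau f z a ls lN lm ly m y T lC dN lNm : R) :
  a + m * (ls + T) <= z -> z <= M * f + tau * M -> 1 + lm <= tau * M ->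
  m * (1 + lNm - lm) - (1 + lm) <= lC -> lm = ly + (lN + ls) -> lN - lNm <= dN ->
  0 <= m -> m = y * M ->
  a - lC <= M * (f + 2 * tau + (y * ly - y * T - y) + y * dN).
Proof.
move=> h1 h2 h3 h4 h5 h6 m0 my.
have h7 := ler_wpM2l m0 h6; subst lm.
have -> : M * (f + 2 * tau + (y * ly - y * T - y) + y * dN) =
  M * f + 2 * (tau * M) + (m * ly - m * T - m) + m * dN by rewrite my; ring.
nra.
Qed.

Lemma slope_slack (b r L tau : R) : tau <= r / 2 * L / 3 ->
  (b + r / 2) * L <= (b + r) * L - 3 * tau.
Proof. by nra. Qed.

Lemma slope_slack' (b r L tau : R) : tau <= r * L / 3 ->
  (b + 3 * r) * L + 3 * tau <= (b + 4 * r) * L.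
Proof. by nra. Qed.

Lemma tangent_arith (j l lj x : R) : 0 < j -> l - lj <= x / j - 1 -> j * l + j - x <= j * lj.
Proof.
move=> j0 /(ler_wpM2l (ltW j0)); rewrite [leRHS]mulrBr mulrCA mulfV ?gt_eqF // !mulr1.
by nra.
Qed.

Lemma half_slack (a e p tau : R) : a - e / 2 <= p -> tau <= e / 4 -> a - e <= p - 2 * tau.
Proof. by lra. Qed.

Lemma quarter_slack (b d e : R) : 32 * b * d <= e -> 2 * b * (2 * d) <= e / 8.
Proof. by nra. Qed.

Lemma double_slack (N m d : R) : 0 < N -> m / N < d -> m <= 2^-1 * N -> 0 <= d ->
  m <= 2 * d * (N - m).
Proof. by move=> N0; rewrite ltr_pdivrMr //; nra. Qed.

Lemma div_subE (N m : R) : N - m != 0 -> N / (N - m) = 1 + m / (N - m).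
Proof. by move=> Nm; field. Qed.

Lemma sum_slack (f B w y dN e : R) : 0 < e -> f + B = - w -> y < B + e / 8 -> dN <= e / 8 ->
  f + 2 * (e / 8) + y + dN <= - w + e.
Proof. by lra. Qed.

End Inequalities.

(** * The hard-core partition function of a constraint family *)

Section HardCore.
Variables (R : realFieldType) (T : finType) (lam : R).
Hypothesis lam_ge0 : 0 <= lam.
Implicit Types (U X g : {set T}) (E : {set {set T}}) (v : T).

Definition indep E X := [forall f in E, ~~ (f \subset X)].

Lemma indepP E X : reflect (forall f, f \in E -> ~~ (f \subset X)) (indep E X).
Proof. exact: (iffP forall_inP). Qed.

Lemma indepU E E' X : indep (E :|: E') X = indep E X && indep E' X.
Proof.
apply/indepP/andP => [H|[/indepP H /indepP H'] f].
  by split; apply/indepP => f fE; apply: H; rewrite in_setU fE ?orbT.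
by rewrite in_setU => /orP[/H|/H'].
Qed.

Lemma indep1 g X : indep [set g] X = ~~ (g \subset X).
Proof.
apply/indepP/idP => [|H f]; first by apply; rewrite in_set1.
by rewrite in_set1 => /eqP ->.
Qed.

Definition hcZ U E : R := \sum_(X : {set T} | (X \subset U) && indep E X) lam ^+ #|X|.

Definition hcW U E g : R :=
  \sum_(X : {set T} | [&& X \subset U, indep E X & g \subset X]) lam ^+ #|X|.

Definition del v E : {set {set T}} := [set f :\ v | f in E].

Lemma hcZ_ge0 U E : 0 <= hcZ U E.
Proof. by apply: sumr_ge0 => X _; rewrite exprn_ge0. Qed.

Lemma hcW0 U E : hcW U E set0 = hcZ U E.
Proof. by apply: eq_bigl => X; rewrite sub0set andbT. Qed.

Lemma hcW_nsub U E g : ~~ (g \subset U) -> hcW U E g = 0.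
Proof.
move=> gU; rewrite /hcW big_pred0 // => X; apply/and3P => -[XU _ gX].
by rewrite (fintype.subset_trans gX XU) in gU.
Qed.

Lemma hcZ_addc U E g : hcZ U (g |: E) = hcZ U E - hcW U E g.
Proof.
apply/eqP; rewrite -subr_eq opprK eq_sym; apply/eqP.
rewrite /hcZ (bigID (fun X => g \subset X)) /= addrC; congr (_ + _).
  by apply: eq_bigl => X; rewrite indepU indep1 -andbA; congr (_ && _); rewrite andbC.
by apply: eq_bigl => X; rewrite andbA.
Qed.

Lemma le_hcZ U E E' : E \subset E' -> hcZ U E' <= hcZ U E.
Proof.
move=> EE'; rewrite -(setUidPr EE').
rewrite /hcZ [leRHS](bigID (indep E')) /= -[leLHS]addr0 lerD //.
  rewrite le_eqVlt; apply/orP; left; apply/eqP; apply: eq_bigl => X.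
  by rewrite indepU andbA.
by apply: sumr_ge0 => X _; rewrite exprn_ge0.
Qed.

Lemma indep_del v E X : v \notin X -> indep (del v E) X = indep E (v |: X).
Proof.
move=> vX; apply/indepP/indepP => H f.
  move=> fE; have := H (f :\ v) (imset_f _ fE); apply: contra.
  by rewrite subDset.
by case/imsetP => f0 f0E ->; rewrite subDset; apply: H.
Qed.

Lemma hcW_rec U E v g : v \in U -> v \notin g ->
  hcW U E (v |: g) = lam * hcW (U :\ v) (del v E) g.
Proof.
move=> vU vg; rewrite /hcW big_distrr /=.
rewrite (reindex_onto (fun X => v |: X) (fun X => X :\ v)) /=; last first.
  by move=> X /and3P[_ _]; rewrite subUset sub1set => /andP[vX _]; rewrite setD1K.
apply: eq_big => [X|X /andP[_ /eqP XE]]; last first.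
  have vX : v \notin X by rewrite -XE setD11.
  by rewrite cardsU1 vX exprS.
have [vX|vX] := boolP (v \in X).
  have -> : (X \subset U :\ v) = false.
    by apply/negP => /subsetP/(_ _ vX); rewrite setD11.
  apply/andP => -[_ /eqP]; move/setP/(_ v).
  by rewrite vX setD11.
rewrite setU1K // eqxx andbT subUset sub1set vU /= indep_del //.
rewrite subsetD1 vX andbT.
congr [&& _, _ & _]; apply/idP/idP => [|h].
  rewrite subUset => /andP[_ /subsetP h]; apply/subsetP => y yg.
  by have := h y yg; rewrite in_setU1; case: eqVneq => // yv; rewrite -yv yg in vg.
by rewrite setUS.
Qed.

Lemma hcZ_rec U E v : v \in U ->
  hcZ U E = hcZ (U :\ v) E + lam * hcZ (U :\ v) (del v E).
Proof.
move=> vU; rewrite -hcW0 -[in RHS]hcW0.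
rewrite -[hcZ (U :\ v) (del v E)]hcW0 -hcW_rec ?in_set0 // setU0.
rewrite [LHS](bigID (fun X => v \in X)) /= addrC; congr (_ + _).
  by apply: eq_bigl => X; rewrite !sub0set !andbT subsetD1 -!andbA; congr (_ && _); rewrite andbC.
by apply: eq_bigl => X; rewrite !sub0set !andbT sub1set andbA.
Qed.

(** A set avoiding [v] cannot contain an edge through [v], so these edges may be kept next to their
    shortened versions. Occupying [v] thus amounts to adding the links of [v] to an unchanged
    family, and the occupation ratio becomes a probability in the state where [v] is empty. *)
Lemma hcZ_del v U E :
  hcZ (U :\ v) (del v E) = hcZ (U :\ v) (E :|: [set f :\ v | f in [set f in E | v \in f]]).
Proof.
apply: eq_bigl => X; have [XU|//] := boolP (X \subset U :\ v); rewrite /=.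
have vX : v \notin X by move: XU; rewrite subsetD1 => /andP[].
apply/indepP/indepP => H f.
  rewrite in_setU => /orP[fE|].
    by have := H _ (imset_f _ fE); apply: contra; apply: fintype.subset_trans (subD1set _ _).
  by case/imsetP => f0; rewrite inE => /andP[f0E _] ->; apply: H; apply: imset_f.
case/imsetP => f0 f0E ->; have [vf|vf] := boolP (v \in f0).
  by apply: H; rewrite in_setU; apply/orP; right; apply: imset_f; rewrite inE f0E.
have -> : f0 :\ v = f0 by apply/setP => y; rewrite !inE; case: eqVneq => // ->; rewrite (negbTE vf).
by apply: H; rewrite in_setU f0E.
Qed.

Lemma hcZ_del_le v U E : hcZ (U :\ v) (del v E) <= hcZ (U :\ v) E.
Proof. by rewrite hcZ_del le_hcZ // subsetUl. Qed.

Lemma hcZ_set0 U E : set0 \in E -> hcZ U E = 0.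
Proof.
move=> h; rewrite /hcZ big_pred0 // => X; apply/andP => -[_ /indepP/(_ _ h)].
by rewrite sub0set.
Qed.

Lemma hcZ_ge1 U E : set0 \notin E -> 1 <= hcZ U E.
Proof.
move=> h; rewrite /hcZ (bigD1 set0) /=; last first.
  rewrite sub0set; apply/indepP => f fE; rewrite subset0; apply: contraNneq h => <-.
  by [].
by rewrite cards0 expr0 lerDl sumr_ge0 // => X _; rewrite exprn_ge0.
Qed.

End HardCore.

(** * States reached by conditioning *)

Section Links.
Variables (R : realFieldType) (T : finType) (lam : R).
Hypothesis lam_ge0 : 0 <= lam.
Variables (G : {set T}) (E0 : {set {set T}}).
Implicit Types (C U X g : {set T}) (E : {set {set T}}) (u v : T).

Local Notation Z := (hcZ lam).
Local Notation W := (hcW lam).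

(* [link C g]: [g] is what remains of an original constraint once part of it,
   inside [C], has been occupied. *)
Definition link C g := [exists f in E0, (g \subset f) && (f :\: g \subset C)].

(** [E] is only confined between two families and not determined by [C]: links are added one at a
    time within a step, and all intermediate families must be admissible states too. *)
Definition valid C E : Prop :=
  (forall h, h \in E -> link C h) /\
  (forall f, f \in E0 -> [disjoint f & C] -> f \in E).

Lemma valid0 : valid set0 E0.
Proof.
split=> // h hE; apply/existsP; exists h.
by rewrite hE fintype.subxx setDv sub0set.
Qed.

Lemma link_sub C C' g : C \subset C' -> link C g -> link C' g.
Proof.
move=> CC' /existsP[f /andP[fE /andP[gf fgC]]]; apply/existsP; exists f.
by rewrite fE gf (fintype.subset_trans fgC).
Qed.

Lemma link_setD1 C v g : link C g -> link (v |: C) (g :\ v).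
Proof.
move=> /existsP[f /andP[fE /andP[gf fgC]]]; apply/existsP; exists f.
rewrite fE (fintype.subset_trans (subD1set _ _) gf) /=.
apply/subsetP => x; rewrite !inE => /andP[].
by case: eqVneq => //= _ xg xf; apply: (subsetP fgC); rewrite inE xg.
Qed.

Lemma valid_del v C E : valid C E -> valid (v |: C) (del v E).
Proof.
move=> [H1 H2]; split=> [h /imsetP[f fE ->]|f fE0]; first exact/link_setD1/H1.
move=> fvC; have vf : v \notin f by rewrite (disjointFl fvC) // setU11.
apply/imsetP; exists f; first by apply: H2 => //; apply: disjointWr fvC; apply: subsetUr.
by apply/setP => x; rewrite !inE; case: eqVneq => // ->; rewrite (negbTE vf).
Qed.

Lemma valid_sub C C' E : C \subset C' -> valid C E -> valid C' E.
Proof.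
move=> CC' [H1 H2]; split=> [h /H1|f fE fC]; first exact: link_sub.
by apply: H2 => //; apply: disjointWr fC.
Qed.

Lemma valid_addcs C E (gs : seq {set T}) : (forall g, g \in gs -> link C g) ->
  valid C E -> valid C (E :|: [set:: gs]).
Proof.
move=> H [H1 H2]; split=> [h|f fE fC].
  by rewrite in_setU in_set => /orP[/H1|/H].
by rewrite in_setU H2.
Qed.

(* Bounds, for all states with at most [m] touched vertices, on the occupation ratio
   of a vertex [v]. *)
Definition ratio_le m (b : R) : Prop := forall C E v, (#|C| <= m)%N -> valid C E ->
  v \in G -> v \notin C ->
  lam * Z (G :\: (v |: C)) (del v E) <= b * Z (G :\: (v |: C)) E.

Definition ratio_ge m (a : R) : Prop := forall C E v, (#|C| <= m)%N -> valid C E ->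
  v \in G -> v \notin C -> [set v] \notin E ->
  a * Z (G :\: (v |: C)) E <= lam * Z (G :\: (v |: C)) (del v E).

Lemma setDU1 C v : G :\: (v |: C) = (G :\: C) :\ v.
Proof. by rewrite setDDl setUC. Qed.

(** The vertices of [g] are occupied one after the other; each costs a factor [b] and becomes a
    touched vertex, whence the budget [#|C| + #|g| <= m.+1]. *)
Lemma hcW_le m b g C E : 0 <= b -> ratio_le m b ->
  (#|C| + #|g| <= m.+1)%N -> valid C E ->
  W (G :\: C) E g <= b ^+ #|g| * Z (G :\: C) E.
Proof.
move=> b0 Hb; move en: #|g| => n; elim: n g C E en => [|n IH] g C E en sz vE.
  by rewrite (cards0_eq en) hcW0 expr0 mul1r.
have /card_gt0P[u ug] : (0 < #|g|)%N by rewrite en.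
have [/subsetP gU|gU] := boolP (g \subset G :\: C); last first.
  by rewrite hcW_nsub // mulr_ge0 ?exprn_ge0 ?hcZ_ge0.
have /[!inE]/andP[uC uG] := gU _ ug.
have eg : g = u |: (g :\ u) by rewrite setD1K.
rewrite eg hcW_rec ?setD11 ?inE ?uC //.
rewrite -setDU1.
have en' : #|g :\ u| = n by move: en; rewrite (cardsD1 u g) ug add1n => -[].
have := IH (g :\ u) (u |: C) (del u E) en'.
rewrite cardsU1 uC => /(_ _ (valid_del _ vE))/wrap[]; first by lia.
move=> /(ler_wpM2l lam_ge0)/le_trans; apply.
rewrite mulrCA exprSr -mulrA ler_wpM2l ?exprn_ge0 //.
apply: le_trans (Hb _ _ _ _ vE uG uC) _; first by lia.
rewrite ler_wpM2l // [leRHS](hcZ_rec lam E (v := u)) ?inE ?uC // -setDU1 lerDl.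
by rewrite mulr_ge0 ?hcZ_ge0.
Qed.

(** The ratio compares occupied with unoccupied weight, so as a probability it is [a / (1 + a)]. No
    constraint may lie inside [g], since the weight would vanish; this condition survives each
    occupation and guarantees that the next vertex is not itself forbidden. *)
Lemma le_hcW m a g C E : 0 <= a -> ratio_ge m a ->
  (#|C| + #|g| <= m.+1)%N -> valid C E -> g \subset G :\: C ->
  (forall h, h \in E -> ~~ (h \subset g)) ->
  (a / (1 + a)) ^+ #|g| * Z (G :\: C) E <= W (G :\: C) E g.
Proof.
move=> a0 Ha; move en: #|g| => n; elim: n g C E en => [|n IH] g C E en sz vE gU gE.
  by rewrite (cards0_eq en) hcW0 expr0 mul1r.
have /card_gt0P[u ug] : (0 < #|g|)%N by rewrite en.
have /[!inE]/andP[uC uG] := subsetP gU _ ug.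
have eg : g = u |: (g :\ u) by rewrite setD1K.
rewrite [X in _ <= W _ _ X]eg hcW_rec ?setD11 ?inE ?uC //.
rewrite -setDU1.
have en' : #|g :\ u| = n by move: en; rewrite (cardsD1 u g) ug add1n => -[].
have := IH (g :\ u) (u |: C) (del u E) en'.
rewrite cardsU1 uC => /(_ _ (valid_del _ vE) _ _)/wrap[].
- by lia.
- by rewrite setDU1 setSD.
- move=> _ /imsetP[h hE ->]; have := gE _ hE; apply: contra => hg.
  by rewrite eg -subDset.
move=> /(ler_wpM2l lam_ge0); apply: le_trans.
rewrite [leRHS]mulrCA exprSr -mulrA ler_wpM2l ?exprn_ge0 ?divr_ge0 ?addr_ge0 //.
rewrite (hcZ_rec lam E (v := u)) ?inE ?uC // -setDU1.
have := Ha _ _ _ _ vE uG uC; move=> /(_ _ _)/wrap[]; first lia.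
  by apply: contraTN ug => /gE; rewrite sub1set.
set A := Z _ E; set D := lam * _ => AD.
have a1 : 0 < 1 + a by rewrite ltr_wpDr.
by rewrite mulrAC ler_pdivrMr //; lra.
Qed.

(** Adding [g] to a family removes the weight of the sets containing [g], a proportion of at most
    [b ^+ #|g|] whatever was added before. *)
Lemma prod_le_hcZ m b C E (gs : seq {set T}) : 0 <= b <= 1 -> ratio_le m b ->
  valid C E -> (forall g, g \in gs -> link C g && (#|C| + #|g| <= m.+1)%N) ->
  (\prod_(g <- gs) (1 - b ^+ #|g|)) * Z (G :\: C) E <= Z (G :\: C) (E :|: [set:: gs]).
Proof.
move=> /andP[b0 b1] Hb vE; elim: gs => [|g gs IH] H.
  by rewrite big_nil mul1r le_hcZ //; apply/subsetP => h; rewrite !inE orbF.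
rewrite big_cons.
have -> : E :|: [set:: g :: gs] = g |: (E :|: [set:: gs]).
  by apply/setP => h; rewrite !inE orbCA.
have /andP[lg sg] := H g (mem_head _ _).
have {}H : forall g, g \in gs -> link C g && (#|C| + #|g| <= m.+1)%N.
  by move=> h hgs; apply: H; rewrite in_cons hgs orbT.
have vE' : valid C (E :|: [set:: gs]) by apply: valid_addcs vE => h /H/andP[].
rewrite hcZ_addc; have := hcW_le b0 Hb sg vE'.
set A := Z _ _; set B := W _ _ _ => BA.
apply: le_trans (_ : (1 - b ^+ #|g|) * A <= _); last by lra.
by rewrite -mulrA ler_wpM2l ?IH // subr_ge0 exprn_ile1.
Qed.

Lemma hcZ_le_prod m a r C E (gs : seq {set T}) : 0 <= a -> ratio_ge m a ->
  valid C E -> uniq gs ->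
  (forall g, g \in gs -> [/\ link C g, g \subset G :\: C, #|g| = r &
     forall h, h \in E -> ~~ (h \subset g)]) -> (#|C| + r <= m.+1)%N ->
  Z (G :\: C) (E :|: [set:: gs]) <=
    (1 - (a / (1 + a)) ^+ r) ^+ size gs * Z (G :\: C) E.
Proof.
move=> a0 Ha vE; elim: gs => [|g gs IH] ugs H sz.
  by rewrite mul1r le_hcZ //; apply/subsetP => h; rewrite !inE => ->.
have -> : E :|: [set:: g :: gs] = g |: (E :|: [set:: gs]).
  by apply/setP => h; rewrite !inE orbCA.
have [lg gU cg gE] := H g (mem_head _ _).
have {}H : forall g, g \in gs -> [/\ link C g, g \subset G :\: C, #|g| = r &
     forall h, h \in E -> ~~ (h \subset g)].
  by move=> h hgs; apply: H; rewrite in_cons hgs orbT.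
have vE' : valid C (E :|: [set:: gs]) by apply: valid_addcs vE => h /H[].
move: ugs => /= /andP[ggs ugs].
(* All members of [gs] have the same size and are distinct, so those already added do not lie inside
   [g]. *)
have gE' h : h \in E :|: [set:: gs] -> ~~ (h \subset g).
  rewrite !inE => /orP[/gE//|hgs]; have [_ _ ch _] := H _ hgs.
  apply/negP => hg; have /eqP : h == g by rewrite eqEcard hg ch cg /=.
  by move=> hg'; rewrite -hg' hgs in ggs.
have := le_hcW a0 Ha _ vE' gU gE'; rewrite cg => /(_ sz).
rewrite hcZ_addc; set A := Z _ _; set B := W _ _ _ => BA.
rewrite /= exprS.
apply: le_trans (_ : (1 - (a / (1 + a)) ^+ r) * A <= _); first by lra.
have a1 : 0 < 1 + a by rewrite ltr_wpDr.
rewrite -mulrA ler_wpM2l ?IH // subr_ge0 exprn_ile1 ?divr_ge0 ?addr_ge0 //.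
by rewrite ler_pdivrMr // mul1r lerDr.
Qed.

End Links.

(** * One step of the occupation recursion *)

Section Steps.
Variables (R : realType) (T : finType) (lam : R).
Hypothesis lam_ge0 : 0 <= lam.
Variables (G : {set T}) (E0 : {set {set T}}) (k : nat) (s d : R).
Implicit Types (C U X g : {set T}) (E : {set {set T}}) (u v : T).

Local Notation Z := (hcZ lam).

Definition codeg (J : {set T}) := #|[set f in E0 | J \subset f]|.

Hypothesis k_ge3 : (3 <= k)%N.
Hypothesis E0_sub : forall f, f \in E0 -> f \subset G.
Hypothesis E0_card : forall f, f \in E0 -> #|f| = k.
Hypothesis s01 : 0 < s <= 1.
Hypothesis d01 : 0 < d <= 1.
Hypothesis deg_s : forall v, v \in G -> (codeg [set v])%:R * s ^+ k.-1 = 1.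
Hypothesis codeg_s : forall J : {set T}, (2 <= #|J| < k)%N -> (codeg J)%:R * s ^+ (k - #|J|) <= d.
Hypothesis twin_s : forall c v, c != v ->
  #|[set f in E0 | (v \in f) && (c |: (f :\ v) \in E0)]|%:R * s ^+ k.-1 <= d.

Lemma sum_le_imset (I J : finType) (A : {set I}) (P : {set J}) (phi : J -> I) (F : I -> R) :
  (forall i, 0 <= F i) -> (forall i, i \in A -> exists2 j, j \in P & phi j = i) ->
  \sum_(i in A) F i <= \sum_(j in P) F (phi j).
Proof.
move=> F0 H; rewrite (partition_big_imset phi) /=.
rewrite [leRHS](bigID (fun i => i \in A)) /= -[leLHS]addr0 lerD //; last first.
  by apply: sumr_ge0 => i _; apply: sumr_ge0 => j _.
rewrite [leRHS](eq_bigl (fun i => i \in A)); last first.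
  move=> i; rewrite andb_idl // => /H[j jP <-]; exact: imset_f.
apply: ler_sum => i /H[j jP ji].
rewrite (bigD1 j) ?jP ?ji ?eqxx //= lerDl.
by apply: sumr_ge0.
Qed.

(** A constraint through [v] is [f0] minus a subset [I] of [C]. The choice [I = set0] gives the
    degree, normalised to 1, hence [b ^+ k.-1]; each of the fewer than [2 ^ #|C|] other choices is
    controlled by the codegree of [v |: I]. *)
Lemma sum_link_le (b : R) C E v : 0 <= b <= 3 -> valid E0 C E -> v \in G -> v \notin C ->
  set0 \notin E -> [set v] \notin E ->
  \sum_(f in [set f in E | v \in f]) (b * s) ^+ #|f :\ v| <=
    b ^+ k.-1 + 2 ^+ #|C| * d * 3 ^+ k.
Proof.
move=> /andP[b0 b3] [vE _] vG vC E_0 E_v; have /andP[s0 s1] := s01.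
have /andP[d0 d1] := d01.
(* The pair is (original edge, part removed from it). At least two vertices are left because neither
   [set0] nor [[set v]] is a constraint, hence the bound [k - 2]. *)
pose P := [set fI : {set T} * {set T} | [&& fI.1 \in E0, fI.2 \subset C,
   v |: fI.2 \subset fI.1 & (#|fI.2| <= k - 2)%N]].
have FI_card (fI : {set T} * {set T}) : fI \in P ->
    #|(fI.1 :\: fI.2) :\ v| = (k.-1 - #|fI.2|)%N.
  rewrite inE => /and4P[fE IC Iv cI]; rewrite setDDl setUC cardsDS // (E0_card fE).
  rewrite cardsU1; have -> : v \notin fI.2 by apply: contra vC; apply/subsetP.
  by rewrite add1n -subn1 -subnDA add1n.
apply: (@le_trans _ _ (\sum_(fI in P) (b * s) ^+ #|(fI.1 :\: fI.2) :\ v|)).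
  apply: (sum_le_imset (phi := fun fI => fI.1 :\: fI.2) (F := fun f => (b * s) ^+ #|f :\ v|)).
    by move=> f; rewrite exprn_ge0 // mulr_ge0 // ltW.
  move=> h; rewrite inE => /andP[hE vh].
  have /existsP[f /andP[fE /andP[hf fhC]]] := vE _ hE.
  exists (f, f :\: h); last by rewrite /= setDDr setDv set0U; apply/setIidPr.
  rewrite inE /= fE fhC /= subUset sub1set (subsetP hf) // subDset subsetUr /=.
  have c1 : (1 < #|h|)%N.
    rewrite ltnNge; apply/negP => /card_le1_eqP h1; move/negP: E_v; apply.
    suff <- : h = [set v] by [].
    apply/setP => x; rewrite in_set1; apply/idP/eqP => [xh|->//]; exact: h1.
  by rewrite cardsDS // (E0_card fE) leq_sub2l.
rewrite (eq_bigr (fun fI : {set T} * {set T} => (b * s) ^+ (k.-1 - #|fI.2|))); last by move=> fI /FI_card ->.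
have -> : \sum_(fI in P) (b * s) ^+ (k.-1 - #|fI.2|) =
   \sum_(I in [set I : {set T} | (I \subset C) && (#|I| <= k - 2)%N])
     (codeg (v |: I))%:R * (b * s) ^+ (k.-1 - #|I|).
  rewrite (eq_bigr (fun I : {set T} => \sum_(f in [set f in E0 | v |: I \subset f]) (b * s) ^+ (k.-1 - #|I|))).
    rewrite pair_big_dep /= (reindex (fun p : {set T} * {set T} => (p.2, p.1))) /=.
      by apply: eq_bigl => -[I f]; rewrite !inE /=; apply/and4P/andP => [[-> -> -> ->]|[/andP[-> ->] /andP[-> ->]]].
    by exists (fun p => (p.2, p.1)) => -[].
  by move=> I _; rewrite sumr_const -[RHS]mulr_natl.
rewrite (bigD1 set0) /=; last by rewrite inE sub0set cards0.
apply: lerD.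
  rewrite setU0 cards0 subn0 exprMn mulrCA deg_s // mulr1 lexx //.
apply: (@le_trans _ _ (\sum_(I in powerset C) (d * 3 ^+ k))); last first.
  by rewrite sumr_const card_powerset -[leLHS]mulr_natl natrX mulrA.
rewrite [leRHS](bigID (fun I : {set T} => (#|I| <= k - 2)%N && (I != set0))) /= -[leLHS]addr0 lerD //; last first.
  by apply: sumr_ge0 => I _; rewrite mulr_ge0 ?exprn_ge0 // ltW.
rewrite [leRHS](eq_bigl (fun I : {set T} => (I \in [set I : {set T} | (I \subset C) && (#|I| <= k - 2)%N]) && (I != set0))); last first.
  by move=> I; rewrite !inE -!andbA.
apply: ler_sum => I; rewrite inE => /andP[/andP[IC Ik] I0].
have vI : v \notin I by apply: contra vC; apply/subsetP.
have cI : (0 < #|I|)%N by rewrite card_gt0.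
have := codeg_s (J := v |: I); rewrite cardsU1 vI  add1n => /(_ _)/wrap[].
  by move: Ik cI k_ge3; clear; lia.
rewrite (_ : (k - #|I|.+1)%N = (k.-1 - #|I|)%N); last by rewrite -subn1 -subnDA add1n.
move=> h; have b3k : b ^+ (k.-1 - #|I|) <= 3 ^+ k.
  apply: (@le_trans _ _ (3 ^+ (k.-1 - #|I|))); first by apply: lerXn2r; rewrite ?nnegrE.
  by apply: ler_weXn2l; [rewrite ler1n | rewrite -subn1 -subnDA leq_subr].
rewrite exprMn mulrCA [leRHS]mulrC.
by apply: ler_pM; rewrite ?exprn_ge0 // mulr_ge0 ?exprn_ge0 // ltW.
Qed.

Lemma exp_le_1B (y b : R) : 0 <= y <= b -> b < 1 -> expR (- (y / (1 - b))) <= 1 - y.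
Proof.
move=> /andP[y0 yb] b1.
have y1 : 0 < 1 - y by lra.
apply: le_trans (_ : expR (- (y / (1 - y))) <= _).
  by rewrite ler_expR lerN2 ler_wpM2l // lef_pV2 ?posrE; lra.
rewrite expRN -[leRHS]invrK lef_pV2 ?posrE ?expR_gt0 ?invr_gt0 //.
apply: le_trans (expR_ge1Dx _).
rewrite le_eqVlt; apply/orP; left; apply/eqP; field.
by rewrite gt_eqF.
Qed.

(** The ratio is [lam] times the probability that no link of [v] is fully occupied, bounded below by
    a product over the links. Occupying [v] and one link touches at most [k] further vertices, which
    is why the assumption is taken at [m + k]. *)
Lemma ratio_ge_step m L (b : R) : 0 <= b <= 3 -> b * s < 1 ->
  ratio_le lam G E0 (m + k) (b * s) -> (m <= L)%N ->
  ratio_ge lam G E0 m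
   (lam * expR (- ((b ^+ k.-1 + 2 ^+ L * d * 3 ^+ k) / (1 - b * s)))).
Proof.
move=> /andP[b0 b3] bs Hb mL C E v cC vE vG vC vF.
have /andP[s0 s1] := s01; have /andP[d0 d1] := d01.
have bs0 : 0 <= b * s by rewrite mulr_ge0 // ltW.
have [E_0|E_0] := boolP (set0 \in E).
  rewrite !hcZ_set0 ?mulr0 //; apply/imsetP; exists set0 => //.
  by rewrite set0D.
rewrite -[leLHS]mulrA ler_wpM2l //.
rewrite setDU1 hcZ_del -setDU1.
set gs := [seq f :\ v | f <- enum [set f in E | v \in f]].
have -> : [set f :\ v | f in [set f in E | v \in f]] = [set:: gs].
  by apply/setP => h; rewrite in_set; apply/imsetP/mapP => -[f fE ->]; exists f => //; move: fE; rewrite mem_enum.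
have vE' : valid E0 (v |: C) E by apply: valid_sub vE; apply: subsetUr.
have cvC : #|v |: C| = #|C|.+1 by rewrite cardsU1 vC.
have bs01 : 0 <= b * s <= 1 by rewrite bs0 ltW.
have Hgs g : g \in gs -> link E0 (v |: C) g && (#|v |: C| + #|g| <= (m + k).+1)%N.
  move=> /mapP[f]; rewrite mem_enum inE => /andP[fE vf] ->.
  rewrite link_setD1 ?vE.1 //= cvC.
  have /existsP[f0 /andP[f0E /andP[ff0 _]]] := vE.1 _ fE.
  have := subset_leq_card ff0; rewrite (E0_card f0E) (cardsD1 v f) vf.
  by move: cC; clear; lia.
apply: (le_trans _ (prod_le_hcZ lam_ge0 bs01 Hb vE' Hgs)).
rewrite ler_wpM2r ?hcZ_ge0 // [leRHS]big_map big_enum /=.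
apply: le_trans (_ : expR (\sum_(f in [set f in E | v \in f])
    - ((b * s) ^+ #|f :\ v| / (1 - b * s))) <= _).
  rewrite ler_expR sumrN lerN2 -mulr_suml; apply: ler_wpM2r; first by rewrite invr_ge0; lra.
  apply: le_trans (sum_link_le _ vE vG vC E_0 vF) _; first by rewrite b0.
  rewrite lerD2l ler_wpM2r ?exprn_ge0 // ler_wpM2r ?(ltW d0) //.
  by apply: ler_weXn2l; [lra | exact: leq_trans mL].
rewrite expR_sum; apply: ler_prod => f; rewrite inE => /andP[fE vf].
rewrite expR_ge0 /=; apply: exp_le_1B => //.
rewrite exprn_ge0 //= -[leRHS]expr1 ler_wiXn2l ?(ltW bs) //.
rewrite card_gt0; apply: contraNneq vF => fv0.
by rewrite -[[set v]]setU0 -fv0 setD1K.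

Qed.

Lemma card_bigcup_le (I : finType) (P : {pred I}) (F : I -> {set {set T}}) :
  (#|\bigcup_(i in P) F i| <= \sum_(i in P) #|F i|)%N.
Proof.
elim/big_rec2: _ => [|i n A _ h]; first by rewrite cards0.
by apply: leq_trans (leq_card_setU _ _) _; rewrite leq_add2l.
Qed.

(* The edges at [v] whose link would contain a smaller constraint once [I] is occupied. *)
Definition blocked v (I : {set T}) := [set f in E0 | (v \in f) &&
  [exists f0 in E0, (I \subset f0) && (f0 :\: I \subset f :\ v)]].

(** If [I] is a single vertex [c], the two links have equal size and so coincide: this is the case
    that codegrees do not control and [twin_s] does. For larger [I] the pairs of edges are counted
    by two codegrees. *)
Lemma card_blocked_le v (I : {set T}) : v \notin I -> (0 < #|I| < k)%N ->
  #|blocked v I|%:R * s ^+ k.-1 <= d.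
Proof.
have /andP[s0 s1] := s01; have /andP[d0 d1] := d01.
move=> vI /andP[I0 Ik]; have [I1|I2] := leqP #|I| 1.
  have /cards1P[c Ic] : #|I| == 1%N by rewrite eqn_leq I1 I0.
  have cv : c != v by move: vI; rewrite Ic in_set1 eq_sym.
  apply: le_trans (twin_s cv); rewrite ler_wpM2r ?exprn_ge0 ?(ltW s0) // ler_nat.
  apply: subset_leq_card; apply/subsetP => f; rewrite !inE => /and3P[fE vf].
  rewrite fE vf /= => /existsP[f0 /and3P[f0E]]; rewrite Ic sub1set => cf0 sub.
  suff <- : f0 :\ c = f :\ v by rewrite setD1K.
  apply/eqP; rewrite eqEcard sub /=.
  have := E0_card f0E; have := E0_card fE.
  by rewrite (cardsD1 v) vf (cardsD1 c f0) cf0 => <- /eqP; rewrite eqn_add2l => /eqP ->.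
pose P := [set f0 in E0 | (I \subset f0) && (v \notin f0 :\: I)].
have sub : blocked v I \subset \bigcup_(f0 in P) [set f in E0 | v |: (f0 :\: I) \subset f].
  apply/subsetP => f; rewrite inE => /and3P[fE vf /existsP[f0 /and3P[f0E If0 sub]]].
  apply/bigcupP; exists f0.
    by rewrite inE f0E If0 /=; apply/negP => /(subsetP sub); rewrite setD11.
  rewrite inE fE subUset sub1set vf /=.
  exact: (fintype.subset_trans sub (subD1set _ _)).
apply: (@le_trans _ _ ((\sum_(f0 in P) codeg (v |: (f0 :\: I)))%:R * s ^+ k.-1)).
  rewrite ler_wpM2r ?exprn_ge0 ?(ltW s0) // ler_nat.
  by apply: leq_trans (subset_leq_card sub) _; apply: card_bigcup_le.
(* The first exponent normalises the number of edges [f0] over [I], the second the number of edges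
   [f] over [v |: (f0 :\: I)], a set of size [k - #|I| + 1]; together they give [d * d <= d]. *)
have -> : k.-1 = ((k - #|I|) + (#|I| - 1))%N by move: I2 Ik; clear; lia.
rewrite exprD mulrCA natr_sum mulr_suml.
apply: (@le_trans _ _ (s ^+ (k - #|I|) * \sum_(f0 in P) d)).
  rewrite ler_wpM2l ?exprn_ge0 ?(ltW s0) //; apply: ler_sum => f0.
  rewrite inE => /and3P[f0E If0 vf0].
  have cJ : #|v |: (f0 :\: I)| = (k - #|I|).+1.
    by rewrite cardsU1 vf0 cardsDS // (E0_card f0E).
  have -> : (#|I| - 1 = k - #|v |: (f0 :\: I)|)%N.
    by rewrite cJ; move: I2 Ik; clear; lia.
  by apply: codeg_s; rewrite cJ; move: I2 Ik; clear; lia.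
rewrite sumr_const -[X in _ * X]mulr_natl mulrA.
apply: le_trans (_ : d * d <= _); last by rewrite ler_piMl // ltW.
rewrite ler_wpM2r ?(ltW d0) //.
apply: le_trans (codeg_s (J := I) _); last by rewrite I2.
rewrite mulrC ler_wpM2r ?exprn_ge0 ?(ltW s0) // ler_nat.
by apply: subset_leq_card; apply/subsetP => f; rewrite !inE => /and3P[-> ->].
Qed.

(** The edges at [v] whose link meets the conditions of [hcZ_le_prod]: full size [k.-1], inside the
    current vertex set, containing no constraint. *)
Definition free_link C E v := [set f in E0 | [&& v \in f, [disjoint f & C] &
  [forall h in E, ~~ (h \subset f :\ v)]]].

(** An edge at [v] fails to be free either by meeting [C], at a codegree cost for each vertex of
    [C], or by being blocked by some [I] inside [C], at a cost [d] for each of at most [2 ^ #|C|]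
    sets. *)
Lemma card_free_link_ge C E v : valid E0 C E -> v \in G -> v \notin C -> set0 \notin E ->
  1 - (#|C|%:R + 2 ^+ #|C|) * d <= #|free_link C E v|%:R * s ^+ k.-1.
Proof.
have /andP[s0 s1] := s01; have /andP[d0 d1] := d01.
move=> [vE _] vG vC E_0.
pose PI := [set I in powerset C | (0 < #|I| < k)%N].
have sub : [set f in E0 | [set v] \subset f] \subset
   free_link C E v :|: (\bigcup_(c in C) [set f in E0 | [set c; v] \subset f])
     :|: (\bigcup_(I in PI) blocked v I).
  apply/subsetP => f; rewrite inE sub1set => /andP[fE vf].
  rewrite !inE fE vf /=; have [fC|] /= := boolP [disjoint f & C]; last first.
    rewrite -setI_eq0 => /set0Pn[c]; rewrite inE => /andP[cf cC].
    apply/orP; left; apply/bigcupP; exists c => //.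
    by rewrite inE fE subUset !sub1set cf vf.
  case: (boolP [forall h in E, ~~ (h \subset f :\ v)]) => [|/forall_inPn[h hE]] //=.
  rewrite negbK => hf; apply/orP; right; apply/bigcupP.
  have /existsP[f0 /and3P[f0E hf0 f0hC]] := vE _ hE.
  exists (f0 :\: h); last first.
    rewrite inE fE vf /=; apply/existsP; exists f0.
    by rewrite f0E subsetDl setDDr setDv set0U (setIidPr hf0).
  (* [f0 :\: h] has fewer than [k] elements because [h] is nonempty, and is nonempty because [h]
     fits into the [k - 1] vertices of [f :\ v]. *)
  rewrite !inE f0hC /= cardsDS // (E0_card f0E) subn_gt0.
  have h0 : (0 < #|h|)%N by rewrite card_gt0; apply: contraNneq E_0 => <-.
  have k0 : (0 < k)%N by exact: leq_trans k_ge3.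
  rewrite ltn_subrL h0 k0.
  have := subset_leq_card hf; have := E0_card fE; rewrite (cardsD1 v) vf add1n => <-.
  by rewrite ltnS !andbT.
have := leq_trans (subset_leq_card sub) (leq_trans (leq_card_setU _ _) (leq_add (leq_card_setU _ _) (leqnn _))).
rewrite -(ler_nat R) !natrD => /(ler_wpM2r (exprn_ge0 k.-1 (ltW s0))).
rewrite deg_s // !mulrDl => h.
have h1 : #|\bigcup_(c in C) [set f in E0 | [set c; v] \subset f]|%:R * s ^+ k.-1 <= #|C|%:R * d.
  apply: (@le_trans _ _ ((\sum_(c in C) codeg [set c; v])%:R * s ^+ k.-1)).
    by rewrite ler_wpM2r ?exprn_ge0 ?(ltW s0) // ler_nat card_bigcup_le.
  rewrite natr_sum mulr_suml [leRHS]mulr_natl -sumr_const; apply: ler_sum => c cC.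
  have c2 : #|[set c; v]| = 2%N.
    by rewrite cards2; case: eqVneq => // cv; rewrite -cv cC in vC.
  have := codeg_s (J := [set c; v]); rewrite c2 k_ge3 => /(_ isT); apply: le_trans.
  rewrite ler_wpM2l // ler_wiXn2l // ?(ltW s0) //.
  by rewrite -subn1 leq_sub2l.
have h2 : #|\bigcup_(I in PI) blocked v I|%:R * s ^+ k.-1 <= 2 ^+ #|C| * d.
  apply: (@le_trans _ _ ((\sum_(I in PI) #|blocked v I|)%:R * s ^+ k.-1)).
    by rewrite ler_wpM2r ?exprn_ge0 ?(ltW s0) // ler_nat card_bigcup_le.
  apply: (@le_trans _ _ (\sum_(I in PI) d)).
    rewrite natr_sum mulr_suml; apply: ler_sum => I; rewrite !inE => /andP[IC cI].
    by apply: card_blocked_le => //; apply: contra vC; apply/subsetP.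
  rewrite sumr_const -[leLHS]mulr_natl ler_wpM2r ?(ltW d0) // -natrX ler_nat -card_powerset.
  by apply: subset_leq_card; apply/subsetP => I; rewrite inE => /andP[].
move: h h1 h2; lra.
Qed.

Lemma ratio_le_step m L (a : R) : 0 <= a -> ratio_ge lam G E0 (m + k) a -> (m <= L)%N ->
  ratio_le lam G E0 m (lam * expR (- ((a / (1 + a)) ^+ k.-1 / s ^+ k.-1
     * (1 - (L%:R + 2 ^+ L) * d)))).
Proof.
move=> a0 Ha mL C E v cC vE vG vC.
have /andP[s0 s1] := s01; have /andP[d0 d1] := d01.
have [E_0|E_0] := boolP (set0 \in E).
  rewrite !hcZ_set0 ?mulr0 //; apply/imsetP; exists set0 => //.
  by rewrite set0D.
rewrite -[leRHS]mulrA ler_wpM2l //.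
rewrite setDU1 hcZ_del -setDU1.
set gs := [seq f :\ v | f <- enum (free_link C E v)].
have ugs : uniq gs.
  rewrite map_inj_in_uniq ?enum_uniq // => f f'; rewrite !mem_enum !inE.
  by move=> /and4P[_ vf _ _] /and4P[_ vf' _ _] e; rewrite -(setD1K vf) e setD1K.
have vE' : valid E0 (v |: C) E by apply: valid_sub vE; apply: subsetUr.
have cvC : #|v |: C| = #|C|.+1 by rewrite cardsU1 vC.
have Hgs g : g \in gs -> [/\ link E0 (v |: C) g, g \subset G :\: (v |: C), #|g| = k.-1 &
     forall h, h \in E -> ~~ (h \subset g)].
  move=> /mapP[f]; rewrite mem_enum inE => /and4P[fE vf fC /forall_inP fF ->]; split=> //.
  - by apply: link_setD1; apply: vE.1; apply: vE.2.
  - rewrite setDU1 setSD // subsetD fC andbT; exact: E0_sub.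
  - by rewrite -(E0_card fE) (cardsD1 v f) vf.
have sz : (#|v |: C| + k.-1 <= (m + k).+1)%N.
  by rewrite cvC; move: cC; clear; lia.
(* Discarding the links that are not free can only increase the partition function. *)
apply: (@le_trans _ _ (Z (G :\: (v |: C)) (E :|: [set:: gs]))).
  apply: le_hcZ => //; apply: setUS; apply/subsetP => g; rewrite in_set => /mapP[f].
  rewrite mem_enum inE => /and4P[fE vf fC fF ->]; apply/imsetP; exists f => //.
  by rewrite inE vf andbT; apply: vE.2.
apply: le_trans (hcZ_le_prod lam_ge0 a0 Ha vE' ugs Hgs sz) _.
rewrite ler_wpM2r ?hcZ_ge0 //.
set r := _ ^+ k.-1.
have r0 : 0 <= r by rewrite exprn_ge0 // divr_ge0 // addr_ge0.
have r1 : r <= 1.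
  by rewrite exprn_ile1 ?divr_ge0 ?addr_ge0 // ler_pdivrMr ?mul1r ?lerDr // ltr_wpDr.
apply: (@le_trans _ _ (expR (- r) ^+ size gs)).
  apply: lerXn2r; rewrite ?nnegrE ?expR_ge0 ?subr_ge0 //.
  exact: expR_ge1Dx.
rewrite -expRM_natl ler_expR size_map -cardE mulrN lerN2 -[leLHS]mulrA [leRHS]mulrC ler_wpM2l //.
rewrite mulrC ler_pdivrMr ?exprn_gt0 //.
apply: le_trans (card_free_link_ge vE vG vC E_0).
rewrite lerD2l lerN2 ler_wpM2r ?(ltW d0) // lerD ?ler_nat ?(leq_trans cC) //.
by rewrite ler_weXn2l ?ler1n // (leq_trans cC).
Qed.

End Steps.

(** * Iteration of the recursion *)

Section Iteration.
Variables (R : realType) (T : finType).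
Variables (G : {set T}) (E0 : {set {set T}}) (k : nat) (s d : R).
Implicit Types (C U X g : {set T}) (E : {set {set T}}) (u v : T).

Local Notation codeg := (codeg E0).

Hypothesis k_ge3 : (3 <= k)%N.
Hypothesis E0_sub : forall f, f \in E0 -> f \subset G.
Hypothesis E0_card : forall f, f \in E0 -> #|f| = k.
Hypothesis s01 : 0 < s <= 1.
Hypothesis d01 : 0 < d <= 1.
Hypothesis deg_s : forall v, v \in G -> (codeg [set v])%:R * s ^+ k.-1 = 1.
Hypothesis codeg_s : forall J : {set T}, (2 <= #|J| < k)%N -> (codeg J)%:R * s ^+ (k - #|J|) <= d.
Hypothesis twin_s : forall c v, c != v ->
  #|[set f in E0 | (v \in f) && (c |: (f :\ v) \in E0)]|%:R * s ^+ k.-1 <= d.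

Variables (x e : R) (L : nat).
Local Notation q := k.-1.
Hypothesis x_gt0 : 0 < x.
Hypothesis x_le : q%:R * x ^+ q <= 1.
Hypothesis s_le_d : s <= d.
Hypothesis e_ge : 2 ^+ (L + 2) * 3 ^+ k * d <= e.
Hypothesis e_le : e <= 6^-1.

Local Notation lam := (s * (x * expR (x ^+ q))).

Let s_gt0 : 0 < s. Proof. by case/andP: s01. Qed.
Let d_gt0 : 0 < d. Proof. by case/andP: d01. Qed.
Let q_ge2 : (2 <= q)%N. Proof. by move: k_ge3; clear; case: k => [|[|[|]]]. Qed.
Let kq : k = q.+1. Proof. by move: k_ge3; clear; case: k. Qed.

Let lam_ge0 : 0 <= lam.
Proof. by rewrite !mulr_ge0 ?expR_ge0 // ltW. Qed.

Let xq_ge0 : 0 <= x ^+ q. Proof. by rewrite exprn_ge0 // ltW. Qed.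

Let xq_le : x ^+ q <= 2^-1.
Proof.
have : 2 * x ^+ q <= 1 by apply: le_trans x_le; rewrite ler_wpM2r // ler_nat.
lra.
Qed.

Let x_le1 : x <= 1.
Proof.
rewrite leNgt; apply/negP => x1.
have : 1 <= x ^+ q by rewrite exprn_ege1 // ltW.
move: xq_le; lra.
Qed.

Let e_ge0 : 0 <= e.
Proof. by apply: le_trans e_ge; rewrite !mulr_ge0 ?exprn_ge0 // ltW. Qed.

Let pow3_d : 4 * 3 ^+ k * d <= e.
Proof.
apply: le_trans e_ge; rewrite ler_wpM2r ?(ltW d_gt0) // ler_wpM2r ?exprn_ge0 //.
have -> : 4 = 2 ^+ 2 :> R by rewrite expr2; lra.
by rewrite ler_weXn2l ?ler1n // leq_addl.
Qed.

Let d_le : d <= 6^-1 / 12.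
Proof.
have h3 : (3 : R) <= 3 ^+ k.
  by rewrite kq -[leLHS]expr1 ler_weXn2l ?ler1n.
have := pow3_d; have := e_le; have := d_gt0; nra.
Qed.

(** The choice of [lam] makes [x] the fixed point: an upper logarithmic error [b] becomes the lower
    error [x ^+ q * (expR (q * b) - 1)], and the codegree and discretisation errors are absorbed in
    [e]. *)
Lemma ratio_ge_step_exp m b : 0 <= b -> x * expR b <= 3 ->
  ratio_le lam G E0 (m + k) (x * expR b * s) -> (m <= L)%N ->
  ratio_ge lam G E0 m (x * expR (- (x ^+ q * (expR (q%:R * b) - 1) + e)) * s).
Proof.
move=> b0 b3 Hb mL.
have xb0 : 0 <= x * expR b by rewrite mulr_ge0 ?expR_ge0 // ltW.
have bs2 : x * expR b * s <= 2^-1.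
  apply: le_trans (_ : 3 * d <= _); last by have := d_le; lra.
  by apply: ler_pM => //; rewrite ltW.
have bs1 : x * expR b * s < 1 by lra.
have := ratio_ge_step lam_ge0 k_ge3 E0_card s01 d01 deg_s codeg_s _ bs1 Hb mL.
rewrite xb0 b3 => /(_ isT) H C E v cC vE vG vC vF.
apply: le_trans (H C E v cC vE vG vC vF); rewrite ler_wpM2r ?hcZ_ge0 //.
rewrite [leLHS]mulrC -[leRHS]mulrA ler_pM2l // -mulrA ler_pM2l // -expRD ler_expR.
set B := x * expR b in b3 xb0 bs2 bs1 *.
have -> : x ^+ q * (expR (q%:R * b) - 1) = B ^+ q - x ^+ q.
  by rewrite /B exprMn expRM_natl mulrBr mulr1.
suff : (B ^+ q + 2 ^+ L * d * 3 ^+ k) / (1 - B * s) <= B ^+ q + e by lra.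
rewrite ler_pdivrMr; last by lra.
have Bk : B ^+ q * (B * s) <= 3 ^+ k * d.
  rewrite mulrA -exprSr -kq; apply: ler_pM; rewrite ?exprn_ge0 // ?(ltW s_gt0) //.
  by apply: lerXn2r; rewrite ?nnegrE.
have h2 : e * (B * s) <= e * 2^-1 by rewrite ler_wpM2l.
have h3 : 2 ^+ (L + 2) * 3 ^+ k * d = 4 * (2 ^+ L * d * 3 ^+ k).
  by rewrite exprD expr2; ring.
have := e_ge; rewrite h3 => h4.
have := pow3_d => h5.
rewrite -subr_ge0.
have -> : (B ^+ q + e) * (1 - B * s) - (B ^+ q + 2 ^+ L * d * 3 ^+ k) =
  e - e * (B * s) - B ^+ q * (B * s) - 2 ^+ L * d * 3 ^+ k by ring.
move: Bk h2 h4 h5; set y1 := 2 ^+ L * d * 3 ^+ k; set y2 := B ^+ q * _; set y3 := e * (B * s).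
rewrite -mulrA; set y4 := 3 ^+ k * d; lra.
Qed.

Lemma ratio_le_step_exp m a : 0 <= a ->
  ratio_ge lam G E0 (m + k) (x * expR (- a) * s) -> (m <= L)%N ->
  ratio_le lam G E0 m (x * expR (x ^+ q * (1 - expR (- (q%:R * a))) + e) * s).
Proof.
move=> a0 Ha mL.
have xa0 : 0 <= x * expR (- a) by rewrite mulr_ge0 ?expR_ge0 // ltW.
have xas0 : 0 <= x * expR (- a) * s by rewrite mulr_ge0 // ltW.
have := ratio_le_step lam_ge0 k_ge3 E0_sub E0_card s01 d01 deg_s codeg_s twin_s xas0 Ha mL.
move=> H C E v cC vE vG vC.
apply: le_trans (H C E v cC vE vG vC) _; rewrite ler_wpM2r ?hcZ_ge0 //.
rewrite [leRHS]mulrC -[leLHS]mulrA ler_pM2l // -mulrA ler_pM2l // -expRD ler_expR.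
set A := x * expR (- a) in xa0 xas0 *.
have -> : x ^+ q * (1 - expR (- (q%:R * a))) = x ^+ q - A ^+ q.
  by rewrite /A exprMn -expRM_natl mulrN mulrBr mulr1.
set X := (L%:R + 2 ^+ L) * d.
suff : A ^+ q - e <= (A * s / (1 + A * s)) ^+ q / s ^+ q * (1 - X) by lra.
have A1 : A <= 1.
  by rewrite /A -[leRHS]mulr1 ler_pM ?expR_ge0 // ?(ltW x_gt0) // -expR0 ler_expR oppr_le0.
have As1 : A * s <= d by rewrite -[leRHS]mul1r ler_pM // ltW.
have -> : (A * s / (1 + A * s)) ^+ q / s ^+ q = A ^+ q * ((1 + A * s)^-1) ^+ q.
  rewrite (_ : A * s / (1 + A * s) = A / (1 + A * s) * s); last by rewrite mulrAC.
  by rewrite exprMn mulfK ?expf_neq0 ?gt_eqF // exprMn.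
set w := A ^+ q; have w0 : 0 <= w by rewrite exprn_ge0.
have w1 : w <= 1 by rewrite exprn_ile1.
have Lpow : (L%:R : R) <= 2 ^+ L by rewrite -natrX ler_nat ltnW // ltn_expl.
have kpow : (q%:R : R) <= 3 ^+ k.
  rewrite -natrX ler_nat; apply: leq_trans (leq_pred _) _.
  by apply: ltnW; apply: ltn_expl.
have p3 : 1 <= 3 ^+ k :> R by rewrite exprn_ege1 // ler1n.
have p2 : 1 <= 2 ^+ L :> R by rewrite exprn_ege1 // ler1n.
have X0 : 0 <= X by rewrite mulr_ge0 ?addr_ge0 ?exprn_ge0 // ltW.
have qX : q%:R * d + X <= e.
  apply: le_trans e_ge; rewrite /X -mulrDl ler_wpM2r ?(ltW d_gt0) //.
  rewrite exprD expr2; nra.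
(* The cost of passing from ratios to probabilities, by Bernoulli's inequality for
   [(1 - d) ^+ q]. *)
have inv_ge : 1 - q%:R * d <= ((1 + A * s)^-1) ^+ q.
  have h1 : 1 - d <= (1 + A * s)^-1.
    rewrite -[(1 + A * s)^-1]mul1r ler_pdivlMr; last by lra.
    have := d_le; nra.
  apply: (@le_trans _ _ ((1 - d) ^+ q)); last first.
    by apply: lerXn2r; rewrite ?nnegrE ?invr_ge0; have := d_le; lra.
  elim: (q) => [|n IH]; first by rewrite expr0; lra.
  have hn : 0 <= n%:R :> R by [].
  rewrite exprSr -natr1.
  have := d_gt0; have := d_le; nra.
have X1 : 0 <= 1 - X.
  have : 0 <= q%:R * d by rewrite mulr_ge0 // ltW.
  by move: qX e_le; lra.
apply: (@le_trans _ _ (w * (1 - q%:R * d) * (1 - X))); last first.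
  by rewrite ler_wpM2r // ler_wpM2l.
have qd0 : 0 <= q%:R * d by rewrite mulr_ge0 // ltW.
set y := q%:R * d in qX qd0 *.
have : 0 <= w * (y * X) by rewrite (mulr_ge0 w0) // (mulr_ge0 qd0).
have : w * (y + X) <= e.
  by apply: le_trans qX; rewrite ler_piMl // addr_ge0.
nra.
Qed.

(** Occupying [v] only tightens constraints, so the ratio never exceeds [lam]; the iteration starts
    here. *)
Lemma ratio_le_trivial m : ratio_le lam G E0 m (x * expR (x ^+ q) * s).
Proof.
move=> C E v _ _ _ _; rewrite [x * _ * s]mulrC ler_wpM2l //.
by rewrite setDU1 hcZ_del_le.
Qed.

Lemma ratio_ge_mono m a a' : a' <= a -> ratio_ge lam G E0 m a -> ratio_ge lam G E0 m a'.
Proof.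
move=> aa H C E v cC vE vG vC vF; apply: le_trans (H C E v cC vE vG vC vF).
by rewrite ler_wpM2r ?hcZ_ge0.
Qed.

Lemma expR_le3 b : 0 <= b <= 2^-1 + e -> x * expR b <= 3.
Proof.
move=> /andP[b0 be]; rewrite -[leRHS]mul1r; apply: ler_pM; rewrite ?expR_ge0 // ?(ltW x_gt0) //.
have b1 : b <= 2 / 3 by have := e_le; lra.
apply: le_trans (expR_le_inv _) _; first lra.
by rewrite invf_ple ?posrE; lra.
Qed.

(* [a j] bounds [q] times the logarithmic error of the lower bound after [j] round trips. *)
Variable a : nat -> R.
Hypothesis e2 : q%:R * e <= 2^-1.
Hypothesis a_0 : 4 <= a 0%N.
Hypothesis a_S : forall j, (q%:R * x ^+ q) ^+ 2 * a j + 9 * (q%:R * e) <= a j.+1.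

Let q0 : 0 < q%:R :> R. Proof. by rewrite ltr0n ltnW. Qed.
Let u01 : 0 <= q%:R * x ^+ q <= 1. Proof. by rewrite mulr_ge0. Qed.

Lemma round_trip_ge0 j : 0 <= a j.
Proof.
elim: j => [|j IH]; first by apply: le_trans a_0.
have /andP[u0 _] := u01; apply: le_trans (a_S j); apply: addr_ge0.
  by rewrite mulr_ge0 ?exprn_ge0.
by rewrite mulr_ge0 // mulr_ge0.
Qed.

(** Each round trip consists of two steps of cost [k]; the odd one out turns the trivial upper bound
    into the first lower bound. *)
Lemma ratio_ge_iter j m : (m + (2 * j).+1 * k <= L)%N ->
  ratio_ge lam G E0 m (x * expR (- (a j / q%:R)) * s).
Proof.
elim: j m => [|j IH] m mL.
  have := @ratio_ge_step_exp m (x ^+ q) xq_ge0 _ (@ratio_le_trivial _) _.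
  move=> /(_ _ _)/wrap[].
  - by apply: expR_le3; rewrite xq_ge0 /=; move: xq_le e_ge0; lra.
  - by apply: leq_trans mL; rewrite leq_addr.
  apply: ratio_ge_mono; rewrite ler_wpM2r ?(ltW s_gt0) // ler_wpM2l ?(ltW x_gt0) //.
  rewrite ler_expR lerN2 ler_pdivlMr //.
  (* With [u = q x^q <= 1], the initial error is [u (exp u - 1) + q e <= 3 + 1/2], which explains
     the starting value 4. *)
  have hu : expR (q%:R * x ^+ q) <= 4.
    by apply: le_trans (expR1_le4 R); rewrite ler_expR; case/andP: u01.
  apply: le_trans a_0.
  set E := expR _ in hu *.
  have -> : (x ^+ q * (E - 1) + e) * q%:R = q%:R * x ^+ q * (E - 1) + q%:R * e by ring.
  have /andP[u0 u1] := u01.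
  have h1 : 0 <= E - 1 by have := expR_ge1Dx (q%:R * x ^+ q); rewrite -/E; move: u0; lra.
  apply: le_trans (_ : 1 * (E - 1) + q%:R * e <= _); last by move: hu e2; lra.
  by rewrite lerD2r ler_wpM2r.
have mk : (m + k + (2 * j).+1 * k <= L)%N.
  by move: mL; rewrite mulnS !addSn !mulSn; clear; lia.
have Ha : ratio_ge lam G E0 (m + k + k) (x * expR (- (a j / q%:R)) * s).
  by apply: IH; move: mL; rewrite mulnS !addSn !mulSn; clear; lia.
have mkL : (m + k <= L)%N by apply: leq_trans mk; rewrite leq_addr.
have aq0 : 0 <= a j / q%:R by rewrite divr_ge0 ?round_trip_ge0.
have Hb := ratio_le_step_exp aq0 Ha mkL.
rewrite [q%:R * _]mulrC divfK ?gt_eqF // in Hb.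
have ea : 0 <= 1 - expR (- a j) <= 1.
  rewrite subr_ge0 -expR0 ler_expR oppr_le0 round_trip_ge0 /= expR0 lerBlDr lerDl; exact: expR_ge0.
have hb0 : 0 <= x ^+ q * (1 - expR (- a j)).
  by rewrite mulr_ge0 //; case/andP: ea.
have hb1 : x ^+ q * (1 - expR (- a j)) <= 2^-1.
  apply: le_trans xq_le; rewrite ler_piMr //; by case/andP: ea.
have := @ratio_ge_step_exp m _ _ _ Hb _; move=> /(_ _ _ _)/wrap[].
- by rewrite addr_ge0.
- by apply: expR_le3; rewrite addr_ge0 //= lerD2r.
- by apply: leq_trans mkL; rewrite leq_addr.
apply: ratio_ge_mono; rewrite ler_wpM2r ?(ltW s_gt0) // ler_wpM2l ?(ltW x_gt0) //.
rewrite ler_expR lerN2 ler_pdivlMr //.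
apply: le_trans (a_S j).
have := two_step_contract u01 (round_trip_ge0 j) (e := q%:R * e).
rewrite mulr_ge0 // e2 => /(_ isT); apply: le_trans.
rewrite le_eqVlt; apply/orP; left; apply/eqP.
set E1 := expR (- a j).
rewrite (_ : x ^+ q * (1 - E1) + e = (q%:R * x ^+ q * (1 - E1) + q%:R * e) / q%:R); last first.
  by rewrite -mulrA -mulrDr mulrAC mulfV ?mul1r // gt_eqF.
rewrite [q%:R * (_ / _)]mulrC divfK ?gt_eqF //; ring.
Qed.

End Iteration.

(* [s] plays the role of [Delta ^ (-1 / (k - 1))]: the degrees are exactly [Delta],
   codegrees are negligible, and few edges survive the replacement of [v] by [c]. *)
Definition quasi_regular (R : realType) (T : finType) (G : {set T}) (E0 : {set {set T}})
    (k : nat) (s d : R) : Prop :=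
  [/\ forall f, f \in E0 -> f \subset G,
      forall f, f \in E0 -> #|f| = k,
      forall v, v \in G -> (codeg E0 [set v])%:R * s ^+ k.-1 = 1,
      forall J : {set T}, (2 <= #|J| < k)%N -> (codeg E0 J)%:R * s ^+ (k - #|J|) <= d
    & forall c v, c != v ->
        #|[set f in E0 | (v \in f) && (c |: (f :\ v) \in E0)]|%:R * s ^+ k.-1 <= d].

Lemma expr_lt_small (R : realType) (t e : R) : 0 <= t < 1 -> 0 < e -> exists J, t ^+ J <= e.
Proof.
move=> /andP[t0 t1] e0.
have /cvgrPdist_le/(_ e e0) : (t ^+ n @[n --> \oo] --> (0 : R))%classic.
  by apply: cvg_expr; rewrite ger0_norm.
case=> N _ /(_ N) /=; rewrite leqnn => /(_ isT); rewrite sub0r normrN ger0_norm ?exprn_ge0 //.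
by exists N.
Qed.

Theorem ratio_bounds (R : realType) (k : nat) (u tau : R) : (3 <= k)%N ->
  0 <= u < 1 -> 0 < tau -> exists2 d : R, 0 < d <= 1 &
  forall (T : finType) (G : {set T}) (E0 : {set {set T}}) (s : R), 0 < s <= d ->
  quasi_regular G E0 k s d ->
  forall x, 0 < x -> k.-1%:R * x ^+ k.-1 <= u ->
  let lam := s * (x * expR (x ^+ k.-1)) in
  forall v, v \in G ->
  x * expR (- tau) * s * hcZ lam (G :\ v) E0 <= lam * hcZ lam (G :\ v) (del v E0)
    <= x * expR tau * s * hcZ lam (G :\ v) E0.
Proof.
move=> k3 /andP[u0 u1] tau0.
pose q := k.-1.
have q2 : (2 <= q)%N by rewrite /q; move: k3; clear; case: k => [|[|[|]]].
have q0 : 0 < q%:R :> R by rewrite ltr0n ltnW.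
have q1 : 1 <= q%:R :> R by rewrite ler1n ltnW.
pose t := Num.min tau 1.
have t0 : 0 < t by rewrite /t lt_min tau0 ltr01.
have t1 : t <= 1 by rewrite /t ge_min lexx orbT.
have tt : t <= tau by rewrite /t ge_min lexx.
pose th := u ^+ 2.
have th01 : 0 <= th < 1 by rewrite /th exprn_ge0 //= exprn_ilt1.
have /andP[th0 th1] := th01.
(* Chosen so that the error recursion [a -> th a + 9 ep] has fixed point [t / 4]. *)
pose ep := (1 - th) * t / 36.
have ep0 : 0 < ep by rewrite /ep divr_gt0 // mulr_gt0 // subr_gt0.
have ep36 : ep <= t / 36.
  by rewrite /ep ler_wpM2r ?invr_ge0 // ler_piMl ?(ltW t0) // lerBlDr lerDl.
have [J hJ] := @expr_lt_small R th (t / 16) th01 (divr_gt0 t0 (ltr0n _ 16)).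
(* The exact solution of that recursion from the value 4; [th ^+ J <= t / 16] brings it down to
   [t / 2]. *)
pose a j : R := th ^+ j * 4 + t / 4 * (1 - th ^+ j).
have aS j : a j.+1 = th * a j + 9 * ep.
  by rewrite /a /ep exprS; field.
have aJ : a J <= t / 2.
  have := exprn_ge0 J th0; rewrite /a; set y := th ^+ J in hJ *; nra.
(* The additional [k] pays for a last step, which turns the final lower bound into the upper
   bound. *)
pose L := ((2 * J).+1 * k + k)%N.
pose e := ep / q%:R.
have e0 : 0 < e by rewrite divr_gt0.
have eep : e <= ep by rewrite ler_pdivrMr // ler_peMr // ltW.
have qe : q%:R * e = ep by rewrite /e mulrC divfK // gt_eqF.
pose D : R := 2 ^+ (L + 2) * 3 ^+ k.
have D1 : 1 <= D.
  by rewrite -[leLHS]mulr1 ler_pM // exprn_ege1 // ler1n.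
have D0 : 0 < D by apply: lt_le_trans D1.
pose d := e / D.
have d0 : 0 < d by rewrite divr_gt0.
have de : D * d <= e by rewrite /d mulrC divfK // gt_eqF.
have e6 : e <= 6^-1 by lra.
have d1 : d <= 1.
  by rewrite ler_pdivrMr // mul1r; apply: le_trans D1; lra.
exists d; first by rewrite d0.
move=> T G E0 s /andP[s0 sd] [Hsub Hcard Hdeg Hcod Htw] x x0 xu lam v vG.
have s01 : 0 < s <= 1 by rewrite s0 (le_trans sd).
have d01 : 0 < d <= 1 by rewrite d0.
have x1 : k.-1%:R * x ^+ k.-1 <= 1 by apply: le_trans xu _; exact: ltW.
have qe2 : k.-1%:R * e <= 2^-1 by rewrite qe; lra.
have a00 : 4 <= a 0%N by rewrite /a expr0; lra.
have aS' j : (k.-1%:R * x ^+ k.-1) ^+ 2 * a j + 9 * (k.-1%:R * e) <= a j.+1.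
  rewrite aS qe lerD2r ler_wpM2r //.
    rewrite /a; have := exprn_ge0 j th0; have : th ^+ j <= 1 by rewrite exprn_ile1 // ltW.
    by set y := th ^+ j => ? ?; nra.
  by apply: lerXn2r; rewrite ?nnegrE ?mulr_ge0 ?exprn_ge0 // ltW.
have a0J := round_trip_ge0 d01 x0 x1 de a00 aS' J.
have HJ m : (m + (2 * J).+1 * k <= L)%N ->
    ratio_ge lam G E0 m (x * expR (- (a J / k.-1%:R)) * s).
  exact: (ratio_ge_iter k3 Hsub Hcard s01 d01 Hdeg Hcod Htw x0 x1 sd de e6 qe2 a00 aS').
have aJq0 : 0 <= a J / k.-1%:R by rewrite divr_ge0 // ltW.
have kL : (0 + k + (2 * J).+1 * k <= L)%N by rewrite add0n addnC.
have HbJ := ratio_le_step_exp k3 Hsub Hcard s01 d01 Hdeg Hcod Htw x0 x1 sd de e6 aJq0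
  (HJ _ kL) (leq0n L).
have v0 : v \notin (set0 : {set T}) by rewrite in_set0.
have c0 : (#|(set0 : {set T})| <= 0)%N by rewrite cards0.
have vE : [set v] \notin E0.
  by apply/negP => /Hcard; rewrite cards1 => k1; move: k3; rewrite -k1.
have := HJ 0%N _ set0 E0 v c0 (valid0 E0) vG v0 vE.
have := HbJ set0 E0 v c0 (valid0 E0) vG v0.
rewrite setU0 => hb /(_ _)/wrap[]; first by rewrite add0n leq_addr.
move=> ha; have /andP[s_0 s_1] := s01.
have lam0 : 0 <= lam by rewrite /lam !mulr_ge0 ?expR_ge0 // ltW.
apply/andP; split.
  apply: le_trans ha; rewrite ler_wpM2r ?hcZ_ge0 // ler_wpM2r ?(ltW s_0) //.
  rewrite ler_wpM2l ?(ltW x0) // ler_expR lerN2 ler_pdivrMr //.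
  have : tau * 1 <= tau * k.-1%:R by rewrite ler_wpM2l // ltW.
  by move: aJ tt t0; lra.
apply: le_trans hb _; rewrite ler_wpM2r ?hcZ_ge0 // ler_wpM2r ?(ltW s_0) //.
rewrite ler_wpM2l ?(ltW x0) // ler_expR [_ * (a J / _)]mulrC divfK ?gt_eqF //.
have xq1 : x ^+ k.-1 <= 1.
  apply: le_trans x1; rewrite ler_peMl ?exprn_ge0 //; exact: ltW.
have eaJ : 0 <= 1 - expR (- a J) <= a J.
  have := expR_ge1Dx (- a J); have : expR (- a J) <= 1 by rewrite -expR0 ler_expR oppr_le0.
  by move=> ? ?; apply/andP; split; lra.
have : x ^+ k.-1 * (1 - expR (- a J)) <= 1 * a J.
  by case/andP: eaJ => ? ?; apply: ler_pM; rewrite ?exprn_ge0 // ltW.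
by move: aJ tt t0 eep ep36; lra.
Qed.

(** * Integration of the occupation density *)

Section PartitionFunction.
Variables (R : realType) (T : finType) (G : {set T}) (E0 : {set {set T}}).
Implicit Types lam : R.

(** The partition function as a polynomial in the activity, so that it can be differentiated
    formally. *)
Definition hcpoly : {poly R} := \sum_(X : {set T} | (X \subset G) && indep E0 X) 'X^(#|X|).

Lemma horner_hcpoly lam : hcpoly.[lam] = hcZ lam G E0.
Proof. by rewrite horner_sum; apply: eq_bigr => X _; rewrite hornerXn. Qed.

(** Both sides are the sum of [#|X| * lam ^+ #|X|] over independent sets, the right one counted by
    elements of [X]. *)
Lemma deriv_hcpoly lam : lam * hcpoly^`().[lam] =
  \sum_(v in G) lam * hcZ lam (G :\ v) (del v E0).
Proof.
transitivity (\sum_(X : {set T} | (X \subset G) && indep E0 X) (#|X|%:R * lam ^+ #|X|)).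
  rewrite linear_sum horner_sum mulr_sumr; apply: eq_bigr => X _.
  rewrite /= derivXn hornerMn hornerXn -[_ *+ #|X|]mulr_natl mulrCA -exprS.
  by case: #|X| => [|n] //=; rewrite !mul0r.
transitivity (\sum_(v in G) hcW lam G E0 [set v]); last first.
  apply: eq_bigr => v vG; rewrite -hcW0 -hcW_rec ?in_set0 ?setU0 //.
rewrite (eq_bigr (fun X : {set T} => \sum_(v in G | v \in X) lam ^+ #|X|)); last first.
  move=> X /andP[XG _]; rewrite (eq_bigl (mem X)) ?sumr_const ?mulr_natl // => v.
  by rewrite andb_idl // => /(subsetP XG).
rewrite (exchange_big_dep (mem G)) /=; last by move=> X v _ /andP[].
apply: eq_bigr => v vG; apply: eq_bigl => X.
by rewrite vG sub1set -andbA.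
Qed.

End PartitionFunction.

Theorem ln_hcZ_approx (R : realType) (k : nat) (u tau : R) : (3 <= k)%N ->
  0 <= u < 1 -> 0 < tau -> exists2 d : R, 0 < d <= 1 &
  forall (T : finType) (G : {set T}) (E0 : {set {set T}}) (s : R), 0 < s <= d ->
  quasi_regular G E0 k s d ->
  forall x : R, 0 <= x -> k.-1%:R * x ^+ k.-1 <= u ->
  `|ln (hcZ (s * (x * expR (x ^+ k.-1))) G E0) -
     #|G|%:R * s * (x + k.-1%:R / k%:R * x ^+ k)| <= tau * (#|G|%:R * s).
Proof.
move=> k3 u01 tau0.
have k0 : 0 < k%:R :> R by rewrite ltr0n (leq_trans _ k3).
have kq : k = k.-1.+1 by move: k3; clear; case: k.
have /andP[u0 u1] := u01.
pose t := Num.min (tau / 16) 16^-1.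
have t0 : 0 < t by rewrite /t lt_min; apply/andP; split; lra.
have t1 : t <= 16^-1 by rewrite /t ge_min lexx orbT.
have tt : t <= tau / 16 by rewrite /t ge_min lexx.
have [d /andP[d0 d1] Hd] := ratio_bounds k3 u01 t0.
pose d' := Num.min d t.
have d'0 : 0 < d' by rewrite lt_min d0.
exists d'; first by rewrite d'0 (le_trans _ d1) // ge_min lexx.
move=> T G E0 s /andP[s0 sd'] Hq x x0 xu.
have sd : s <= d by apply: le_trans sd' _; rewrite ge_min lexx.
have st : s <= t by apply: le_trans sd' _; rewrite ge_min lexx orbT.
have Hqd : quasi_regular G E0 k s d.
  have dd : d' <= d by rewrite ge_min lexx.
  case: Hq => h1 h2 h3 h4 h5; split=> //.
    by move=> J /h4/le_trans; apply.
  by move=> c v /h5/le_trans; apply.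
have E_0 : set0 \notin E0.
  by case: Hq => _ h _ _ _; apply/negP => /h; rewrite cards0 => k0'; move: k3; rewrite -k0'.
set N : R := #|G|%:R.
have N0 : 0 <= N by rewrite /N.
pose q : R := k.-1%:R.
have q0 : 0 <= q by rewrite /q.
pose lm y := s * (y * expR (y ^+ k.-1)).
pose f y := ln (hcZ (lm y) G E0).
pose g y := N * s * (y + q / k%:R * y ^+ k).
have lm_ge0 y : 0 <= y -> 0 <= lm y.
  by move=> y0; rewrite /lm !mulr_ge0 ?expR_ge0 // ltW.
have Zgt0 y : 0 <= y -> 0 < hcZ (lm y) G E0.
  by move=> y0; apply: lt_le_trans (hcZ_ge1 (lm_ge0 _ y0) G E_0).
pose dlm y := s * (y * (expR (y ^+ k.-1) * (q * y ^+ k.-2)) + expR (y ^+ k.-1) * 1).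
have Dlm (y : R) : is_derive y 1 lm (dlm y).
  exact: (is_derive1Z s (is_derive1M (is_derive1_id y) (is_derive1_chain
    (g := fun z : R => z ^+ k.-1) (is_derive_expR (y ^+ k.-1)) (is_derive1Xn k.-1 y)))).
pose df y := (hcZ (lm y) G E0)^-1 * ((hcpoly R G E0)^`().[lm y] * dlm y).
have Df (y : R) : 0 <= y -> is_derive y 1 f (df y).
  move=> y0; rewrite /f /df.
  have -> : (fun y0 => ln (hcZ (lm y0) G E0)) = (fun y0 => ln ((hcpoly R G E0).[lm y0])).
    by apply/funext => z; rewrite horner_hcpoly.
  rewrite -horner_hcpoly.
  have h0 : 0 < (hcpoly R G E0).[lm y] by rewrite horner_hcpoly Zgt0.
  exact: (is_derive1_chain (g := fun z => (hcpoly R G E0).[lm z]) (is_derive1_ln h0)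
    (is_derive1_chain (g := lm) (is_derive_poly (hcpoly R G E0) (lm y)) (Dlm y))).
pose dg y := N * s * (1 + q / k%:R * (k%:R * y ^+ k.-1)).
have Dg (y : R) : is_derive y 1 g (dg y).
  exact: (is_derive1Z (N * s) (is_derive1D (is_derive1_id y)
    (is_derive1Z (q / k%:R) (is_derive1Xn k y)))).
have Ns0 : 0 <= N * s by rewrite mulr_ge0 // ltW.
have q1 : 1 <= q by rewrite /q ler1n; move: k3; clear; case: k => [|[|]].
have x1 : x <= 1.
  rewrite leNgt; apply/negP => x1.
  have : 1 * 1 <= q * x ^+ k.-1 by rewrite ler_pM // exprn_ege1 // ltW.
  by move: xu; rewrite -/q; move: u1; clear; lra.
(* The mean number of occupied vertices is close to [N * y * s], and the activity has logarithmic
   derivative [(1 + q y^q) / y]; the product is [dg y]. As [f] and [g] vanish at 0, the comparison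
   of derivatives integrates. *)
have key (y : R) : 0 < y -> y <= x -> (1 - 3 * t) * dg y <= df y <= (1 + 3 * t) * dg y.
  move=> y0 yx; have yu : k.-1%:R * y ^+ k.-1 <= u.
    apply: le_trans xu; rewrite ler_wpM2l //.
    by apply: lerXn2r; rewrite ?nnegrE // ltW.
  have H := Hd T G E0 s _ Hqd y y0 yu; rewrite s0 sd /= in H.
  rewrite -/(lm y) in H; have {}H := H isT.
  set Zy := hcZ (lm y) G E0; have Zy0 : 0 < Zy by apply: Zgt0; rewrite ltW.
  set S := lm y * (hcpoly R G E0)^`().[lm y].
  have lmy0 : 0 <= lm y by rewrite lm_ge0 // ltW.
  have Sub : S <= N * (y * expR t * s * Zy).
    rewrite /S deriv_hcpoly /N [leRHS]mulr_natl -sumr_const; apply: ler_sum => v vG.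
    have /andP[_ h] := H v vG; apply: le_trans h _.
    rewrite ler_wpM2l ?mulr_ge0 ?expR_ge0 ?(ltW y0) ?(ltW s0) //.
    by rewrite /Zy (hcZ_rec _ _ vG) lerDl mulr_ge0 ?hcZ_ge0.
  set a := y * expR (- t) * s.
  have a0 : 0 <= a by rewrite !mulr_ge0 ?expR_ge0 // ltW.
  (* [Zy] splits into the parts with [v] empty and [v] occupied, which turns the lower bound [a] on
     the ratio into the density [a / (1 + a)]. *)
  have Slb : N * (a * Zy) <= (1 + a) * S.
    rewrite /S deriv_hcpoly /N [leLHS]mulr_natl -sumr_const mulr_sumr; apply: ler_sum => v vG.
    have /andP[h _] := H v vG; rewrite -/a in h.
    rewrite /Zy (hcZ_rec _ _ vG); set W := lm y * _ in h *.
    by rewrite mulrDr mulrDl mul1r lerD2r.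
  have D0 : 0 <= 1 + q * y ^+ k.-1 by rewrite addr_ge0 // mulr_ge0 // exprn_ge0 // ltW.
  have ydf : y * df y = S / Zy * (1 + q * y ^+ k.-1).
    rewrite /df -/Zy /dlm /S.
    have -> : y ^+ k.-1 = y * y ^+ k.-2.
      by rewrite -exprS; congr (_ ^+ _); move: k3; clear; case: k => [|[|]].
    rewrite /lm.
    have -> : y ^+ k.-1 = y * y ^+ k.-2.
      by rewrite -exprS; congr (_ ^+ _); move: k3; clear; case: k => [|[|]].
    by ring.
  have dgE : dg y = N * s * (1 + q * y ^+ k.-1).
    rewrite /dg mulrA divfK // gt_eqF //.
  set D := 1 + q * y ^+ k.-1 in D0 ydf dgE *.
  have a_t : a <= t.
    apply: le_trans st; rewrite /a -[leRHS]mul1r ler_wpM2r ?(ltW s0) //.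
    rewrite -[leRHS]mul1r ler_pM ?expR_ge0 ?(ltW y0) ?(le_trans yx) //.
    by rewrite -expR0 ler_expR oppr_le0 ltW.
  have NsD : 0 <= N * s * D by rewrite mulr_ge0.
  apply/andP; split; rewrite -(ler_pM2l y0) ydf dgE.
    have a1 : 0 < 1 + a by rewrite ltr_wpDr.
    apply: (@le_trans _ _ (N * a / (1 + a) * D)).
      have -> : y * ((1 - 3 * t) * (N * s * D)) = (1 - 3 * t) * (y * (N * s * D)) by ring.
      have -> : N * a / (1 + a) * D = expR (- t) / (1 + a) * (y * (N * s * D)).
        by rewrite /a; ring.
      rewrite ler_wpM2r //; first by rewrite mulr_ge0 // ltW.
      rewrite ler_pdivlMr //; have := expR_ge1Dx (- t).
      by move: t0 t1 a_t a0; clear; nra.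
    rewrite ler_wpM2r // ler_pdivlMr //.
    have -> : N * a / (1 + a) * Zy = N * (a * Zy) / (1 + a) by ring.
    by rewrite ler_pdivrMr // [leRHS]mulrC.
  have et : expR t <= 1 + 3 * t.
    by have := @expR_sub1_le2 R t; rewrite ltW //= => /(_ _)/wrap[]; [move: t1; lra | move: t0; lra].
  apply: (@le_trans _ _ (N * (y * expR t * s) * D)).
    by rewrite ler_wpM2r // ler_pdivrMr // -[leRHS]mulrA.
  have -> : N * (y * expR t * s) * D = y * (expR t * (N * s * D)) by ring.
  by rewrite ler_wpM2l ?(ltW y0) // ler_wpM2r.
have gx : 0 <= g x <= 2 * (N * s).
  have xk1 : 0 <= x ^+ k <= 1 by rewrite exprn_ge0 // exprn_ile1.
  have qk : 0 <= q / k%:R <= 1.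
    by rewrite divr_ge0 ?(ltW k0) // ler_pdivrMr // mul1r ler_nat leq_pred.
  have h : 0 <= q / k%:R * x ^+ k <= 1.
    by case/andP: xk1 => ? ?; case/andP: qk => ? ?; rewrite mulr_ge0 // mulr_ile1.
  case/andP: h => h1 h2; rewrite /g [2 * _]mulrC mulr_ge0 ?addr_ge0 //=.
  by rewrite ler_wpM2l //; move: x1 h2; clear; lra.
have hcZ00 : hcZ (0 : R) G E0 = 1.
  rewrite /hcZ (bigD1 set0) /=; last first.
    rewrite sub0set; apply/indepP => h hE; rewrite subset0; apply: contraNneq E_0 => <-.
    by [].
  rewrite cards0 expr0 big1 ?addr0 // => X /andP[_ X0].
  by rewrite expr0n cards_eq0 (negbTE X0).
have f0 : f 0 = 0 by rewrite /f /lm mul0r mulr0 hcZ00 ln1.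
have g0 : g 0 = 0.
  by rewrite /g expr0n kq /= mulr0 addr0 mulr0.
have up : f x <= (1 + 3 * t) * g x.
  have := @le_of_derive_ge0 R (fun y => (1 + 3 * t) * g y - f y)
    (fun y => (1 + 3 * t) * dg y - df y) 0 x x0.
  rewrite f0 g0 mulr0 subr0 subr_ge0; apply => y.
    by case/andP=> y0 _; exact: (is_derive1B (is_derive1Z _ (Dg y)) (Df y y0)).
  by case/andP=> y0 /ltW yx; rewrite subr_ge0; have /andP[] := key y y0 yx.
have dn : (1 - 3 * t) * g x <= f x.
  have := @le_of_derive_ge0 R (fun y => f y - (1 - 3 * t) * g y)
    (fun y => df y - (1 - 3 * t) * dg y) 0 x x0.
  rewrite f0 g0 mulr0 subr0 subr_ge0; apply => y.
    by case/andP=> y0 _; exact: (is_derive1B (Df y y0) (is_derive1Z _ (Dg y))).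
  by case/andP=> y0 /ltW yx; rewrite subr_ge0; have /andP[] := key y y0 yx.
rewrite -/(f x) -/(g x) ler_norml.
case/andP: gx => gx0 gx1.
have h : t * g x <= tau / 16 * (2 * (N * s)) by apply: ler_pM => //; exact: ltW.
by apply/andP; split; lra.
Qed.

(** * Independent sets of prescribed size *)

Section Levels.
Variables (R : realType) (T : finType) (G : {set T}) (E : {set {set T}}).
Implicit Types (X : {set T}) (lam : R) (m : nat).

Definition hcN m := #|[set X : {set T} | [&& X \subset G, #|X| == m & indep E X]]|.

Lemma hcZ_levels lam : hcZ lam G E = \sum_(m < #|G|.+1) (hcN m)%:R * lam ^+ m.
Proof.
rewrite /hcZ (partition_big (fun X : {set T} => inord #|X| : 'I_#|G|.+1) xpredT) //=.
apply: eq_bigr => m _.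
rewrite (eq_bigr (fun=> lam ^+ m)); last first.
  move=> X /andP[/andP[XG _] /eqP <-]; rewrite inordK // ltnS; exact: subset_leq_card.
rewrite sumr_const -[LHS]mulr_natl; congr (_%:R * _); apply: eq_card => X.
rewrite inE unfold_in /=; have [XG|//] := boolP (X \subset G); rewrite /= andbC; congr (_ && _).
have cX : (#|X| < #|G|.+1)%N by rewrite ltnS subset_leq_card.
by rewrite -val_eqE /= inordK.
Qed.

Lemma hcZ_mono lam lam' : 0 <= lam <= lam' -> hcZ lam G E <= hcZ lam' G E.
Proof.
move=> /andP[l0 ll]; apply: ler_sum => X _.
by apply: lerXn2r; rewrite ?nnegrE // (le_trans l0).
Qed.

Lemma hcN_le_hcZ lam m : 0 <= lam -> (m <= #|G|)%N -> (hcN m)%:R * lam ^+ m <= hcZ lam G E.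
Proof.
move=> l0 mG; rewrite hcZ_levels (bigD1 (inord m : 'I_#|G|.+1)) //= inordK ?ltnS //.
by rewrite lerDl sumr_ge0 // => i _; rewrite mulr_ge0 ?exprn_ge0.
Qed.

Lemma hcZ_le_max lam : 0 <= lam ->
  exists2 m, (m <= #|G|)%N & hcZ lam G E <= #|G|.+1%:R * ((hcN m)%:R * lam ^+ m).
Proof.
move=> l0; pose F (i : 'I_#|G|.+1) : R := (hcN i)%:R * lam ^+ i.
case: (@Order.TotalTheory.arg_maxP _ R 'I_#|G|.+1 ord0 xpredT F isT) => i _ Fi.
exists i; first by rewrite -ltnS.
rewrite hcZ_levels; apply: (@le_trans _ _ (\sum_(j < #|G|.+1) F i)).
  by apply: ler_sum => j _; apply: Fi.
by rewrite sumr_const card_ord -[leLHS]mulr_natl.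
Qed.

(** Double counting of pairs of a set and an element to remove or to add: removing an element
    preserves independence. *)
Lemma hcN_step m : (hcN m.+1 * m.+1 <= hcN m * (#|G| - m))%N.
Proof.
pose A m := [set X : {set T} | [&& X \subset G, #|X| == m & indep E X]].
have -> : (hcN m.+1 * m.+1 = \sum_v #|[set X in A m.+1 | v \in X]|)%N.
  rewrite -sum_nat_const.
  rewrite (eq_bigr (fun X : {set T} => \sum_(v in X) 1)%N); last first.
    by move=> X; rewrite inE sum1_card => /and3P[_ /eqP].
  rewrite (exchange_big_dep xpredT) //=; apply: eq_bigr => v _.
  by rewrite -sum1_card; apply: eq_bigl => X; rewrite inE.
have -> : (hcN m * (#|G| - m) = \sum_v #|[set X in A m | v \in G :\: X]|)%N.
  rewrite -sum_nat_const.
  rewrite (eq_bigr (fun X : {set T} => \sum_(v in G :\: X) 1)%N); last first.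
    by move=> X; rewrite inE sum1_card => /and3P[XG /eqP <- _]; rewrite cardsDS.
  rewrite (exchange_big_dep xpredT) //=; apply: eq_bigr => v _.
  by rewrite -sum1_card; apply: eq_bigl => X; rewrite inE.
apply: leq_sum => v _.
rewrite -(@card_in_imset _ _ (fun X => X :\ v) [set X in A m.+1 | v \in X]).
  apply: subset_leq_card; apply/subsetP => Y /imsetP[X].
  rewrite !inE => /andP[/and3P[XG cX /indepP iX] vX] ->.
  rewrite setD11 (subsetP XG) //= andbT; apply/and3P; split.
  - exact: fintype.subset_trans (subD1set _ _) XG.
  - by move: cX; rewrite (cardsD1 v) vX.
  - apply/indepP => f fE; have := iX f fE; apply: contra => fX.
    exact: fintype.subset_trans fX (subD1set _ _).
move=> X Y; rewrite !inE => /andP[_ vX] /andP[_ vY] e.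
by rewrite -(setD1K vX) e setD1K.
Qed.

Lemma hcN_ratio_anti m m' : (m <= m' <= #|G|)%N ->
  (hcN m')%:R / 'C(#|G|, m')%:R <= (hcN m)%:R / 'C(#|G|, m)%:R :> R.
Proof.
move=> /andP[/subnKC <-]; elim: (m' - m)%N => [|i IH]; first by rewrite addn0.
rewrite addnS => h; apply: le_trans (IH (ltnW h)).
set j := (m + i)%N in h *.
have Cj : 0 < 'C(#|G|, j)%:R :> R by rewrite ltr0n bin_gt0 ltnW.
have Cj1 : 0 < 'C(#|G|, j.+1)%:R :> R by rewrite ltr0n bin_gt0.
rewrite ler_pdivrMr // mulrAC ler_pdivlMr // -!natrM ler_nat.
rewrite -(leq_pmul2r (ltn0Sn j)) mulnAC.
have -> : (hcN j * 'C(#|G|, j.+1) * j.+1 = hcN j * (#|G| - j) * 'C(#|G|, j))%N.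
  by rewrite -mulnA [('C(_, j.+1) * _)%N]mulnC mul_bin_left mulnA.
by rewrite leq_mul2r hcN_step orbT.
Qed.

End Levels.

(** * Factorials and binomial coefficients on the logarithmic scale *)

Lemma le_ffact (n m : nat) : ((n - m) ^ m <= n ^_ m)%N.
Proof.
elim: m n => [|m IH] [|n] //; first by rewrite sub0n exp0n.
by rewrite subSS ffactSS expnS leq_mul // leqW // leq_subr.
Qed.

Lemma ffact_le_exp (n m : nat) : (n ^_ m <= n ^ m)%N.
Proof.
elim: m n => [|m IH] [|n] //; rewrite ffactSS expnS leq_mul2l /=.
by apply: leq_trans (IH n) _; case: (m) => // m'; rewrite leq_exp2r.
Qed.

Section BinomialBounds.
Variable R : realType.

Lemma ln_bin_le (N m : nat) : (0 < m <= N)%N ->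
  ln 'C(N, m)%:R <= m%:R * (1 + ln N%:R - ln m%:R) :> R.
Proof.
move=> /andP[m0 mN]; have N0 : (0 < N)%N by apply: leq_trans mN.
have mR : 0 < m%:R :> R by rewrite ltr0n.
have NR : 0 < N%:R :> R by rewrite ltr0n.
have f0 : 0 < m`!%:R :> R by rewrite ltr0n fact_gt0.
have C0 : 0 < 'C(N, m)%:R :> R by rewrite ltr0n bin_gt0.
have h1 : m%:R ^+ m / m`!%:R <= expR m%:R :> R.
  have := @expR_ge1Dxn R m%:R m.-1 (ltW mR); rewrite prednK //; apply: le_trans.
  by rewrite lerDr.
have h2 : 'C(N, m)%:R * m`!%:R <= N%:R ^+ m :> R.
  rewrite -natrM -natrX ler_nat bin_ffact; exact: ffact_le_exp.
have h3 : 'C(N, m)%:R * m%:R ^+ m <= expR m%:R * N%:R ^+ m :> R.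
  have h1' : m%:R ^+ m <= expR m%:R * m`!%:R :> R by rewrite -ler_pdivrMr.
  rewrite -(ler_pM2r f0); apply: (@le_trans _ _ ((N%:R ^+ m) * (expR m%:R * m`!%:R) : R)).
    by rewrite mulrAC; apply: ler_pM; rewrite ?exprn_ge0 ?mulr_ge0.
  by rewrite le_eqVlt; apply/orP; left; apply/eqP; ring.
have := h3; rewrite -ler_ln ?posrE ?mulr_gt0 ?exprn_gt0 ?expR_gt0 //.
rewrite !lnM ?posrE ?exprn_gt0 ?expR_gt0 // !lnXn // expRK.
rewrite -[ln m%:R *+ m]mulr_natl -[ln N%:R *+ m]mulr_natl; lra.
Qed.

(** The induction from [m + 1] to [m + 2] amounts to [1 <= (m+2) (ln (m+2) - ln (m+1))], which is
    [ln (1 + x) <= x] at [x = -1/(m+2)]. *)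
Lemma ln_fact_le (m : nat) : (0 < m)%N ->
  ln m`!%:R <= 1 + ln m%:R + m%:R * (ln m%:R - 1) :> R.
Proof.
elim: m => // -[_ _|m IH _]; first by rewrite ln1; lra.
have m0 : 0 < m.+1%:R :> R by [].
have m1 : 0 < m.+2%:R :> R by [].
rewrite factS natrM lnM ?posrE // ?ltr0n ?fact_gt0 //.
have {}IH := IH isT.
have h : m.+2%:R^-1 <= ln m.+2%:R - ln m.+1%:R :> R.
  have := @le_ln1Dx R (- m.+2%:R^-1).
  have -> : 1 + - m.+2%:R^-1 = m.+1%:R / m.+2%:R :> R.
    rewrite -[m.+2%:R]natr1 in m1 *; move: (m.+1%:R : R) m1 => x x1.
    by field; rewrite gt_eqF.
  rewrite ln_div ?posrE // => /(_ _)/wrap[]; last by rewrite lerNr opprB.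
  by rewrite ltrN2 invf_lt1 // ltr1n.
have h' : 1 <= m.+2%:R * (ln m.+2%:R - ln m.+1%:R) :> R.
  by rewrite -ler_pdivrMl // mulr1.
move: IH h'; rewrite -[m.+2%:R]natr1 !mulrDl; nra.
Qed.

Lemma ln_bin_ge (N m : nat) : (0 < m < N)%N ->
  m%:R * (1 + ln (N%:R - m%:R) - ln m%:R) - (1 + ln m%:R) <= ln 'C(N, m)%:R :> R.
Proof.
move=> /andP[m0 mN].
have f0 : 0 < m`!%:R :> R by rewrite ltr0n fact_gt0.
have C0 : 0 < 'C(N, m)%:R :> R by rewrite ltr0n bin_gt0 ltnW.
have Nm : 0 < N%:R - m%:R :> R by rewrite subr_gt0 ltr_nat.
have : (N%:R - m%:R) ^+ m <= 'C(N, m)%:R * m`!%:R :> R.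
  by rewrite -natrB ?(ltnW mN) // -natrX -natrM ler_nat bin_ffact le_ffact.
rewrite -ler_ln ?posrE ?mulr_gt0 ?exprn_gt0 // lnM ?posrE // lnXn //.
rewrite -[_ *+ m]mulr_natl; have := ln_fact_le m0; lra.
Qed.

End BinomialBounds.

(** * Copies of a strictly 2-balanced graph *)

Section StrictlyBalanced.
Variables (V : finType) (H : {set {set V}}).
Hypothesis Hsimple : simple_graph H.
Hypothesis Hbal : strictly_2_balanced H.
Local Notation h := #|V|.
Local Notation k := #|H|.

Lemma d2_ltE (nv ne nv' ne' : nat) : (3 <= nv)%N -> (3 <= nv')%N -> (1 <= ne)%N -> (1 <= ne')%N ->
  (d2 nv ne < d2 nv' ne') = ((ne - 1) * (nv' - 2) < (ne' - 1) * (nv - 2))%N.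
Proof.
move=> v3 v3' e1 e1'; rewrite /d2.
have natB (m i : nat) : (i <= m)%N -> m%:Q - i%:Q = (m - i)%N%:Q.
  by move=> im; rewrite -!pmulrn natrB.
have nvp m : (3 <= m)%N -> 0 < (m - 2)%N%:Q.
  by move=> m3; rewrite -!pmulrn ltr0n subn_gt0.
rewrite (natB ne 1%N) // (natB ne' 1%N) // (natB nv 2%N) ?(natB nv' 2%N); try exact: ltnW.
rewrite ltr_pdivrMr ?nvp // mulrAC ltr_pdivlMr ?nvp //.
by rewrite -!pmulrn -!natrM ltr_nat.
Qed.

Lemma edges_ge3 : (3 <= k)%N. Proof. by case: Hbal. Qed.

Lemma edges_on_le (S : {set V}) (E : {set {set V}}) : E \subset H ->
  (forall e, e \in E -> e \subset S) -> (#|E| <= 'C(#|S|, 2))%N.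
Proof.
move=> EH ES; rewrite -cards_draws; apply: subset_leq_card; apply/subsetP => e eE.
by rewrite inE ES //= Hsimple // (subsetP EH).
Qed.

Lemma vertices_ge3 : (3 <= h)%N.
Proof.
have := @edges_on_le [set: V] H (fintype.subxx _) (fun e _ => finset.subsetT e).
rewrite cardsT; have := edges_ge3; case: (h) => [|[|[|n]]] // k3 /(leq_trans k3) //.
Qed.

Lemma sub_balanced (S : {set V}) (E : {set {set V}}) : E \subset H -> E != H ->
  (forall e, e \in E -> e \subset S) -> (3 <= #|S|)%N -> (1 <= #|E|)%N ->
  ((#|E| - 1) * (h - 2) < (k - 1) * (#|S| - 2))%N.
Proof.
move=> EH EnH ES S3 E1; rewrite -d2_ltE ?vertices_ge3 //; last first.
  by apply: leq_trans edges_ge3.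
by case: Hbal => _; apply=> // -[_ EH']; rewrite EH' eqxx in EnH.
Qed.

Lemma card_cover_ge3 (E : {set {set V}}) : E \subset H -> (2 <= #|E|)%N -> (3 <= #|cover E|)%N.
Proof.
move=> EH E2; rewrite ltnNge; apply/negP => c2.
have : (#|E| <= 'C(#|cover E|, 2))%N.
  apply: edges_on_le => // e eE; exact: (bigcup_max e).
rewrite leqNgt; move/negP; apply; apply: leq_ltn_trans E2.
by move: c2; case: #|cover E| => [|[|[|]]].
Qed.

Lemma cover_balanced (E : {set {set V}}) : E \subset H -> (2 <= #|E| < k)%N ->
  ((#|E| - 1) * (h - 2) < (k - 1) * (#|cover E| - 2))%N.
Proof.
move=> EH /andP[E2 Ek]; apply: sub_balanced => //.
- by apply: contraTneq Ek => ->; rewrite ltnn.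
- move=> e eE; exact: (bigcup_max e).
- exact: card_cover_ge3.
- exact: ltnW.
Qed.

(** Two edges sharing a vertex span three vertices, and balancedness for this pair reads
    [h - 2 < k - 1]. If no two edges meet, then [2 * k <= h], whereas balancedness for two disjoint
    edges gives [h < 2 * k]. *)
Lemma vertices_le_edges : (h <= k)%N.
Proof.
have k3 := edges_ge3; have h3 := vertices_ge3.
have [/existsP[[e f] /and4P[/= eH fH ef]]|no] := boolP [exists p : {set V} * {set V},
    [&& p.1 \in H, p.2 \in H, p.1 != p.2 & ~~ [disjoint p.1 & p.2]]]; last first.
  have tH : trivIset H.
    apply/trivIsetP => e f eH fH ef; apply: contraNT no => d.
    by apply/existsP; exists (e, f); rewrite /= eH fH ef.
  have ck : (2 * k <= h)%N.
    have := leq_card_cover H => -[_]; rewrite tH => /eqP e1.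
    have : (\sum_(e in H) #|e| = k * 2)%N.
      by rewrite -sum_nat_const; apply: eq_bigr => e /Hsimple.
    by rewrite -e1 mulnC => <-; rewrite max_card.
  have /card_gt0P[e eH] : (0 < k)%N by apply: leq_trans k3.
  have /card_gt0P[f] : (0 < #|H :\ e|)%N.
    by move: k3; rewrite (cardsD1 e) eH add1n ltnS; apply: leq_trans.
  rewrite !inE => /andP[fe fH].
  have sub : [set e; f] \subset H by rewrite subUset !sub1set eH fH.
  have c2 : #|[set e; f]| = 2%N by rewrite cards2 eq_sym fe.
  have := cover_balanced sub; rewrite c2 => /(_ k3).
  have -> : #|cover [set e; f]| = 4%N.
    have := leq_card_cover [set e; f] => -[_]; rewrite (trivIsetS sub tH) => /eqP ->.
    by rewrite big_setU1 ?big_set1 ?inE 1?eq_sym //= !Hsimple.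
  by move: ck h3; clear; lia.
rewrite -setI_eq0 => /set0Pn[w]; rewrite inE => /andP[we wf].
have sub : [set e; f] \subset H by rewrite subUset !sub1set eH fH.
have c2 : #|[set e; f]| = 2%N by rewrite cards2 ef.
have := cover_balanced sub; rewrite c2 => /(_ k3).
have cle : (#|cover [set e; f]| <= 3)%N.
  rewrite /cover big_setU1 ?inE //= big_set1.
  rewrite cardsU (Hsimple eH) (Hsimple fH).
  have : (0 < #|e :&: f|)%N by apply/card_gt0P; exists w; rewrite inE we wf.
  by rewrite leq_subLR; case: #|e :&: f| => // n _; clear; lia.
have : ((k - 1) * (#|cover [set e; f]| - 2) <= (k - 1) * 1)%N.
  by rewrite leq_mul2l leq_subLR cle orbT.
move=> a b; have := leq_trans b a; rewrite mul1n muln1.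
have gen (a0 b0 : nat) : (2 < a0 -> 2 < b0 -> b0 - 2 < a0 - 1 -> b0 <= a0)%N by clear; lia.
exact: gen.
Qed.

(** If [w] lost its last edge, the remaining [k - 1] edges would live on [h - 1] vertices and
    balancedness would force [k + 1 < h]. For [h = 3] that subgraph is too small for balancedness,
    but two vertices carry only one edge. This is what controls copies differing in one edge. *)
Lemma cover_del e : e \in H -> cover (H :\ e) = [set: V].
Proof.
move=> eH; have k3 := edges_ge3; have h3 := vertices_ge3; have hk := vertices_le_edges.
apply/eqP; rewrite -subTset; apply/subsetP => w _; apply/negPn/negP => wC.
have ck : #|H :\ e| = (k - 1)%N by rewrite (cardsD1 e H) eH add1n subn1.
have EH : H :\ e \subset H by apply: subD1set.
have ES f : f \in H :\ e -> f \subset [set~ w].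
  move=> fE; apply/subsetP => y yf; rewrite !inE; apply: contraNneq wC => <-.
  by apply/bigcupP; exists f.
have cS : #|[set~ w]| = (h - 1)%N by rewrite cardsC1 subn1.
have [h4|h4] := leqP 4 h.
  have := @sub_balanced [set~ w] (H :\ e) EH; rewrite cS ck.
  move=> /(_ _ ES _ _)/wrap[].
  - by apply/eqP => HE; rewrite -HE setD11 in eH.
  - by move: h4; clear; lia.
  - by move: k3; clear; lia.
  by move: h4 hk; clear; nia.
have := edges_on_le EH ES; rewrite cS ck.
have -> : h = 3%N by apply/eqP; rewrite eqn_leq h3 -ltnS h4.
by rewrite binn; move: k3; clear; lia.
Qed.

Lemma cover_full : cover H = [set: V].
Proof.
have /card_gt0P[e eH] : (0 < k)%N by apply: leq_trans edges_ge3.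
apply/eqP; rewrite -subTset -(cover_del eH); apply/bigcupsP => f.
by rewrite inE => /andP[_ fH]; apply: (bigcup_max f).
Qed.

End StrictlyBalanced.

(** * Images of graphs under vertex maps *)

Section Image.
Implicit Types T U W : finType.

Definition imgraph T U (f : T -> U) (A : {set {set T}}) : {set {set U}} :=
  [set f @: (e : {set T}) | e in A].

Lemma imgraph_inj T U (f : T -> U) : injective f -> injective (imgraph f).
Proof. by move=> fI; apply: imset_inj; apply: imset_inj. Qed.

Lemma imgraph_comp T U W (f : T -> U) (g : U -> W) (A : {set {set T}}) :
  imgraph (fun x => g (f x)) A = imgraph g (imgraph f A).
Proof.
rewrite /imgraph -imset_comp; apply: eq_imset => e /=.
by rewrite -imset_comp.
Qed.

Lemma eq_imgraph T U (f g : T -> U) (A : {set {set T}}) : f =1 g -> imgraph f A = imgraph g A.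
Proof. by move=> fg; apply: eq_imset => e; apply: eq_imset. Qed.

Lemma cover_imgraph T U (f : T -> U) (A : {set {set T}}) :
  cover (imgraph f A) = f @: cover A.
Proof.
apply/setP => y; apply/bigcupP/imsetP => [[_ /imsetP[e eA ->] /imsetP[x xe ->]]|[x /bigcupP[e eA xe] ->]].
  by exists x => //; apply/bigcupP; exists e.
by exists (f @: e); apply: imset_f.
Qed.

Lemma card_imgraph T U (f : T -> U) (A : {set {set T}}) : injective f -> #|imgraph f A| = #|A|.
Proof. by move=> fI; rewrite card_imset //; apply: imset_inj. Qed.

End Image.

Lemma perm_pair (T : finType) (a b : {set T}) : #|a| = 2%N -> #|b| = 2%N ->
  exists s : {perm T}, s @: a = b.
Proof.
move=> /eqP/cards2P[x [y [xy ->]]] /eqP/cards2P[x' [y' [xy' ->]]].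
pose s1 := tperm x x'; pose s2 := tperm (s1 y) y'.
have e1 : s1 x = x' by rewrite tpermL.
have ne : x' != s1 y by rewrite -e1 (inj_eq perm_inj).
exists (s1 * s2)%g; rewrite imsetU1 imset_set1 !permM e1.
by rewrite tpermL tpermD // eq_sym // eq_sym.
Qed.

(** * Counting copies in the complete graph *)

Section Copies.
Variables (V : finType) (H : {set {set V}}).
Hypothesis Hsimple : simple_graph H.
Hypothesis Hbal : strictly_2_balanced H.
Variable n : nat.
Local Notation h := #|V|.
Local Notation k := #|H|.
Implicit Types (f : {ffun V -> 'I_n}) (F : {set {set 'I_n}}).

Definition emb := [set f : {ffun V -> 'I_n} | injectiveb f].

Lemma embP f : reflect (injective f) (f \in emb).
Proof. by rewrite inE; apply: injectiveP. Qed.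

Lemma copiesE : copies H n = [set imgraph f H | f : {ffun V -> 'I_n} in emb].
Proof. by []. Qed.

Lemma card_copy F : F \in copies H n -> #|F| = k.
Proof. by rewrite copiesE => /imsetP[f /embP fI ->]; rewrite card_imgraph. Qed.

Lemma copy_sub_Kn F : F \in copies H n -> F \subset Kn n.
Proof.
rewrite copiesE => /imsetP[f /embP fI ->]; apply/subsetP => _ /imsetP[e eH ->].
by rewrite inE card_imset // Hsimple.
Qed.

(** As [H] has no isolated vertex, a copy determines its vertex set; two embeddings onto the same
    copy then differ by a permutation of [V], necessarily an automorphism. *)
Lemma card_emb_fiber (f0 : {ffun V -> 'I_n}) : injective f0 ->
  #|[set f in emb | imgraph f H == imgraph f0 H]| = aut_card H.
Proof.
move=> f0I; rewrite /aut_card.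
pose phi (s : {perm V}) : {ffun V -> 'I_n} := [ffun v => f0 (s v)].
have phiI : injective phi.
  move=> s s' /ffunP e; apply/perm.permP => v; have := e v; rewrite !ffunE; exact: f0I.
rewrite -(card_imset _ phiI); apply: eq_card => f; rewrite inE.
have phiH s : imgraph (phi s) H = imgraph f0 (imgraph s H).
  by rewrite -imgraph_comp; apply: eq_imgraph => v; rewrite ffunE.
apply/andP/imsetP => [[/embP fI /eqP fE]|[s]]; last first.
  rewrite inE => /eqP sH ->; split; last by rewrite phiH /imgraph sH.
  by apply/embP => v v'; rewrite !ffunE => /f0I/perm_inj.
have fV : f @: [set: V] = f0 @: [set: V].
  by rewrite -(cover_full Hsimple Hbal) -!cover_imgraph fE.
have pre v : exists w, f0 w == f v.
  have : f v \in f @: [set: V] by apply: imset_f.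
  by rewrite fV => /imsetP[w _ ->]; exists w.
pose g v := xchoose (pre v).
have gE v : f0 (g v) = f v by apply/eqP; apply: (xchooseP (pre v)).
have gI : injective g by move=> v v' e; apply: fI; rewrite -!gE e.
have fphi : f = phi (perm gI) by apply/ffunP => v; rewrite ffunE permE gE.
exists (perm gI) => //; rewrite inE; apply/eqP.
by apply: (imgraph_inj f0I); rewrite -phiH -fphi.
Qed.

Lemma card_copies : (#|copies H n| * aut_card H = n ^_ h)%N.
Proof.
have := card_inj_ffuns V 'I_n; rewrite card_ord => <-.
rewrite -/emb -[RHS]sum1_card (partition_big_imset (fun f : {ffun V -> 'I_n} => imgraph f H)) /=.
rewrite -copiesE -sum_nat_const; apply: eq_bigr => F.
rewrite copiesE => /imsetP[f0 /embP f0I ->].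
by rewrite -(card_emb_fiber f0I) -sum1_card; apply: eq_bigl => f; rewrite inE.
Qed.

Definition edge_deg (a : {set 'I_n}) := #|[set F in copies H n | a \in F]|.

(** Permutations of the vertices act transitively on edges and preserve copies; exchanging [a] and
    [b] gives exact regularity. *)
Lemma edge_deg_le a b : a \in Kn n -> b \in Kn n -> (edge_deg a <= edge_deg b)%N.
Proof.
rewrite !inE => /eqP ca /eqP cb; have [s sab] := perm_pair ca cb.
have sI : injective s by apply: perm_inj.
rewrite /edge_deg -[leqLHS](card_imset _ (imgraph_inj sI)).
apply: subset_leq_card; apply/subsetP => F' /imsetP[F]; rewrite inE => /andP[FH aF] ->.
rewrite inE; apply/andP; split; last by rewrite -sab imset_f.
move: FH; rewrite copiesE => /imsetP[f /embP fI ->].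
apply/imsetP; exists [ffun v => s (f v)].
  by apply/embP => v v'; rewrite !ffunE => /sI/fI.
by rewrite -imgraph_comp; apply: eq_imgraph => v; rewrite ffunE.
Qed.

Lemma sum_edge_deg : (\sum_(a in Kn n) edge_deg a = #|copies H n| * k)%N.
Proof.
rewrite -sum_nat_const.
rewrite (eq_bigr (fun a => \sum_(F in copies H n | a \in F) 1)%N); last first.
  by move=> a _; rewrite /edge_deg -sum1_card; apply: eq_bigl => F; rewrite inE.
rewrite (exchange_big_dep (mem (copies H n))) /=; last by move=> a F _ /andP[].
apply: eq_bigr => F FH; rewrite -(card_copy FH) -sum1_card; apply: eq_bigl => a.
by rewrite FH /= andb_idl // => /(subsetP (copy_sub_Kn FH)).
Qed.

Lemma card_Kn : #|Kn n| = 'C(n, 2).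
Proof. by rewrite card_draws card_ord. Qed.

Lemma edge_degE a : a \in Kn n -> (edge_deg a * aut_card H = 2 * k * (n - 2) ^_ (h - 2))%N.
Proof.
move=> aK; have n2 : (2 <= n)%N.
  have : (0 < #|Kn n|)%N by apply/card_gt0P; exists a.
  by rewrite card_Kn bin_gt0.
have C0 : (0 < 'C(n, 2))%N by rewrite bin_gt0.
have h3 := vertices_ge3 Hsimple Hbal.
apply/eqP; rewrite -(eqn_pmul2r C0); apply/eqP.
have := sum_edge_deg; rewrite (eq_bigr (fun=> edge_deg a)); last first.
  by move=> b bK; apply/eqP; rewrite eqn_leq !edge_deg_le.
rewrite sum_nat_const card_Kn => e.
rewrite mulnAC [(edge_deg a * _)%N]mulnC e mulnAC card_copies.
have -> : (n ^_ h = n * n.-1 * (n - 2) ^_ (h - 2))%N.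
  have hE : h = (h - 2).+2 by rewrite -addn2 subnK // ltnW.
  by rewrite [in LHS]hE !ffactnS mulnA !subn2.
have -> : (n * n.-1 = 2 * 'C(n, 2))%N.
  by have := bin_ffact n 2; rewrite !ffactnS ffactn0 muln1 => <-; rewrite mulnC.
by ring.
Qed.

Lemma card_into (S : {set V}) (A : {set 'I_n}) :
  #|[set f : {ffun V -> 'I_n} | [forall v in S, f v \in A]]| = (#|A| ^ #|S| * n ^ (h - #|S|))%N.
Proof.
pose B v : {set 'I_n} := if v \in S then A else [set: 'I_n].
have -> : #|[set f : {ffun V -> 'I_n} | [forall v in S, f v \in A]]| = #|family (fun v => mem (B v))|.
  apply: eq_card => f; rewrite inE; apply/forall_inP/familyP => fB v; rewrite /B.
    by case: ifP => [/fB|_]; rewrite ?inE.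
  by move=> vS; have := fB v; rewrite /B vS.
rewrite card_family foldrE big_map big_enum /= (bigID (mem S)) /=.
congr (_ * _)%N.
  rewrite -prod_nat_const; apply: eq_bigr => v vS; by rewrite /B vS.
rewrite (eq_bigr (fun=> n)); last by move=> v vS; rewrite /B (negbTE vS) cardsT card_ord.
rewrite prod_nat_const; congr (_ ^ _)%N.
by rewrite -(cardC S) addKn; apply: eq_card => v; rewrite !inE.
Qed.

(** An embedding onto such a copy is described by the preimage of [W], the map from it into [W], and
    [h - #|W|] free images. *)
Lemma card_copies_cover (W : {set 'I_n}) : (#|W| <= h)%N ->
  (#|[set F in copies H n | W \subset cover F]| <= 2 ^ h * h ^ h * n ^ (h - #|W|))%N.
Proof.
move=> Wh.
pose P := [set S : {set V} | #|S| == #|W|].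
have sub : [set F in copies H n | W \subset cover F] \subset
   [set imgraph f H | f : {ffun V -> 'I_n} in \bigcup_(S in P) [set f : {ffun V -> 'I_n} | [forall v in S, f v \in W]]].
  apply/subsetP => F; rewrite inE copiesE => /andP[/imsetP[f /embP fI ->]].
  rewrite cover_imgraph (cover_full Hsimple Hbal) => WV.
  apply/imsetP; exists f => //; apply/bigcupP; exists (f @^-1: W).
    rewrite inE -(card_imset _ fI); apply/eqP; congr #|pred_of_set _|.
    apply/setP => y; apply/imsetP/idP => [[v]|yW]; first by rewrite inE => vW ->.
    by have /imsetP[v _ e] := subsetP WV _ yW; exists v; rewrite // inE -e.
  by rewrite inE; apply/forall_inP => v; rewrite inE.
apply: leq_trans (subset_leq_card sub) _; apply: leq_trans (leq_imset_card _ _) _.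
apply: (@leq_trans (\sum_(S in P) h ^ h * n ^ (h - #|W|))%N); last first.
  rewrite sum_nat_const mulnA leq_mul2r; apply/orP; right.
  rewrite leq_mul2r; apply/orP; right.
  rewrite -[X in (2 ^ X)%N]cardsT -card_powerset subset_leq_card //.
  by apply/subsetP => S _; rewrite inE finset.subsetT.
apply: (@leq_trans (\sum_(S in P) #|[set f : {ffun V -> 'I_n} | [forall v in S, f v \in W]]|)%N).
  elim/big_rec2: _ => [|S m A _ hh]; first by rewrite cards0.
  by apply: leq_trans (leq_card_setU _ _) _; rewrite leq_add2l.
apply: leq_sum => S; rewrite inE => /eqP cS; rewrite card_into cS leq_mul2r; apply/orP; right.
have h0 : (0 < h)%N by apply: leq_trans (vertices_ge3 Hsimple Hbal).
by apply: leq_trans (leq_pexp2l h0 Wh); case: (posnP #|W|) => [->|w0] //; rewrite leq_exp2r.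
Qed.

End Copies.

(** * Quasi-regularity of the hypergraph of copies *)

Section Asymptotics.
Variables (R : realType) (V : finType) (H : {set {set V}}).
Hypothesis Hsimple : simple_graph H.
Hypothesis Hbal : strictly_2_balanced H.
Local Notation h := #|V|.
Local Notation k := #|H|.
Local Notation q := k.-1.

Definition scale (n : nat) : R := DeltaH R H n `^ (- (k - 1)%:R^-1).

(** For [2 * h <= n] the falling factorial in [DeltaH] is at least [(n / 2) ^ (h - 2)]; this
    constant compares [n ^ (h - 2)] with [DeltaH]. *)
Definition sparsity_const : nat := (2 ^ (h - 2) * aut_card H)%N.

Lemma aut_card_gt0 : (0 < aut_card H)%N.
Proof.
apply/card_gt0P; exists 1%g; rewrite inE; apply/eqP.
rewrite -[RHS]imset_id; apply: eq_imset => e.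
by rewrite -[RHS]imset_id; apply: eq_imset => v; rewrite perm1.
Qed.

Let k3 : (3 <= k)%N. Proof. exact: edges_ge3. Qed.
Let h3 : (3 <= h)%N. Proof. exact: (vertices_ge3 Hsimple Hbal). Qed.
Let hk : (h <= k)%N. Proof. exact: (vertices_le_edges Hsimple Hbal). Qed.
Let q0 : (0 < q)%N. Proof. by move: k3; clear; case: k => [|[|]]. Qed.

Lemma sparsity_const_gt0 : (0 < sparsity_const)%N.
Proof. by rewrite muln_gt0 expn_gt0 aut_card_gt0. Qed.

Lemma expn_le_Delta (n : nat) : (2 * h <= n)%N ->
  (n ^ (h - 2))%:R <= sparsity_const%:R * DeltaH R H n.
Proof.
move=> hn; rewrite /DeltaH.
have a0 : 0 < (aut_card H)%:R :> R by rewrite ltr0n aut_card_gt0.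
rewrite /sparsity_const [(_ * aut_card H)%:R]natrM [X in _ <= X](_ : _ = (2 ^ (h - 2))%:R * ((2 * k)%:R * ((n - 2) ^_ (h - 2))%:R)); last first.
  by field; rewrite gt_eqF.
rewrite -!natrM ler_nat.
apply: (@leq_trans (2 ^ (h - 2) * (n - 2) ^_ (h - 2))%N); last first.
  rewrite leq_mul2l leq_pmull ?orbT // muln_gt0 /=; exact: leq_trans k3.
apply: (@leq_trans (2 ^ (h - 2) * (n - h) ^ (h - 2))%N).
  rewrite -expnMn leq_exp2r; last by rewrite subn_gt0.
  by move: hn; clear; lia.
rewrite leq_mul2l; apply/orP; right; apply: leq_trans (le_ffact _ _).
by rewrite -subnDA subnKC // ltnW.
Qed.

Lemma Delta_le_expn (n : nat) : DeltaH R H n <= (2 * k * n ^ (h - 2))%:R.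
Proof.
have a0 : 1 <= (aut_card H)%:R :> R by rewrite ler1n aut_card_gt0.
rewrite /DeltaH ler_pdivrMr; last by apply: lt_le_trans a0.
apply: (@le_trans _ _ (2 * k * n ^ (h - 2))%:R); last by rewrite ler_peMr.
rewrite -natrM ler_nat leq_mul2l; apply/orP; right.
apply: leq_trans (ffact_le_exp _ _) _; rewrite leq_exp2r ?leq_subr // subn_gt0.
exact: h3.
Qed.

Lemma Delta_gt0 (n : nat) : (2 * h <= n)%N -> 0 < DeltaH R H n.
Proof.
move=> hn; have n0 : (0 < n)%N.
  by apply: leq_trans hn; rewrite muln_gt0 /=; apply: leq_trans h3.
have : 0 < sparsity_const%:R * DeltaH R H n.
  by apply: lt_le_trans (expn_le_Delta hn); rewrite ltr0n expn_gt0 n0.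
by rewrite pmulr_rgt0 // ltr0n sparsity_const_gt0.
Qed.

Lemma scale_gt0 (n : nat) : (2 * h <= n)%N -> 0 < scale n.
Proof. by move=> hn; rewrite powR_gt0 // Delta_gt0. Qed.

Lemma scaleX (n : nat) : (2 * h <= n)%N -> scale n ^+ q = (DeltaH R H n)^-1.
Proof.
move=> hn; rewrite /scale -powR_mulrn ?powR_ge0 // -powRrM subn1 mulNr mulVf.
  by rewrite powR_inv1 // ltW // Delta_gt0.
by rewrite pnatr_eq0 -lt0n.
Qed.

Lemma edge_deg_scale (n : nat) (a : {set 'I_n}) : (2 * h <= n)%N -> a \in Kn n ->
  (edge_deg H a)%:R * scale n ^+ q = 1.
Proof.
move=> hn aK; rewrite scaleX //.
have a0 : 0 < (aut_card H)%:R :> R by rewrite ltr0n aut_card_gt0.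
have -> : (edge_deg H a)%:R = DeltaH R H n.
  rewrite /DeltaH -natrM -(edge_degE Hsimple Hbal aK) natrM mulfK // gt_eqF //.
by rewrite mulfV // gt_eqF // Delta_gt0.
Qed.

Local Notation s := scale.
Local Notation C := (2 ^ h * h ^ h)%N.
Local Notation K := sparsity_const.
Let K0 : (0 < K)%N. Proof. exact: sparsity_const_gt0. Qed.
Let KR0 : 0 < K%:R :> R. Proof. by rewrite ltr0n. Qed.

(** The power [q] clears the fractional exponent of the scale. If some copy contains [J], then [J]
    is the image of a proper subgraph, and every copy over [J] contains its vertices. The strict
    inequality of balancedness, being between integers, leaves one spare factor [n]. *)
Lemma codeg_copies_le (n : nat) (J : {set {set 'I_n}}) : (0 < n)%N -> (2 <= #|J| < k)%N ->
  ((codeg (copies H n) J) ^ q * n <= C ^ q * (n ^ (h - 2)) ^ (k - #|J|))%N.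
Proof.
move=> n0 /andP[J2 Jk].
have [->|] := posnP (codeg (copies H n) J); first by rewrite exp0n.
move=> /card_gt0P[F]; rewrite inE copiesE => /andP[/imsetP[f /embP fI ->] JF].
pose E := [set e in H | f @: (e : {set V}) \in J].
have EJ : imgraph f E = J.
  apply/setP => a; apply/imsetP/idP => [[e]|aJ]; first by rewrite inE => /andP[_ ?] ->.
  by have /imsetP[e eH ae] := subsetP JF _ aJ; exists e; rewrite // inE eH -ae.
have cE : #|E| = #|J| by rewrite -EJ card_imgraph.
have EH : E \subset H by apply/subsetP => e; rewrite inE => /andP[].
have := cover_balanced Hsimple Hbal EH; rewrite cE J2 Jk => /(_ isT).
have -> : #|cover E| = #|cover J| by rewrite -EJ cover_imgraph card_imset.
have w3 : (3 <= #|cover J|)%N.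
  by rewrite -EJ cover_imgraph card_imset // (card_cover_ge3 Hsimple) // cE.
have wh : (#|cover J| <= h)%N.
  by rewrite -EJ cover_imgraph card_imset // max_card.
set w := #|cover J| in w3 wh *; set j := #|J| in J2 Jk * => wj.
have cJ : (codeg (copies H n) J <= C * n ^ (h - w))%N.
  apply: leq_trans (card_copies_cover Hsimple Hbal wh); apply: subset_leq_card.
  apply/subsetP => F'; rewrite !inE => /andP[-> JF'] /=.
  by apply/bigcupsP => a aJ; apply: (bigcup_max a) => //; apply: (subsetP JF').
apply: (@leq_trans ((C * n ^ (h - w)) ^ q * n)%N).
  by rewrite leq_mul2r leq_exp2r // cJ orbT.
rewrite expnMn -mulnA leq_mul2l; apply/orP; right.
rewrite -!expnM -expnSr leq_pexp2l //.
have kj : (k - j = (k - 1) - (j - 1))%N by move: J2 Jk; clear; lia.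
have hw : (h - w = (h - 2) - (w - 2))%N by move: w3 wh; clear; lia.
have gen (a b c e : nat) : (e * a < c * b -> b <= a -> e <= c ->
    ((a - b) * c).+1 <= a * (c - e))%N.
  rewrite mulnBl mulnBr => ca ba ec.
  have h1 : (b * c <= a * c)%N by rewrite leq_mul2r ba orbT.
  have h2 : (a * e <= a * c)%N by rewrite leq_mul2l ec orbT.
  move: ca h1 h2; rewrite [(e * a)%N]mulnC [(c * b)%N]mulnC.
  by move: (a * c)%N (b * c)%N (a * e)%N => x y z; clear; lia.
rewrite kj hw -subn1; apply: gen wj _ _; first by rewrite leq_sub2r.
by rewrite leq_sub2r // ltnW.
Qed.

(** A copy without one edge still covers all its vertices, so both copies have the same vertex set.
    It contains [c :|: v], hence at least three prescribed vertices, one more than for the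
    degree. *)
Lemma twin_copies_le (n : nat) (c v : {set 'I_n}) : (0 < n)%N -> c != v ->
  (#|[set F in copies H n | (v \in F) && (c |: (F :\ v) \in copies H n)]| * n
     <= C * n ^ (h - 2))%N.
Proof.
move=> n0 cv; set A := [set F in _ | _].
have AP F : F \in A -> [/\ #|c| = 2%N, #|v| = 2%N & c :|: v \subset cover F].
  rewrite inE => /and3P[FH vF cF].
  have := subsetP (copy_sub_Kn Hsimple FH) _ vF; rewrite inE => /eqP v2.
  have := subsetP (copy_sub_Kn Hsimple cF) _ (setU11 _ _); rewrite inE => /eqP c2.
  split=> //.
  have vc : v \subset cover F by apply: (bigcup_max v).
  rewrite subUset vc andbT.
  move: FH vF cF vc; rewrite copiesE => /imsetP[f /embP fI ->] /imsetP[e eH ve].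
  move=> /imsetP[f' /embP f'I f'E] _.
  have FvE : imgraph f H :\ v = imgraph f (H :\ e).
    apply/setP => a; rewrite !inE; apply/andP/imsetP => [[av /imsetP[e' e'H ae']]|[e']].
      by exists e' => //; rewrite !inE e'H andbT; apply: contraNneq av => e'e; rewrite ae' e'e -ve.
    rewrite !inE => /andP[e'e e'H] ->; split; last exact: imset_f.
    by rewrite ve (inj_eq (imset_inj fI)).
  have covFv : cover (imgraph f H :\ v) = f @: [set: V].
    by rewrite FvE cover_imgraph (cover_del Hsimple Hbal).
  have covF : cover (imgraph f H) = f @: [set: V].
    by rewrite cover_imgraph (cover_full Hsimple Hbal).
  have covF' : cover (c |: (imgraph f H :\ v)) = f' @: [set: V].
    by rewrite f'E cover_imgraph (cover_full Hsimple Hbal).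
  have /eqP eq' : f @: [set: V] == f' @: [set: V].
    rewrite eqEcard !card_imset // leqnn andbT -covF' -covFv.
    by apply/bigcupsP => a aF; apply: (bigcup_max a) => //; rewrite inE aF orbT.
  by rewrite covF eq' -covF'; apply: (bigcup_max c); rewrite ?setU11.
have [->|/card_gt0P[F0 F0A]] := posnP #|A|; first by rewrite mul0n.
have [c2 v2 cvF] := AP _ F0A.
have w3 : (3 <= #|c :|: v|)%N.
  rewrite cardsU c2 v2.
  have : (#|c :&: v| < 2)%N.
    rewrite -c2; apply: proper_card; rewrite properEneq subsetIl andbT.
    apply: contra cv => /eqP/setIidPl cv'.
    by rewrite eqEcard cv' c2 v2.
  by case: #|c :&: v| => [|[|]].
have wh : (#|c :|: v| <= h)%N.
  apply: leq_trans (subset_leq_card cvF) _.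
  move: F0A; rewrite inE copiesE => /andP[/imsetP[f /embP fI ->] _].
  by rewrite cover_imgraph (cover_full Hsimple Hbal) card_imset // cardsT.
apply: (@leq_trans (C * n ^ (h - #|c :|: v|) * n)%N).
  rewrite leq_mul2r; apply/orP; right.
  apply: leq_trans (card_copies_cover Hsimple Hbal wh); apply: subset_leq_card.
  by apply/subsetP => F FA; rewrite inE; have [_ _ ->] := AP _ FA; move: FA; rewrite inE => /andP[->].
rewrite -mulnA leq_mul2l; apply/orP; right; rewrite -expnSr leq_pexp2l //.
by move: w3 wh; clear; lia.
Qed.

Lemma quasi_regular_copies (d : R) : 0 < d ->
  \forall n \near \oo%classic, 0 < s n <= d /\ quasi_regular (Kn n) (copies H n) k (s n) d.
Proof.
move=> d0.
(* The three terms are the thresholds on [n] for codegrees, twins and the scale itself. *)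
pose B : R := (C ^ q * K ^ k)%:R / d ^+ q + (C * K)%:R / d + K%:R / d ^+ q.
have dq0 : 0 < d ^+ q by rewrite exprn_gt0.
have B1 : (C ^ q * K ^ k)%:R / d ^+ q <= B.
  by rewrite /B -addrA lerDl addr_ge0 // divr_ge0 // ltW.
have B2 : (C * K)%:R / d <= B.
  by rewrite /B addrAC lerDr addr_ge0 // divr_ge0 // ltW.
have B3 : K%:R / d ^+ q <= B by rewrite /B lerDr addr_ge0 // divr_ge0 // ltW.
near=> n.
have hn : (2 * h <= n)%N by near: n; exact: nbhs_infty_ge.
have nB : B <= n%:R by near: n; exact: nbhs_infty_ger.
have n0 : (0 < n)%N.
  by apply: leq_trans hn; rewrite muln_gt0 /=; apply: leq_trans h3.
have nR0 : 0 < n%:R :> R by rewrite ltr0n.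
have s0 : 0 < s n by apply: scale_gt0.
have sq0 : 0 < s n ^+ q by rewrite exprn_gt0.
have D0 : 0 < DeltaH R H n by apply: Delta_gt0.
have sX : s n ^+ q = (DeltaH R H n)^-1 by apply: scaleX.
have expD : (n ^ (h - 2))%:R * s n ^+ q <= K%:R.
  by rewrite sX ler_pdivrMr //; apply: expn_le_Delta.
have powle (x : R) : 0 <= x -> x ^+ q <= d ^+ q -> x <= d.
  by move=> x0; rewrite ler_pXn2r ?nnegrE ?(ltW d0).
split.
  rewrite s0 /=; apply: powle; first exact: ltW.
  have h1 : K%:R <= n%:R * d ^+ q by rewrite -ler_pdivrMr // (le_trans B3).
  have h2 : n%:R * s n ^+ q <= K%:R.
    apply: le_trans expD; rewrite ler_wpM2r ?(ltW sq0) // ler_nat -[leqLHS]expn1.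
    by rewrite leq_pexp2l // subn_gt0.
  by rewrite -(ler_pM2l nR0); apply: le_trans h2 h1.
split.
- by move=> F FH; apply: copy_sub_Kn FH.
- by move=> F FH; apply: card_copy FH.
- move=> a aK; rewrite -[RHS](edge_deg_scale hn aK); congr (_%:R * _).
  by apply: eq_card => F; rewrite !inE sub1set.
- move=> J Jk; apply: powle; first by rewrite mulr_ge0 // exprn_ge0 // ltW.
  have h1 : (C ^ q * K ^ k)%:R <= n%:R * d ^+ q by rewrite -ler_pdivrMr // (le_trans B1).
  rewrite -(ler_pM2l nR0); apply: le_trans h1.
  have := codeg_copies_le n0 Jk; rewrite -(ler_nat R) => h2.
  have sJ0 : 0 <= (s n ^+ (k - #|J|)) ^+ q by rewrite !exprn_ge0 // ltW.
  have := ler_wpM2r sJ0 h2; rewrite natrM natrX.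
  rewrite exprMn mulrA [n%:R * _]mulrC => /le_trans; apply.
  rewrite !natrM -mulrA ler_wpM2l // natrX exprAC -exprMn.
  apply: (@le_trans _ _ (K%:R ^+ (k - #|J|))).
    by apply: lerXn2r; rewrite ?nnegrE // mulr_ge0 // ltW.
  by rewrite natrX ler_weXn2l ?ler1n // leq_subr.
- move=> c v cv.
  have h1 : (C * K)%:R <= n%:R * d by rewrite -ler_pdivrMr // (le_trans B2).
  rewrite -(ler_pM2l nR0); apply: le_trans h1.
  have := twin_copies_le n0 cv; rewrite -(ler_nat R) => h2.
  have := ler_wpM2r (ltW sq0) h2; rewrite natrM.
  rewrite mulrA [n%:R * _]mulrC => /le_trans; apply.
  by rewrite [(_ * n ^ _)%:R]natrM [(_ * K)%:R]natrM -[leLHS]mulrA ler_wpM2l.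
Unshelve. all: by end_near. Qed.

(** After taking [q]-th powers this compares [n ^ (2 * q)] with [n ^ q * n ^ (h - 2)] up to
    constants, and [h <= k] leaves a factor [n] for them. It makes logarithms of [n] negligible on
    the scale [N * s]. *)
Lemma le_card_Kn_scale : \forall n \near \oo%classic, n%:R <= #|Kn n|%:R * s n.
Proof.
near=> n.
have hn : (2 * h <= n)%N by near: n; exact: nbhs_infty_ge.
have nB : (4 ^ q * (2 * k) <= n)%N by near: n; exact: nbhs_infty_ge.
have n0 : (0 < n)%N.
  by apply: leq_trans hn; rewrite muln_gt0 /=; apply: leq_trans h3.
have n2 : (2 <= n)%N.
  by apply: leq_trans hn; rewrite leq_pmulr //; apply: leq_trans h3.
have s0 : 0 < s n by apply: scale_gt0.
have D0 : 0 < DeltaH R H n by apply: Delta_gt0.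
have sX : s n ^+ q = (DeltaH R H n)^-1 by apply: scaleX.
have N4 : (n * n <= 4 * #|Kn n|)%N.
  rewrite card_Kn.
  have := bin_ffact n 2; rewrite !ffactnS ffactn0 muln1 => e.
  have -> : (4 * 'C(n, 2) = 2 * ('C(n, 2) * 2`!))%N by rewrite (_ : 2`! = 2)%N //; ring.
  rewrite e mulnCA leq_mul2l; apply/orP; right.
  by move: n2; clear; lia.
rewrite -(@ler_pXn2r _ q) ?nnegrE ?mulr_ge0 // ?(ltW s0) //.
rewrite exprMn sX ler_pdivlMr //.
apply: (@le_trans _ _ (n%:R ^+ q * (2 * k * n ^ (h - 2))%:R)).
  by rewrite ler_wpM2l ?exprn_ge0 //; apply: Delta_le_expn.
rewrite -!natrX -natrM ler_nat -(leq_pmul2l (_ : 0 < 4 ^ q)%N) ?expn_gt0 // -expnMn.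
apply: (@leq_trans ((n * n) ^ q)%N); last by rewrite leq_exp2r.
rewrite expnMn mulnCA leq_mul2l; apply/orP; right.
rewrite mulnA; apply: (@leq_trans (n * n ^ (h - 2))%N); first by rewrite leq_mul2r nB orbT.
by rewrite -expnS leq_pexp2l //; move: h3 hk; clear; lia.
Unshelve. all: by end_near. Qed.

End Asymptotics.

(** * The limits *)

Local Open Scope classical_set_scope.
Local Open Scope ring_scope.

Section Limits.
Variables (R : realType) (V : finType) (H : {set {set V}}).
Hypothesis Hsimple : simple_graph H.
Hypothesis Hbal : strictly_2_balanced H.
Local Notation h := #|V|.
Local Notation k := #|H|.
Local Notation q := k.-1.
Local Notation s := (scale R H).
Local Notation N n := (#|Kn n|%:R : R).
Local Notation Z n lam := (hcZ lam (Kn n) (copies H n)).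

Let k3 : (3 <= k)%N. Proof. exact: edges_ge3. Qed.
Let h3 : (3 <= h)%N. Proof. exact: (vertices_ge3 Hsimple Hbal). Qed.
Let q0 : (0 < q)%N. Proof. by move: k3; clear; case: k => [|[|]]. Qed.
Let k0 : 0 < k%:R :> R. Proof. by rewrite ltr0n; apply: leq_trans k3. Qed.
Let kq : k = q.+1. Proof. by move: k3; clear; case: k. Qed.
Let kE : k%:R = q%:R + 1 :> R. Proof. by rewrite natr1 -kq. Qed.

Definition activity (x : R) : R := x * expR (x ^+ q).
Definition freeEnergy (x : R) : R := x + q%:R / k%:R * x ^+ k.

Lemma ln_Z_near (u tau : R) : 0 <= u < 1 -> 0 < tau -> \forall n \near \oo,
  forall x, 0 <= x -> q%:R * x ^+ q <= u ->
  `|ln (Z n (s n * activity x)) - N n * s n * freeEnergy x| <= tau * (N n * s n).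
Proof.
move=> u01 tau0; have [d /andP[d0 _] Hd] := ln_hcZ_approx k3 u01 tau0.
have := quasi_regular_copies Hsimple Hbal d0; apply: filterS => n [sd Hq] x x0 xu.
exact: Hd.
Qed.

Lemma scale_near_gt0 : \forall n \near \oo, 0 < s n.
Proof.
by have := quasi_regular_copies Hsimple Hbal (@ltr01 R); apply: filterS => n [/andP[]].
Qed.

Lemma scale_cvg0 : s n @[n --> \oo] --> 0.
Proof.
apply/cvgrPdist_le => e e0; have := quasi_regular_copies Hsimple Hbal e0.
apply: filterS => n [/andP[s0 se] _].
by rewrite sub0r normrN gtr0_norm.
Qed.

Lemma card_Kn_scale_gt0 : \forall n \near \oo, 0 < N n * s n.
Proof.
near=> n; apply: lt_le_trans (_ : n%:R <= _); last by near: n; exact: le_card_Kn_scale.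
by rewrite ltr0n; near: n; exact: nbhs_infty_gt.
Unshelve. all: by end_near. Qed.

Lemma scale_normE (n : nat) (y : R) :
  DeltaH R H n `^ ((k - 1)%:R^-1) / ('C(n, 2))%:R * y = y / (N n * s n).
Proof.
rewrite card_Kn /scale powRN invfM invrK mulrC; congr (_ * _); exact: mulrC.
Qed.

Lemma XH_eq0 (n : nat) (G : {set {set 'I_n}}) : (XH H G == 0%N) = indep (copies H n) G.
Proof.
rewrite /XH cards_eq0; apply/eqP/indepP => [e F FH|iG].
  by apply/negP => FG; move: (in_set0 F); rewrite -e inE FH FG.
by apply/setP => F; rewrite !inE; apply/negP => /andP[/iG/negP].
Qed.

Lemma Pp_freeE (n : nat) (p : R) : p < 1 ->
  Pp_free H n p = (1 - p) ^+ #|Kn n| * Z n (p / (1 - p)).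
Proof.
move=> p1; have p0 : 1 - p != 0 by rewrite gt_eqF // subr_gt0.
rewrite /Pp_free (bigID (fun G => indep (copies H n) G)) /= [X in _ + X]big1 ?addr0; last first.
  by move=> G /andP[_ /negbTE iG]; rewrite XH_eq0 iG mulr0.
rewrite /hcZ mulr_sumr; apply: eq_bigr => G /andP[GK iG].
rewrite XH_eq0 iG mulr1 exprMn exprVn -(subnK (subset_leq_card GK)) exprD addnK.
by rewrite mulrC -mulrA; congr (_ * _); rewrite mulrCA mulfV ?mulr1 // expf_neq0.
Qed.

Lemma Pm_freeE (n m : nat) :
  Pm_free R H n m = (hcN (Kn n) (copies H n) m)%:R / 'C(#|Kn n|, m)%:R.
Proof.
rewrite /Pm_free /hcN; congr (_%:R / _); apply: eq_card => G.
by rewrite !inE XH_eq0.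
Qed.

Lemma activity_gt0 x : 0 < x -> 0 < activity x.
Proof. by move=> x0; rewrite mulr_gt0 ?expR_gt0. Qed.

Lemma ln_activity x : 0 < x -> ln (activity x) = ln x + x ^+ q.
Proof. by move=> x0; rewrite lnM ?posrE ?expR_gt0 // expRK. Qed.

Lemma activity_lt x y : 0 <= x -> x < y -> activity x < activity y.
Proof.
move=> x0 xy; have y0 : 0 < y by apply: le_lt_trans xy.
apply: (@le_lt_trans _ _ (x * expR (y ^+ q))).
  by rewrite ler_wpM2l // ler_expR lerXn2r ?nnegrE ?(ltW y0) // ltW.
by rewrite ltr_pM2r ?expR_gt0.
Qed.

Lemma continuous_freeEnergy : continuous freeEnergy.
Proof.
move=> x; apply: cvgD; first exact: cvg_id.
by apply: cvgMr; apply: exprn_continuous.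
Qed.

Lemma LambertW_spec (z : R) : 0 <= z -> 0 <= LambertW z /\ LambertW z * expR (LambertW z) = z.
Proof.
move=> z0; rewrite /LambertW.
have [y yz] : exists y, 0 <= y /\ y * expR y = z.
  have cont : {within `[0, z], continuous (fun y : R => y * expR y)}.
    apply: continuous_subspaceT => y; apply: cvgM; first exact: cvg_id.
    exact: continuous_expR.
  have [|c] := @IVT R (fun y => y * expR y) 0 z z z0 cont.
    rewrite mul0r ge_min le_max z0 /=; apply/orP; right.
    by rewrite ler_peMr // -expR0 ler_expR.
  by rewrite in_itv /= => /andP[c0 _] cE; exists c.
exact: (@xgetPex _ 0 [set y | 0 <= y /\ y * expR y = z] (ex_intro _ y yz)).
Qed.

(** The [q]-th power of [activity xs = c], multiplied by [q], is the Lambert equation for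
    [y = q * xs ^+ q]; the bound on [c] says that its right side is below [e], that is [y < 1]. *)
Lemma activity_LambertW (c : R) : 0 < c -> c < (expR 1 / (k - 1)%:R) `^ ((k - 1)%:R^-1) ->
  let xs := (LambertW ((k - 1)%:R * c ^+ (k - 1)) / (k - 1)%:R) `^ ((k - 1)%:R^-1) in
  [/\ 0 < xs, q%:R * xs ^+ q < 1 & activity xs = c].
Proof.
rewrite subn1; set Q : R := q%:R; have Q0 : 0 < Q by rewrite ltr0n.
move=> c0 cb; set y := LambertW _.
have Qc0 : 0 < Q * c ^+ q by rewrite mulr_gt0 // exprn_gt0.
have [y0 yE] := LambertW_spec (ltW Qc0); rewrite -/y in y0 yE.
have y_gt0 : 0 < y.
  by rewrite lt_neqAle y0 andbT; apply: contraTneq Qc0 => y00; rewrite -yE -y00 mul0r ltxx.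
have yQ : 0 < y / Q by rewrite divr_gt0.
have xsq : (y / Q) `^ Q^-1 ^+ q = y / Q.
  by rewrite -powR_mulrn ?powR_ge0 // -powRrM mulVf ?gt_eqF // powRr1 // ltW.
have cq : c ^+ q < expR 1 / Q.
  rewrite [ltRHS](_ : _ = (expR 1 / Q) `^ Q^-1 ^+ q); last first.
    rewrite -powR_mulrn ?powR_ge0 // -powRrM mulVf ?gt_eqF // powRr1 //.
    by rewrite divr_ge0 ?expR_ge0 // ltW.
  by rewrite ltrXn2r // -?lt0n // ltW.
have y1 : y < 1.
  rewrite ltNge; apply/negP => y1.
  have : 1 * expR 1 <= y * expR y by apply: ler_pM; rewrite ?expR_ge0 ?ler_expR.
  by rewrite yE mul1r leNgt mulrC -ltr_pdivlMr // cq.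
move=> xs; split.
- by rewrite powR_gt0.
- by rewrite xsq mulrC divfK // gt_eqF.
- have xs0 : 0 < xs by rewrite powR_gt0.
  apply/eqP; rewrite -(@eqrXn2 _ q) // ?(ltW c0) ?(ltW (activity_gt0 xs0)) //.
  have yQQ : Q * (y / Q) = y by rewrite mulrC divfK // gt_eqF.
  rewrite /activity exprMn -expRM_natl xsq -/Q yQQ.
  by rewrite mulrAC yE [Q * _]mulrC mulfK // gt_eqF.
Qed.

Lemma hcZ_gt0 (n : nat) (lam : R) : 0 <= lam -> 0 < Z n lam.
Proof.
move=> l0; apply: lt_le_trans (hcZ_ge1 l0 (Kn n) _) => //.
apply/negP => /card_copy; rewrite cards0 => e.
by move: k3; rewrite -e.
Qed.

Lemma freeEnergy_bracket (x e : R) : 0 < x -> q%:R * x ^+ q < 1 -> 0 < e ->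
  exists x1 x2, [/\ 0 < x1 < x, x < x2, q%:R * x2 ^+ q < 1,
    `|freeEnergy x1 - freeEnergy x| <= e & `|freeEnergy x2 - freeEnergy x| <= e].
Proof.
move=> x0 xq1 e0.
have c1 : \forall y \near x, q%:R * y ^+ q < 1.
  have : q%:R * y ^+ q @[y --> x] --> q%:R * x ^+ q.
    by apply: cvgMr; apply: exprn_continuous.
  by move/cvgr_lt; apply.
have c2 : \forall y \near x, `|freeEnergy y - freeEnergy x| <= e.
  by have /cvgrPdistC_le/(_ e e0) := @continuous_freeEnergy x.
have c3 : \forall y \near x, 0 < y.
  by have /cvgr_gt := @cvg_id _ (nbhs x); apply.
have [r /= r0 Hr] := (nbhs_normP _ _).1 (filterI (filterI c1 c2) c3).
have r2 : 0 < r / 2 by rewrite divr_gt0.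
have r2r : r / 2 < r by rewrite ltr_pdivrMr // ltr_pMr // ltr1n.
have b1 : `|x - (x - r / 2)| < r by rewrite opprB addrC subrK gtr0_norm.
have b2 : `|x - (x + r / 2)| < r by rewrite opprD addrA subrr sub0r normrN gtr0_norm.
have [[h11 h12] h13] := Hr _ b1; have [[h21 h22] h23] := Hr _ b2.
exists (x - r / 2), (x + r / 2); split=> //; first by rewrite h13 /= gtrBl.
by rewrite ltrDl.
Qed.

(** The uniform estimate needs an activity of the exact form [s n * activity x]. Since [Z] is
    monotone in the activity, [lam n] can be enclosed between two such values around [x]. *)
Lemma ln_Z_cvg (x : R) (lam : nat -> R) : 0 < x -> q%:R * x ^+ q < 1 ->
  lam n / s n @[n --> \oo] --> activity x ->
  ln (Z n (lam n)) / (N n * s n) @[n --> \oo] --> freeEnergy x.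
Proof.
move=> x0 xq1 Hlam; apply/cvgrPdist_le => e e0.
have [x1 [x2 [/andP[x10 x1x] xx2 x2q Hx1 Hx2]]] := freeEnergy_bracket x0 xq1 (divr_gt0 e0 (ltr0n _ 2)).
have x20 : 0 < x2 by apply: lt_trans xx2.
have u01 : 0 <= q%:R * x2 ^+ q < 1 by rewrite x2q andbT mulr_ge0 // exprn_ge0 // ltW.
have HZ := ln_Z_near u01 (divr_gt0 e0 (ltr0n _ 2)).
have l1 : activity x1 < activity x by apply: activity_lt => //; exact: ltW.
have l2 : activity x < activity x2 by apply: activity_lt => //; exact: ltW.
near=> n.
have s0 : 0 < s n by near: n; exact: scale_near_gt0.
have Ns0 : 0 < N n * s n by near: n; exact: card_Kn_scale_gt0.
have a1 : activity x1 < lam n / s n by near: n; apply: (cvgr_gt _ Hlam).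
have a2 : lam n / s n < activity x2 by near: n; apply: (cvgr_lt _ Hlam).
have b1 : s n * activity x1 <= lam n by rewrite mulrC -ler_pdivlMr // ltW.
have b2 : lam n <= s n * activity x2 by rewrite [leRHS]mulrC -ler_pdivrMr // ltW.
have b0 : 0 <= s n * activity x1 by rewrite mulr_ge0 // ?(ltW s0) // ltW // activity_gt0.
have HZn : forall x, 0 <= x -> q%:R * x ^+ q <= q%:R * x2 ^+ q ->
  `|ln (Z n (s n * activity x)) - N n * s n * freeEnergy x| <= e / 2 * (N n * s n).
  by near: n.
have l0 : 0 <= lam n by apply: le_trans b1.
have Z1 : ln (Z n (s n * activity x1)) <= ln (Z n (lam n)).
  by rewrite ler_ln ?posrE ?hcZ_gt0 // hcZ_mono // b0.
have Z2 : ln (Z n (lam n)) <= ln (Z n (s n * activity x2)).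
  by rewrite ler_ln ?posrE ?hcZ_gt0 ?(le_trans l0) // hcZ_mono // l0.
have x12 : q%:R * x1 ^+ q <= q%:R * x2 ^+ q.
  by rewrite ler_wpM2l // lerXn2r ?nnegrE ?(ltW x10) ?(ltW x20) // ltW // (lt_trans x1x).
have g4 : ln (Z n (s n * activity x2)) <= N n * s n * freeEnergy x2 + e / 2 * (N n * s n).
  by have := HZn x2 (ltW x20) (lexx _); rewrite ler_distl => /andP[].
have g1 : N n * s n * freeEnergy x1 - e / 2 * (N n * s n) <= ln (Z n (s n * activity x1)).
  by have := HZn x1 (ltW x10) x12; rewrite ler_distl => /andP[].
have f1 : freeEnergy x - e / 2 <= freeEnergy x1 by move: Hx1; rewrite ler_distl => /andP[].
have f4 : freeEnergy x2 <= freeEnergy x + e / 2 by move: Hx2; rewrite ler_distl => /andP[].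
exact: (bracket_arith Ns0 f1 f4 g1 g4 Z1 Z2).
Unshelve. all: by end_near. Qed.

Lemma ln_Pp_cvg (c : R) (p : nat -> R) :
  0 < c -> c < (expR 1 / (k - 1)%:R) `^ ((k - 1)%:R^-1) ->
  (forall n, 0 <= p n <= 1) ->
  p n / (c * (DeltaH R H n `^ (- (k - 1)%:R^-1))) @[n --> \oo] --> (1 : R) ->
  let xs := (LambertW ((k - 1)%:R * c ^+ (k - 1)) / (k - 1)%:R) `^ ((k - 1)%:R^-1) in
  DeltaH R H n `^ ((k - 1)%:R^-1) / ('C(n, 2))%:R * ln (Pp_free H n (p n))
    @[n --> \oo] --> xs + (1 - k%:R^-1) * xs ^+ k - c.
Proof.
move=> c0 cb p01 pc xs.
have [xs0 xs1 xsE] := activity_LambertW c0 cb; rewrite -/xs in xs0 xs1 xsE.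
have s_gt0 := scale_near_gt0.
have tc : p n / s n @[n --> \oo] --> c.
  have : p n / (c * s n) * c @[n --> \oo] --> 1 * c.
    by apply: cvgM; [exact: pc | exact: cvg_cst].
  rewrite mul1r; apply: cvg_trans; apply: near_eq_cvg; near=> n.
  by rewrite invfM mulrA mulrAC divfK // gt_eqF.
have p_0 : p n @[n --> \oo] --> 0.
  have : p n / s n * s n @[n --> \oo] --> c * 0.
    by apply: cvgM => //; exact: scale_cvg0.
  rewrite mulr0; apply: cvg_trans; apply: near_eq_cvg; near=> n.
  by rewrite divfK // gt_eqF //; near: n.
have p1 : 1 - p n @[n --> \oo] --> (1 : R).
  have : 1 - p n @[n --> \oo] --> (1 - 0 : R) by apply: cvgB => //; exact: cvg_cst.
  by rewrite subr0.
have p_lt1 : \forall n \near \oo, p n < 1 by apply: (cvgr_lt _ p_0).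
pose lam n := p n / (1 - p n).
have lc : lam n / s n @[n --> \oo] --> c.
  rewrite (_ : (fun n => _) = (fun n => p n / s n * (1 - p n)^-1)); last first.
    by apply/funext => n; rewrite /lam mulrAC.
  have : p n / s n * (1 - p n)^-1 @[n --> \oo] --> (c * 1^-1 : R).
    by apply: cvgM => //; apply: cvgV => //; exact: oner_neq0.
  by rewrite invr1 mulr1.
have A : ln (1 - p n) / s n @[n --> \oo] --> - c.
  (* Both sides are [ln (1 + z) <= z], applied to [- p] and to [lam = 1 / (1 - p) - 1]. *)
  apply: (@squeeze_cvgr _ _ _ _ (fun n => - (lam n / s n)) (fun n => - (p n / s n))).
  - near=> n.
    have s0 : 0 < s n by near: n.
    have pn1 : p n < 1 by near: n.
    have q1 : 0 < 1 - p n by rewrite subr_gt0.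
    rewrite -[- (lam n / s n)]mulNr -[- (p n / s n)]mulNr !ler_pM2r ?invr_gt0 //; apply/andP; split; last first.
      by apply: le_ln1Dx; rewrite ltrN2.
    rewrite lerNl -lnV ?posrE //.
    have -> : (1 - p n)^-1 = 1 + lam n.
      by rewrite /lam; field; rewrite gt_eqF.
    apply: le_ln1Dx; rewrite (lt_le_trans (ltrN10 _)) // divr_ge0 ?(ltW q1) //.
    by case/andP: (p01 n).
  - exact: cvgN.
  - exact: cvgN.
have B : ln (Z n (lam n)) / (N n * s n) @[n --> \oo] --> freeEnergy xs.
  by apply: ln_Z_cvg => //; rewrite xsE.
have -> : xs + (1 - k%:R^-1) * xs ^+ k - c = - c + freeEnergy xs.
  rewrite addrC /freeEnergy; congr (_ + (_ + _ * _)).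
  by rewrite -[q%:R](addrK 1) -kE mulrBl mulfV ?gt_eqF // mul1r.
have : ln (1 - p n) / s n + ln (Z n (lam n)) / (N n * s n) @[n --> \oo] --> - c + freeEnergy xs.
  exact: cvgD.
apply: cvg_trans; apply: near_eq_cvg; near=> n.
have s0 : 0 < s n by near: n.
have Ns0 : 0 < N n * s n by near: n; exact: card_Kn_scale_gt0.
have pn1 : p n < 1 by near: n.
have q1 : 0 < 1 - p n by rewrite subr_gt0.
have N0 : 0 < N n by rewrite -(pmulr_lgt0 _ s0).
have l0 : 0 <= lam n by rewrite divr_ge0 ?(ltW q1) //; case/andP: (p01 n).
rewrite scale_normE Pp_freeE // lnM ?posrE ?exprn_gt0 ?hcZ_gt0 //.
rewrite lnXn // -[ln (1 - p n) *+ _]mulr_natl mulrDl; congr (_ + _).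
by rewrite -mulf_div mulfV ?mul1r // gt_eqF.
Unshelve. all: by end_near. Qed.

(** * The limit for a fixed number of edges *)

Definition log_activity (x : R) := ln x + x ^+ q.

Let kK (w : R) : q%:R / k%:R * (k%:R * w) = q%:R * w.
Proof. by rewrite mulrA divfK // gt_eqF. Qed.

Lemma is_derive_log_activity (z : R) : 0 < z -> is_derive z 1 log_activity (z^-1 + q%:R * z ^+ q.-1).
Proof. move=> z0; exact: (is_derive1D (is_derive1_ln z0) (is_derive1Xn q z)). Qed.

Lemma is_derive_freeEnergy (z : R) : is_derive z 1 freeEnergy (1 + q%:R / k%:R * (k%:R * z ^+ q)).
Proof. exact: (is_derive1D (is_derive1_id z) (is_derive1Z (q%:R / k%:R) (is_derive1Xn k z))). Qed.

(** The derivative of the free energy with respect to the logarithmic activity is the density [x]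
    itself, so between [x] and [y] the mean slope is at least [x]. *)
Lemma freeEnergy_slope_ge (x y : R) : 0 < x -> x <= y ->
  x * (log_activity y - log_activity x) <= freeEnergy y - freeEnergy x.
Proof.
move=> x0 xy.
have := @le_of_derive_ge0 R (fun z => freeEnergy z - x * log_activity z)
  (fun z => 1 + q%:R / k%:R * (k%:R * z ^+ q) - x * (z^-1 + q%:R * z ^+ q.-1)) x y xy.
move=> /(_ _ _)/wrap[|z /andP[xz _]|].
- move=> z /andP[xz _]; have z0 : 0 < z by apply: lt_le_trans xz.
  exact: (is_derive1B (is_derive_freeEnergy z) (is_derive1Z x (is_derive_log_activity z0))).
- have z0 : 0 < z by apply: lt_trans xz.
  have -> : 1 + q%:R / k%:R * (k%:R * z ^+ q) - x * (z^-1 + q%:R * z ^+ q.-1) =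
     (1 + q%:R * z ^+ q) * ((z - x) / z).
    rewrite kK (_ : z ^+ q = z * z ^+ q.-1); last by rewrite -exprS prednK.
    by apply: slope_factor; rewrite gt_eqF.
  apply: mulr_ge0; first by rewrite addr_ge0 // mulr_ge0 // exprn_ge0 // ltW.
  by rewrite divr_ge0 ?(ltW z0) // subr_ge0 ltW.
by move/subr_le_swap; rewrite mulrBr.
Qed.

Lemma freeEnergy_slope_le (x y : R) : 0 < x -> x <= y ->
  freeEnergy y - freeEnergy x <= y * (log_activity y - log_activity x).
Proof.
move=> x0 xy.
have := @le_of_derive_ge0 R (fun z => y * log_activity z - freeEnergy z)
  (fun z => y * (z^-1 + q%:R * z ^+ q.-1) - (1 + q%:R / k%:R * (k%:R * z ^+ q))) x y xy.
move=> /(_ _ _)/wrap[|z /andP[xz zy]|].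
- move=> z /andP[xz _]; have z0 : 0 < z by apply: lt_le_trans xz.
  exact: (is_derive1B (is_derive1Z y (is_derive_log_activity z0)) (is_derive_freeEnergy z)).
- have z0 : 0 < z by apply: lt_trans xz.
  have -> : y * (z^-1 + q%:R * z ^+ q.-1) - (1 + q%:R / k%:R * (k%:R * z ^+ q)) =
     (1 + q%:R * z ^+ q) * ((y - z) / z).
    rewrite kK (_ : z ^+ q = z * z ^+ q.-1); last by rewrite -exprS prednK.
    rewrite -opprB slope_factor ?gt_eqF // -mulrN -mulNr opprB //.
  apply: mulr_ge0; first by rewrite addr_ge0 // mulr_ge0 // exprn_ge0 // ltW.
  by rewrite divr_ge0 ?(ltW z0) // subr_ge0 ltW.
by move/subr_le_swap; rewrite mulrBr.
Qed.

Lemma log_activity_lt (x y : R) : 0 < x -> x < y -> log_activity x < log_activity y.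
Proof.
move=> x0 xy; have y0 : 0 < y by apply: lt_trans xy.
rewrite /log_activity ltr_leD ?ltr_ln ?posrE //.
by apply: lerXn2r; rewrite ?nnegrE ltW.
Qed.

(** With [r = sqrt n], [N + 1 <= r ^ 4] and [ln r < r] bound the left side by [5 * r], against
    [N * s >= r ^ 2]. *)
Lemma ln_card_Kn_near (e : R) : 0 < e ->
  \forall n \near \oo, 1 + ln (N n + 1) <= e * (N n * s n).
Proof.
move=> e0; near=> n.
have n1 : (2 <= n)%N by near: n; exact: nbhs_infty_ge.
have n0 : 0 < n%:R :> R by rewrite ltr0n ltnW.
have ne : (5 / e) ^+ 2 <= n%:R by near: n; exact: nbhs_infty_ger.
have Mn : n%:R <= N n * s n by near: n; exact: (le_card_Kn_scale R Hsimple Hbal).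
have r0 : 0 < Num.sqrt (n%:R : R) by rewrite sqrtr_gt0.
have rr : Num.sqrt (n%:R : R) ^+ 2 = n%:R by rewrite sqr_sqrtr // ltW.
set r := Num.sqrt _ in r0 rr.
have re : 5 <= e * r.
  rewrite mulrC -ler_pdivrMr //.
  by rewrite -(@ler_pXn2r _ 2) ?nnegrE ?(ltW r0) ?divr_ge0 ?(ltW e0) // rr.
have Nn : N n + 1 <= r ^+ 4.
  rewrite (_ : 4 = 2 * 2)%N // exprM rr -natrX natr1 ler_nat card_Kn ltnNge; apply/negP => Cn.
  have := bin_ffact n 2; rewrite !ffactnS ffactn0 muln1 (_ : 2`! = 2)%N // => e1.
  have : (n ^ 2 * 2 <= n * n.-1)%N by rewrite -e1 leq_mul2r Cn orbT.
  rewrite leqNgt => /negP; apply; rewrite -[(n ^ 2)%N]mulnn -mulnA ltn_pmul2l ?(ltnW n1) //.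
  by move: n1; clear; lia.
have r1 : 1 <= r.
  rewrite -(@ler_pXn2r _ 2) ?nnegrE ?(ltW r0) // rr expr1n ler1n; exact: ltnW.
apply: le_trans (_ : e * n%:R <= _); last by rewrite ler_wpM2l // ltW.
have l1 : ln (N n + 1) <= 4 * r.
  apply: (@le_trans _ _ (ln (r ^+ 4))); first by rewrite ler_ln ?posrE ?exprn_gt0 // ltr_wpDl.
  rewrite lnXn // -[_ *+ 4]mulr_natl ler_wpM2l //; exact/ltW/ln_sublinear.
apply: (@le_trans _ _ (5 * r)).
  by apply: (le_trans (lerD (lexx 1) l1)); rewrite -lerBrDr -mulrBl; lra.
by rewrite -rr expr2 mulrA ler_wpM2r // ltW.
Unshelve. all: by end_near. Qed.

Local Notation hc n m := (hcN (Kn n) (copies H n) m).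

Lemma freeEnergyE (x : R) : freeEnergy x = x + (x ^+ k - x ^+ k / k%:R).
Proof.
rewrite /freeEnergy; congr (_ + _).
by rewrite -[q%:R](addrK 1) -kE mulrBl mulfV ?gt_eqF // mulrBl !mul1r mulrC.
Qed.

Lemma ln_scale_activity (n : nat) (x : R) : 0 < s n -> 0 < x ->
  ln (s n * activity x) = ln (s n) + log_activity x.
Proof. by move=> s0 x0; rewrite lnM ?posrE ?activity_gt0 // ln_activity. Qed.

Lemma ln_hcN_le (n m : nat) (x : R) : 0 < s n -> 0 < x -> (m <= #|Kn n|)%N -> (0 < hc n m)%N ->
  ln (hc n m)%:R + m%:R * (ln (s n) + log_activity x) <= ln (Z n (s n * activity x)).
Proof.
move=> s0 x0 mN a0; have l0 : 0 < s n * activity x by rewrite mulr_gt0 ?activity_gt0.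
have aR : 0 < (hc n m)%:R :> R by rewrite ltr0n.
rewrite -ln_scale_activity // mulr_natl -lnXn // -lnM ?posrE ?exprn_gt0 //.
by rewrite ler_ln ?posrE ?mulr_gt0 ?exprn_gt0 ?hcZ_gt0 ?(ltW l0) // hcN_le_hcZ // ltW.
Qed.

Lemma lower_params (b e : R) : 0 < b -> q%:R * b ^+ q < 1 -> 0 < e -> exists r, [/\ 0 < r,
  q%:R * (b + 3 * r) ^+ q < 1 &
  - (b ^+ k / k%:R) - e <= freeEnergy (b + 2 * r) - (b + 2 * r) - (b + 4 * r) * (b + 2 * r) ^+ q].
Proof.
move=> b0 bq e0.
have lin c : b + c * r @[r --> (0 : R)] --> b.
  have : b + c * r @[r --> (0 : R)] --> b + c * 0.
    by apply: cvgD; [exact: cvg_cst | apply: cvgMr; exact: cvg_id].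
  by rewrite mulr0 addr0.
have pow c : (b + c * r) ^+ q @[r --> (0 : R)] --> b ^+ q.
  by apply: (@continuous_cvg _ _ _ _ _ _ (fun z : R => z ^+ q)); [exact: exprn_continuous | exact: lin].
have c1 : \forall r \near (0 : R), q%:R * (b + 3 * r) ^+ q < 1.
  have : q%:R * (b + 3 * r) ^+ q @[r --> (0 : R)] --> q%:R * b ^+ q by apply: cvgMr.
  by move/cvgr_lt; apply.
have c2 : \forall r \near (0 : R), - (b ^+ k / k%:R) - e <
    freeEnergy (b + 2 * r) - (b + 2 * r) - (b + 4 * r) * (b + 2 * r) ^+ q.
  have : freeEnergy (b + 2 * r) - (b + 2 * r) - (b + 4 * r) * (b + 2 * r) ^+ q
      @[r --> (0 : R)] --> freeEnergy b - b - b * b ^+ q.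
    apply: cvgB; last by apply: cvgM; [exact: lin | exact: pow].
    apply: cvgB; last exact: lin.
    by apply: continuous_cvg; [exact: continuous_freeEnergy | exact: lin].
  move/cvgr_gt; apply.
  have -> : freeEnergy b - b - b * b ^+ q = - (b ^+ k / k%:R).
    by rewrite freeEnergyE -exprS -kq; move: (b ^+ k / k%:R) (b ^+ k) => w K; ring.
  by rewrite ltrBlDr ltrDl.
have [r /= r0 Hr] := (nbhs_normP _ _).1 (filterI c1 c2).
have r2 : 0 < r / 2 by rewrite divr_gt0.
have b1 : `|0 - r / 2| < r by rewrite sub0r normrN gtr0_norm // ltr_pdivrMr // ltr_pMr // ltr1n.
by have [h1 h2] := Hr _ b1; exists (r / 2); split=> //; apply: ltW.
Qed.

(** The dominant index [j] at density [b + 2 r] is trapped between [b + r / 2] and [b + 4 r] (in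
    units of [N * s]) by comparison with the densities [b + r] and [b + 3 r]. Then [m n <= j], and
    monotonicity in the size transfers the bound. Positivity of the count is recorded because
    [Pm_upper] assumes it. *)
Lemma Pm_lower (b e : R) (m : nat -> nat) : 0 < b -> q%:R * b ^+ q < 1 -> 0 < e ->
  (m n)%:R / (N n * s n) @[n --> \oo] --> b ->
  \forall n \near \oo, (0 < hc n (m n))%N /\
    - (b ^+ k / k%:R) - e <= ln (Pm_free R H n (m n)) / (N n * s n).
Proof.
move=> b0 bq e0 mb.
have [r [r0 rq rpsi]] := lower_params b0 bq (divr_gt0 e0 (ltr0n _ 2)).
set x0 := b + r; set x1 := b + 2 * r in rpsi; set x2 := b + 3 * r in rq.
set y := b + 4 * r in rpsi; set y0 := b + r / 2.
have x00 : 0 < x0 by rewrite addr_gt0.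
have r20 : 0 < 2 * r by rewrite mulr_gt0.
have r30 : 0 < 3 * r by rewrite mulr_gt0.
have x10 : 0 < x1 by rewrite addr_gt0.
have x20 : 0 < x2 by rewrite addr_gt0.
have y00 : 0 < y0 by rewrite addr_gt0 // divr_gt0.
have x01 : x0 < x1 by rewrite /x0 /x1 ltrD2l mulr_natl mulr2n ltrDr.
have x12 : x1 < x2 by rewrite /x1 /x2 ltrD2l ltr_pM2r // ltr_nat.
have L01 : 0 < log_activity x1 - log_activity x0 by rewrite subr_gt0; apply: log_activity_lt.
have L12 : 0 < log_activity x2 - log_activity x1 by rewrite subr_gt0; apply: log_activity_lt.
pose tau := Num.min (r / 2 * (log_activity x1 - log_activity x0) / 3) (Num.min (r * (log_activity x2 - log_activity x1) / 3) (e / 4)).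
have tau0 : 0 < tau by rewrite !lt_min !divr_gt0 // !mulr_gt0 // invr_gt0.
have tau1 : tau <= r / 2 * (log_activity x1 - log_activity x0) / 3 by rewrite ge_min lexx.
have tau2 : tau <= r * (log_activity x2 - log_activity x1) / 3 by rewrite !ge_min lexx orbT.
have tau3 : tau <= e / 4 by rewrite !ge_min lexx !orbT.
have u01 : 0 <= q%:R * x2 ^+ q < 1 by rewrite rq andbT mulr_ge0 // exprn_ge0 // ltW.
have HZ := ln_Z_near u01 tau0.
near=> n.
have s0 : 0 < s n by near: n; exact: scale_near_gt0.
have Ns0 : 0 < N n * s n by near: n; exact: card_Kn_scale_gt0.
have N0 : 0 < N n by rewrite -(pmulr_lgt0 _ s0).
have HZn : forall x, 0 <= x -> q%:R * x ^+ q <= q%:R * x2 ^+ q ->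
  `|ln (Z n (s n * activity x)) - N n * s n * freeEnergy x| <= tau * (N n * s n).
  by near: n.
have lN : 1 + ln (N n + 1) <= tau * (N n * s n).
  by near: n; exact: (ln_card_Kn_near tau0).
have my : (m n)%:R / (N n * s n) < y0.
  by near: n; apply: (cvgr_lt _ mb); rewrite /y0 ltrDl divr_gt0.
have lN' : ln (N n + 1) <= tau * (N n * s n).
  by apply: le_trans lN; rewrite lerDr.
set M := N n * s n in Ns0 HZn lN lN' my *.
have HZi x : 0 < x -> x <= x2 -> M * freeEnergy x - tau * M <= ln (Z n (s n * activity x))
    <= M * freeEnergy x + tau * M.
  move=> xx0 xx2; rewrite -ler_distl; apply: HZn; first exact: ltW.
  by rewrite ler_wpM2l // lerXn2r ?nnegrE ?(ltW xx0) ?(ltW x20).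
have l10 : 0 < s n * activity x1 by rewrite mulr_gt0 ?activity_gt0.
have [j jN jmax] := hcZ_le_max (Kn n) (copies H n) (ltW l10).
have j0 : (0 < hc n j)%N.
  rewrite lt0n; apply/eqP => j0; have := hcZ_gt0 n (ltW l10).
  by rewrite ltNge => /negP; apply; move: jmax; rewrite j0 mul0r mulr0.
have jR : 0 < (hc n j)%:R :> R by rewrite ltr0n.
have z1 : ln (Z n (s n * activity x1)) <=
    ln (N n + 1) + (ln (hc n j)%:R + j%:R * (ln (s n) + log_activity x1)).
  rewrite -ln_scale_activity // mulr_natl -lnXn // -lnM ?posrE ?exprn_gt0 //.
  rewrite natr1 -lnM ?posrE ?mulr_gt0 ?exprn_gt0 // ler_ln ?posrE ?hcZ_gt0 ?(ltW l10) //.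
  by rewrite !mulr_gt0 // exprn_gt0.
have /andP[zx1 _] := HZi x1 x10 (ltW x12).
have /andP[_ zx0] := HZi x0 x00 (ltW (lt_trans x01 x12)).
have /andP[_ zx2] := HZi x2 x20 (lexx _).
have jy0 : y0 * M <= j%:R.
  apply: (level_ge_arith z1 (ln_hcN_le s0 x00 jN j0) zx1 zx0 lN'
    (freeEnergy_slope_ge x00 (ltW x01)) Ns0 (log_activity_lt x00 x01)).
  exact: slope_slack tau1.
have jy : j%:R <= y * M.
  apply: (level_le_arith z1 (ln_hcN_le s0 x20 jN j0) zx1 zx2 lN'
    (freeEnergy_slope_le x10 (ltW x12)) Ns0 (log_activity_lt x10 x12)).
  exact: slope_slack' tau2.
have mj : (m n <= j)%N.
  by rewrite -(ler_nat R); apply: le_trans jy0; rewrite -ler_pdivrMr // ltW.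
have jp : 0 < j%:R :> R by apply: lt_le_trans jy0; rewrite mulr_gt0.
have Cj : 0 < 'C(#|Kn n|, j)%:R :> R by rewrite ltr0n bin_gt0.
have Cm : 0 < 'C(#|Kn n|, m n)%:R :> R by rewrite ltr0n bin_gt0 (leq_trans mj).
have anti : (hc n j)%:R / 'C(#|Kn n|, j)%:R <= (hc n (m n))%:R / 'C(#|Kn n|, m n)%:R :> R.
  by apply: hcN_ratio_anti; rewrite mj.
have pj : 0 < (hc n j)%:R / 'C(#|Kn n|, j)%:R :> R by rewrite divr_gt0.
have pm : 0 < (hc n (m n))%:R / 'C(#|Kn n|, m n)%:R :> R by apply: lt_le_trans anti.
split; first by move: pm; rewrite pmulr_lgt0 ?invr_gt0 // ltr0n.
rewrite Pm_freeE ler_pdivlMr //.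
apply: le_trans (_ : ln ((hc n j)%:R / 'C(#|Kn n|, j)%:R) <= _); last by rewrite ler_ln ?posrE.
rewrite ln_div ?posrE //.
(* The convex function [z ln z] lies above its tangent at [x1 * M]. *)
have tangent : j%:R * (ln x1 + (ln (N n) + ln (s n))) + j%:R - x1 * M <= j%:R * ln j%:R.
  have xM : 0 < x1 * M / j%:R by rewrite divr_gt0 // mulr_gt0.
  have := @le_ln1Dx R (x1 * M / j%:R - 1).
  have -> : 1 + (x1 * M / j%:R - 1) = x1 * M / j%:R by rewrite addrC subrK.
  move=> /(_ _)/wrap[]; first by rewrite ltrBrDr addNr.
  rewrite ln_div ?posrE ?mulr_gt0 // lnM ?posrE //.
  have -> : ln M = ln (N n) + ln (s n) by rewrite /M lnM ?posrE.
  exact: tangent_arith.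
have lC : ln 'C(#|Kn n|, j)%:R <= j%:R * (1 + ln (N n) - ln j%:R) :> R.
  by apply: ln_bin_le; rewrite -(ltr0n R) jp.
have xq0 : 0 <= x1 ^+ q by rewrite exprn_ge0 // ltW.
apply: le_trans (Pm_ge_arith z1 zx1 lN' lC tangent jy xq0).
rewrite mulrC ler_wpM2l ?(ltW Ns0) //.
exact: half_slack rpsi tau3.
Unshelve. all: by end_near. Qed.

(** The term bound is applied at the activity of density [b]. The positivity assumption keeps the
    logarithm meaningful; [Pm_lower] provides it. *)
Lemma Pm_upper (b e : R) (m : nat -> nat) : 0 < b -> q%:R * b ^+ q < 1 -> 0 < e ->
  (m n)%:R / (N n * s n) @[n --> \oo] --> b ->
  \forall n \near \oo, (0 < hc n (m n))%N ->
    ln (Pm_free R H n (m n)) / (N n * s n) <= - (b ^+ k / k%:R) + e.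
Proof.
move=> b0 bq e0 mb.
have e8 : 0 < e / 8 by rewrite divr_gt0.
(* Replacing [ln (N - m)] by [ln N] costs at most [y * m / (N - m) <= 2 b * 2 d] per unit of
   [N * s], and this is at most [e / 8]. *)
pose d := Num.min 2^-1 (e / (32 * b)).
have d0 : 0 < d.
  rewrite lt_min; apply/andP; split; first by rewrite invr_gt0.
  by rewrite divr_gt0 // mulr_gt0.
have d1 : d <= 2^-1 by rewrite ge_min lexx.
have db : 32 * b * d <= e.
  by rewrite mulrC -ler_pdivlMr ?mulr_gt0 // /d ge_min lexx orbT.
have u01 : 0 <= q%:R * b ^+ q < 1 by rewrite bq andbT mulr_ge0 // exprn_ge0 // ltW.
have HZ := ln_Z_near u01 e8.
have mN0 : (m n)%:R / N n @[n --> \oo] --> 0.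
  have : (m n)%:R / (N n * s n) * s n @[n --> \oo] --> b * 0.
    by apply: cvgM => //; exact: scale_cvg0.
  rewrite mulr0; apply: cvg_trans; apply: near_eq_cvg; near=> n.
  have s0 : 0 < s n by near: n; exact: scale_near_gt0.
  by rewrite invfM mulrA divfK // gt_eqF.
(* What the binomial coefficient and the factor [lam ^+ m] contribute at density [y]; the powers of
   [N] and [s] cancel, and [freeEnergy b + F b] is the limit. *)
pose F (y : R) := y * ln y - y * log_activity b - y.
have Fm : F ((m n)%:R / (N n * s n)) @[n --> \oo] --> F b.
  apply: cvgB => //; apply: cvgB; last by apply: cvgM => //; exact: cvg_cst.
  by apply: cvgM => //; apply: continuous_cvg => //; exact: continuous_ln.
near=> n => hm.
have s0 : 0 < s n by near: n; exact: scale_near_gt0.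
have Ns0 : 0 < N n * s n by near: n; exact: card_Kn_scale_gt0.
have N0 : 0 < N n by rewrite -(pmulr_lgt0 _ s0).
have HZn : forall x, 0 <= x -> q%:R * x ^+ q <= q%:R * b ^+ q ->
  `|ln (Z n (s n * activity x)) - N n * s n * freeEnergy x| <= e / 8 * (N n * s n).
  by near: n.
have lN : 1 + ln (N n + 1) <= e / 8 * (N n * s n).
  by near: n; exact: (ln_card_Kn_near e8).
have mNd : (m n)%:R / N n < d by near: n; apply: (cvgr_lt _ mN0).
have y0 : 0 < (m n)%:R / (N n * s n) by near: n; apply: (cvgr_gt _ mb).
have y2b : (m n)%:R / (N n * s n) < 2 * b.
  by near: n; apply: (cvgr_lt _ mb); rewrite mulr_natl mulr2n ltrDr.
have Fy : F ((m n)%:R / (N n * s n)) < F b + e / 8.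
  by near: n; apply: (cvgr_lt _ Fm); rewrite ltrDl.
have yE : (m n)%:R = (m n)%:R / (N n * s n) * (N n * s n) by rewrite divfK // gt_eqF.
set y := (m n)%:R / (N n * s n) in y0 y2b Fy yE *.
have m0 : 0 < (m n)%:R :> R by rewrite yE mulr_gt0.
have mN : (m n)%:R <= 2^-1 * N n.
  by rewrite -ler_pdivrMr // (le_trans (ltW mNd)).
have mNlt : (m n)%:R < N n by apply: le_lt_trans mN _; rewrite gtr_pMl // invf_lt1 // ltr1n.
have NmR : 0 < N n - (m n)%:R by rewrite subr_gt0.
have mNn : (m n < #|Kn n|)%N by rewrite -(ltr_nat R).
have h2 : ln (Z n (s n * activity b)) <= N n * s n * freeEnergy b + e / 8 * (N n * s n).
  by have := HZn b (ltW b0) (lexx _); rewrite ler_distl => /andP[].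
have h3' : 1 + ln (m n)%:R <= e / 8 * (N n * s n).
  have N1 : 0 < N n + 1 by rewrite addr_gt0.
  apply: le_trans lN; rewrite lerD2l ler_ln ?posrE //.
  by rewrite (le_trans (ltW mNlt)) // lerDl.
have h4 : (m n)%:R * (1 + ln (N n - (m n)%:R) - ln (m n)%:R) - (1 + ln (m n)%:R)
    <= ln 'C(#|Kn n|, m n)%:R.
  by apply: ln_bin_ge; rewrite mNn -(ltr0n R) m0.
have h5 : ln (m n)%:R = ln y + (ln (N n) + ln (s n)).
  by rewrite [X in ln X = _]yE lnM ?posrE // [ln (N n * s n)]lnM ?posrE.
have h6 : ln (N n) - ln (N n - (m n)%:R) <= (m n)%:R / (N n - (m n)%:R).
  rewrite -ln_div ?posrE //.
  have -> : N n / (N n - (m n)%:R) = 1 + (m n)%:R / (N n - (m n)%:R).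
    exact: div_subE (lt0r_neq0 NmR).
  by apply: le_ln1Dx; apply: (lt_le_trans (ltrN10 _)); rewrite divr_ge0 ?ltW.
have h1 := ln_hcN_le s0 b0 (ltnW mNn) hm.
rewrite Pm_freeE ler_pdivrMr // ln_div ?posrE ?ltr0n ?bin_gt0 ?(ltnW mNn) //.
apply: le_trans (Pm_le_arith h1 h2 h3' h4 h5 h6 (ltW m0) yE) _.
rewrite mulrC ler_wpM2r ?(ltW Ns0) //.
have dN : y * ((m n)%:R / (N n - (m n)%:R)) <= e / 8.
  apply: (@le_trans _ _ (2 * b * (2 * d))); last exact: quarter_slack db.
  apply: ler_pM; [exact: ltW | by rewrite divr_ge0 ?ltW | exact: ltW |].
  rewrite ler_pdivrMr //; exact: (double_slack N0 mNd mN (ltW d0)).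
have Fb : freeEnergy b + F b = - (b ^+ k / k%:R).
  rewrite /F freeEnergyE // /log_activity [b * (_ + _)]mulrDr -exprS -kq.
  by move: (b ^+ k / k%:R) (b ^+ k) (b * ln b) => w K l; ring.
exact: (sum_slack e0 Fb Fy dN).
Unshelve. all: by end_near. Qed.

Lemma ln_Pm_cvg (b : R) (m : nat -> nat) :
  0 < b -> b < (k - 1)%:R `^ (- (k - 1)%:R^-1) ->
  (m n)%:R / (b * (DeltaH R H n `^ (- (k - 1)%:R^-1)) * ('C(n, 2))%:R)
    @[n --> \oo] --> (1 : R) ->
  DeltaH R H n `^ ((k - 1)%:R^-1) / ('C(n, 2))%:R * ln (Pm_free R H n (m n))
    @[n --> \oo] --> - (b ^+ k / k%:R).
Proof.
move=> b0 bk mb.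
have Q0 : 0 < q%:R :> R by rewrite ltr0n.
have bq : q%:R * b ^+ q < 1.
  rewrite mulrC -ltr_pdivlMr // mul1r.
  have : b ^+ q < ((k - 1)%:R `^ (- (k - 1)%:R^-1)) ^+ q.
    by rewrite ltrXn2r // -?lt0n // ltW.
  rewrite subn1 -[X in _ < X -> _]powR_mulrn ?powR_ge0 // -powRrM mulNr mulVf ?gt_eqF //.
  by rewrite powR_inv1 // ltW.
have yb : (m n)%:R / (N n * s n) @[n --> \oo] --> b.
  have : (m n)%:R / (b * s n * 'C(n, 2)%:R) * b @[n --> \oo] --> 1 * b.
    by apply: cvgM; [exact: mb | exact: cvg_cst].
  rewrite mul1r; apply: cvg_trans; apply: near_eq_cvg; near=> n.
  rewrite card_Kn (_ : b * s n * 'C(n, 2)%:R = 'C(n, 2)%:R * s n * b); last by ring.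
  by rewrite invfM mulrA divfK // gt_eqF.
apply/cvgrPdist_le => e e0.
have Hlo := Pm_lower b0 bq e0 yb.
have Hup := Pm_upper b0 bq e0 yb.
near=> n.
have [hm lo] : (0 < hc n (m n))%N /\
    - (b ^+ k / k%:R) - e <= ln (Pm_free R H n (m n)) / (N n * s n) by near: n.
have up : (0 < hc n (m n))%N -> ln (Pm_free R H n (m n)) / (N n * s n) <= - (b ^+ k / k%:R) + e.
  by near: n.
by rewrite scale_normE distrC ler_distl lo up.
Unshelve. all: by end_near. Qed.

End Limits.

Theorem mainTheorem1 (R : realType) (V : finType) (H : {set {set V}})
  (Hsimple : simple_graph H) (Hbal : strictly_2_balanced H) :
  let k := #|H| in
  (forall (c : R) (p : nat -> R),
     0 < c -> c < (expR 1 / (k - 1)%:R) `^ ((k - 1)%:R^-1) ->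
     (forall n, 0 <= p n <= 1) ->
     p n / (c * (DeltaH R H n `^ (- (k - 1)%:R^-1))) @[n --> \oo] --> (1 : R) ->
     let xs := (LambertW ((k - 1)%:R * c ^+ (k - 1)) / (k - 1)%:R) `^ ((k - 1)%:R^-1) in
     DeltaH R H n `^ ((k - 1)%:R^-1) / ('C(n, 2))%:R * ln (Pp_free H n (p n))
       @[n --> \oo] --> xs + (1 - k%:R^-1) * xs ^+ k - c)
  /\
  (forall (b : R) (m : nat -> nat),
     0 < b -> b < (k - 1)%:R `^ (- (k - 1)%:R^-1) ->
     (m n)%:R / (b * (DeltaH R H n `^ (- (k - 1)%:R^-1)) * ('C(n, 2))%:R)
       @[n --> \oo] --> (1 : R) ->
     DeltaH R H n `^ ((k - 1)%:R^-1) / ('C(n, 2))%:R * ln (Pm_free R H n (m n))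
       @[n --> \oo] --> - (b ^+ k / k%:R)).
Proof.
by move=> k; split=> [c p|b m]; [exact: ln_Pp_cvg | exact: ln_Pm_cvg].
Qed.
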